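(* Let $Z=\mathbb R^{2N}$, let $E$ be an affine subspace of $Z$ of dimension $N$, $E_0$ its translate through the origin, $E_0^\perp$ the orthogonal complement of $E_0$, $\mu_D=L_D\,\mathcal L^{2N}$ with $L_D\in L^1_{\rm loc}(Z)$ non-negative, and $\mu=\mu_D\times(\mathcal H^N\llcorner E)$. Assume: (a) $L_D(\xi)=\lim_{\lambda\to+\infty}L_D(\xi+\eta/\lambda)$ for $\mathcal H^N$-a.e. $\xi\in E$ and $\mathcal H^N$-a.e. $\eta\in E_0^\perp$; (b) there are $g_0\in L^1(E\times E_0^\perp\times E_0;\mathcal H^{3N})$, $\lambda_0>0$, $\beta_0>0$ such that $e^{-\beta_0(\|\eta\|^2+\|\zeta\|^2)}L_D(\xi+\eta/\lambda)\le g_0(\xi,\eta,\zeta)$ for $\mathcal H^{3N}$-a.e. $(\xi,\eta,\zeta)$ and all $\lambda\ge\lambda_0$; (c) the function $\hat g(\xi):=\sup_{\eta\in E_0^\perp}L_D(\xi+\eta)$, $\xi\in E$, belongs to $L^1(E;\mathcal H^N)$; (d) $0<\int_E L_D\,d\mathcal H^N<\infty$. For every $h\in\mathbb N$ let $(A_{h,i})_{i\in\mathbb N}$ be a partition of $Z$ into bounded Borel sets, let $y_{h,i}\in A_{h,i}$, $c_{h,i}:=\mu_D(A_{h,i})$, $\mu_{D,h}:=\sum_{i=1}^\infty c_{h,i}\,\delta_{y_{h,i}}$, $\mu_h:=\mu_{D,h}\times(\mathcal H^N\llcorner E)$, and for $y\in Z$ let $\delta_h(y)$ be the diameter of the cell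 $A_{h,i}$ containing $y$. Let $(\beta_h)$ be positive numbers with $\beta_h\to+\infty$, $\lambda_h:=\sqrt{\beta_h/\beta_0}$, and assume $\lim_{h\to\infty}\lambda_h\sup_{y\in Z}\delta_h(y)=0$. Let $z_{h,i}:=P_E(y_{h,i})$ and, for $f\in C_c(Z)$, $$f_{h,i}:=C_{\beta_h}^{-1}\int_{E_0}f(z_{h,i}+\xi)\,e^{-\beta_h\|\xi\|^2}\,d\mathcal H^N(\xi),\qquad C_{\beta_h}:=\int_{E_0}e^{-\beta_h\|\xi\|^2}\,d\mathcal H^N(\xi).$$ Then, for every $f\in C_c(Z)$ and all sufficiently large $h$, the approximate expectation $\mathbb E_h[f]:=|\mu_{h,\beta_h}|^{-1}\int_{Z\times Z}f(z)\,d\mu_{h,\beta_h}(y,z)$ is given by $$\mathbb E_h[f]=\frac{\sum_{i=1}^\infty c_{h,i}\,f_{h,i}\,e^{-\beta_h\|y_{h,i}-z_{h,i}\|^2}}{\sum_{i=1}^\infty c_{h,i}\,e^{-\beta_h\|y_{h,i}-z_{h,i}\|^2}},$$ and $$\lim_{h\to\infty}\mathbb E_h[f]=\mathbb E_\infty[f]:=\frac{\int_E f(\xi)L_D(\xi)\,d\mathcal H^N(\xi)}{\int_E L_D(\xi)\,d\mathcal H^N(\xi)}.$$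
   Context: $N\ge1$ is an integer; $Z=\mathbb R^{2N}$ is endowed with a scalar product, with corresponding norm $\|\cdot\|$; orthogonality and diameters refer to this scalar product and norm, and $P_E$ is the orthogonal (closest-point) projection of $Z$ onto $E$. $\mathcal H^N$ is the $N$-dimensional Hausdorff measure and $\mathcal H^N\llcorner E$ its restriction to $E$; on $E\times E_0^\perp\times E_0$, $\mathcal H^{3N}$ is the product of the three measures $\mathcal H^N$. $L_D:Z\to[0,\infty)$ is regarded as a fixed, pointwise defined function. $C_c(Z)$ is the set of continuous compactly supported real functions on $Z$; $|\nu|$ is the total mass of a positive measure $\nu$. For $\beta>0$, the thermalized measure of $\mu_h$ is $$\mu_{h,\beta}:=w_\beta\,\mu_h,\quad w_\beta(y,z):=B_\beta^{-1}e^{-\beta\|y-z\|^2},\quad B_\beta:=\int_Z e^{-\beta\|\xi\|^2}\,d\xi .$$ *)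

(* Defs.v *)
From HB Require Import structures.
From mathcomp Require Import all_boot all_order all_algebra.
From mathcomp Require Import all_classical all_reals all_analysis.

Set Implicit Arguments.
Unset Strict Implicit.
Unset Printing Implicit Defensive.

Import Order.TTheory GRing.Theory Num.Theory.
Import numFieldNormedType.Exports.

Local Open Scope classical_set_scope.
Local Open Scope ring_scope.

(* The library's integrals, product measures and a.e. filters take plain set
   functions [set T -> \bar R], evaluated on the sigma-algebra of [T]; the
   measures below are given as such set functions.  The sigma-algebra of R^n
   is the Borel one, so outer measures on R^n become Borel measures. *)

Section borel_rV.
Context (R : realType) (n : nat).

Let borel : set (set 'rV[R]_n) := <<s @open 'rV[R]_n >>.

Let borel0 : borel set0.
Proof. exact: sigma_algebra0. Qed.

Let borelC (A : set 'rV[R]_n) : borel A -> borel (~` A).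
Proof. by move=> mA; rewrite -setTD; exact: sigma_algebraCD. Qed.

Let borel_bigcup (F : (set 'rV[R]_n)^nat) :
  (forall i, borel (F i)) -> borel (\bigcup_i F i).
Proof. exact: sigma_algebra_bigcup. Qed.

HB.instance Definition _ := @isMeasurable.Build
  (sigma_display (@open 'rV[R]_n)) 'rV[R]_n borel borel0 borelC borel_bigcup.

End borel_rV.

Section measures.
Local Open Scope ereal_scope.
Context d (T : measurableType d) (R : realType).
Implicit Types (mu : set T -> \bar R) (A D : set T).

Definition restriction mu D : set T -> \bar R := fun A => mu (A `&` D).

Definition density (w : T -> R) mu : set T -> \bar R :=
  fun A => \int[mu]_(x in A) (w x)%:E.

Definition atomic (c : nat -> \bar R) (y : nat -> T) : set T -> \bar R :=
  fun A => \sum_(0 <= i <oo) c i * \d_(y i) A.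

(* The library's [integrable] asks for measurability with respect to the
   sigma-algebra of [T]; functions in L^1 need only be measurable for its
   completion, i.e. agree a.e. with such a function.  For such a function
   the library integral has the same value as that of the representative. *)
Definition L1 mu D (f : T -> \bar R) : Prop :=
  exists2 g : T -> \bar R, mu.-integrable D g &
    {ae mu, forall x, D x -> f x = g x}.

End measures.

(* Lebesgue (outer) measure on R^n, by countable covers with boxes. *)
Definition lebesgue_rV (R : realType) (n : nat) (A : set 'rV[R]_n) : \bar R :=
  ereal_inf
    [set (\sum_(0 <= k <oo) (\prod_(j < n) ((ab.2 k) 0 j - (ab.1 k) 0 j))%:E)%E
    | ab in [set ab : (nat -> 'rV[R]_n) * (nat -> 'rV[R]_n) |
        (forall k j, (ab.1 k) 0 j <= (ab.2 k) 0 j) /\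
        A `<=` \bigcup_k [set x | forall j,
                            (ab.1 k) 0 j < x 0 j <= (ab.2 k) 0 j]]].

(* Volume of the Euclidean unit ball of R^n, pi^(n/2) / Gamma(n/2 + 1). *)
Fixpoint unit_ball_volume (R : realType) (n : nat) : R :=
  match n with
  | 0 => 1
  | 1 => 2
  | m.+2 => 2 * pi / m.+2%:R * unit_ball_volume R m
  end.

Section euclidean.
Context (R : realType) (n : nat).
Local Notation Z := 'rV[R]_n.
Context (ip : {dot Z for idfun}).

Definition ipnorm (x : Z) : R := Num.sqrt (ip x x).

(* The adjoined 0 only matters for the empty set. *)
Definition diam (A : set Z) : \bar R :=
  ereal_sup ([set 0%E] `|`
             [set (ipnorm (p.1 - p.2))%:E | p in [set p : Z * Z | A p.1 /\ A p.2]]).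

Definition hausdorff_size (s : nat) (delta : R) (A : set Z) : \bar R :=
  ereal_inf
    [set (\sum_(0 <= k <oo)
            (unit_ball_volume R s * (fine (diam (F k)) / 2) ^+ s)%:E)%E
    | F in [set F : nat -> set Z |
        (forall k, (diam (F k) <= delta%:E)%E) /\ A `<=` \bigcup_k F k]].

(* s-dimensional Hausdorff (outer) measure of the metric of [ip], for s >= 1
   (for s = 0 the empty sets of a cover would be counted). *)
Definition hausdorff (s : nat) (A : set Z) : \bar R :=
  ereal_sup [set hausdorff_size s delta A | delta in [set delta : R | 0 < delta]].

Definition hausdorff_on (s : nat) (E : set Z) : set Z -> \bar R :=
  restriction (hausdorff s) E.

Definition is_translate (E0 : {vspace Z}) (E : set Z) : Prop :=
  exists p : Z, E = [set p + v | v in [set` E0]].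

Definition orthocompl (E0 : {vspace Z}) : set Z :=
  [set x | forall v, v \in E0 -> ip x v = 0].

Definition closest_point (E : set Z) (y : Z) : Z :=
  get [set z | E z /\ forall w, E w -> ipnorm (y - z) <= ipnorm (y - w)].

(* Diameter of the cell containing [y], when [A] is a partition. *)
Definition cell_diam (A : nat -> set Z) (y : Z) : \bar R :=
  diam (\bigcup_(i in [set i | A i y]) A i).

Definition L1loc (f : Z -> R) : Prop :=
  forall K : set Z, compact K -> L1 (@lebesgue_rV R n) K (EFin \o f).

Definition Cc (f : Z -> R) : Prop :=
  continuous f /\ compact (closure [set x | f x != 0]).

Definition bounded_for_ip (A : set Z) : Prop :=
  exists M : R, forall x, A x -> ipnorm x <= M.

Definition bounded_borel_partition (A : nat -> set Z) : Prop :=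
  [/\ forall i, measurable (A i), forall i, bounded_for_ip (A i),
      trivIset setT A & \bigcup_i A i = setT].

Definition gauss (beta : R) (x : Z) : R := expR (- (beta * ipnorm x ^+ 2)).

Definition gauss_mass_Z (beta : R) : R :=
  fine (\int[@lebesgue_rV R n]_x (gauss beta x)%:E)%E.

Definition gauss_mass_on (s : nat) (E0 : set Z) (beta : R) : R :=
  fine (\int[hausdorff_on s E0]_x (gauss beta x)%:E)%E.

Definition thermal_weight (beta : R) (p : Z * Z) : R :=
  (gauss_mass_Z beta)^-1 * gauss beta (p.1 - p.2).

Definition thermalized (beta : R) (nu : set (Z * Z) -> \bar R) :
    set (Z * Z) -> \bar R :=
  density (thermal_weight beta) nu.

Definition total_mass (nu : set (Z * Z) -> \bar R) : \bar R := nu setT.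

Definition expectation_z (nu : set (Z * Z) -> \bar R) (f : Z -> R) : R :=
  (fine (total_mass nu))^-1 * fine (\int[nu]_p (f p.2)%:E)%E.

Definition data_measure (L : Z -> R) : set Z -> \bar R :=
  density L (@lebesgue_rV R n).

Definition discretized (s : nat) (E : set Z) (L : Z -> R)
    (A : nat -> set Z) (y : nat -> Z) : set (Z * Z) -> \bar R :=
  (atomic (fun i => data_measure L (A i)) y \x hausdorff_on s E)%E.

Definition smoothed_value (s : nat) (E0 : set Z) (beta : R) (f : Z -> R)
    (z : Z) : R :=
  (gauss_mass_on s E0 beta)^-1 *
  fine (\int[hausdorff_on s E0]_x (f (z + x) * gauss beta x)%:E)%E.

Definition limit_expectation (s : nat) (E : set Z) (L f : Z -> R) : R :=
  fine (\int[hausdorff_on s E]_x (f x * L x)%:E)%E /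
  fine (\int[hausdorff_on s E]_x (L x)%:E)%E.

End euclidean.

(* Main.v *)
From HB Require Import structures.
Require Import Defs.
From mathcomp Require Import all_boot all_order all_algebra.
From mathcomp Require Import all_classical all_reals all_analysis.
From mathcomp Require Import measurable_realfun ring lra.

Set Implicit Arguments.
Unset Strict Implicit.
Unset Printing Implicit Defensive.

Import Order.TTheory GRing.Theory Num.Theory.
Import numFieldNormedType.Exports.

Local Open Scope classical_set_scope.
Local Open Scope ring_scope.

(* By Pythagoras, |y - z|^2 = |y - P_E y|^2 + |z - P_E y|^2 for z in E, so
   integrating out z turns the mass of mu_{h,beta_h} and the integral of f
   against it into sums over the cells, with the common factor
   C_{beta_h} / B_{beta_h}; both sums are integrals over Z of L_D times a
   function of the sample point of the cell.

   Lebesgue measure is kappa times the product of H^N on E and H^N on the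
   orthocomplement of E_0, by uniqueness of Haar measure.  Substituting
   eta / lambda_h for eta, lambda_h^N times such a sum is kappa times the
   integral over (xi, eta) of
     L_D(xi + eta / lambda_h) Phi_h exp(- beta_0 |eta_h|^2),
   where Phi_h -> f(xi) and, the cells being small at the scale 1 / lambda_h,
   eta_h -> eta.  Dominated convergence, first in eta (dominating function:
   ghat(xi) times a Gaussian envelope), then in xi, gives the limit
   kappa (int_E f L_D) (int exp(- beta_0 |eta|^2)), and the constants cancel
   in the quotient.

   L_D is only Lebesgue measurable; it is replaced by a Borel function, which
   agrees with it a.e. on almost every fibre xi + E_0^perp. *)

(** [lebesgue_rV] and [hausdorff] come as set functions built from countable covers, so they must
    first be shown to be measures on the Borel sets; half-spaces suffice for this. Tonelli also asks
    for sigma-finiteness, hence for finite Hausdorff measure of bounded parts of N-planes. The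
    Hausdorff measures on the planes are used later only through concentration on their plane,
    translation invariance, homogeneity of degree N and a unit ball of finite positive mass.

    The residual x - P_E x is 1-Lipschitz, so replacing a point by the sample point of its cell
    moves the rescaled variable eta by at most the rescaled mesh. Once this is at most 1, a Gaussian
    in the positive part of |eta| - 1 dominates all weights.

    Functions that are only Lebesgue measurable occur in the data and in the limit. The integral of
    a nonnegative function is a supremum over simple functions below it, which ignores null sets
    even without measurability; this justifies every exchange of L_D for a Borel function. *)

(** * Borel sets and Borel maps of R^n *)

Section borel_rV_theory.
Context (R : realType).

Lemma open_measurable_rV n (U : set 'rV[R]_n) : open U -> measurable U.
Proof. by move=> oU; exact: sub_sigma_algebra. Qed.

Lemma closed_measurable_rV n (U : set 'rV[R]_n) : closed U -> measurable U.
Proof.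
by move=> cU; rewrite -(setCK U); apply: measurableC; apply: open_measurable_rV;
  exact: closed_openC.
Qed.

Lemma continuous_measurable_rV n (f : 'rV[R]_n -> R) :
  continuous f -> measurable_fun [set: 'rV[R]_n] f.
Proof.
move=> cf; apply: (measurability _ (RGenOInfty.measurableE R)) => //.
move=> _ [_ [a ->] <-]; rewrite setTI; apply: open_measurable_rV.
apply: open_comp; first by move=> x _; exact: cf.
by rewrite set_itvE; exact: open_gt.
Qed.

Lemma measurable_coord n (j : 'I_n) :
  measurable_fun [set: 'rV[R]_n] (fun x : 'rV[R]_n => x 0 j).
Proof. by apply: continuous_measurable_rV; exact: coord_continuous. Qed.

Lemma ball_rVE n (x : 'rV[R]_n) e : 0 < e ->
  ball x e = \bigcap_(j in [set: 'I_n]) [set y | `|x 0 j - y 0 j| < e].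
Proof.
move=> e0; apply/seteqP; split=> y; first by move=> [_ xy] j _ /=; exact: xy.
by move=> xy; split => // i j; rewrite (ord1 i); exact: (xy j).
Qed.

Lemma ratr_approx (a : R) (e : R) : 0 < e -> exists q : rat, `|ratr q - a| < e.
Proof.
move=> e0; have [q] : exists q : rat, ratr q \in `]a, (a + e)[.
  by apply: rat_in_itvoo; rewrite ltrDl.
rewrite in_itv/= => /andP[aq qe]; exists q.
by rewrite gtr0_norm ?subr_gt0// ltrBlDl.
Qed.

(** Second countability of R^n, in the form that lets Borel measurability be tested on countably
    many rational balls. *)
Lemma open_rV_bigcup n (U : set 'rV[R]_n) : open U ->
  U = \bigcup_(p in [set p : 'rV[rat]_n * rat | 0 < (ratr p.2 : R) /\
     ball (map_mx ratr p.1 : 'rV[R]_n) (ratr p.2) `<=` U])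
     ball (map_mx ratr p.1 : 'rV[R]_n) (ratr p.2).
Proof.
move=> oU; apply/seteqP; split=> x; last by move=> [p [_ pU]]; exact: pU.
move=> Ux; have /nbhs_ballP[e /= e0 xU] := open_nbhs_nbhs (conj oU Ux).
have [r] : exists r : rat, ratr r \in `]0, (e / 2)[.
  by apply: rat_in_itvoo; rewrite divr_gt0.
rewrite in_itv/= => /andP[r0 re].
have /choice[q qx] : forall j, exists q : rat, `|ratr q - x 0 j| < (ratr r : R).
  by move=> j; exact: ratr_approx.
have xq : ball (map_mx ratr (\row_j q j) : 'rV[R]_n) (ratr r) x.
  by split=> // i j; rewrite !mxE (ord1 i); exact: qx.
exists (\row_j q j, r) => //=; split=> // y yq; apply: xU.
by apply: (le_ball _ (ball_triangle (ball_sym xq) yq)); rewrite [leRHS]splitr lerD// ltW.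
Qed.

(** Balls of the sup norm are finite intersections of coordinate conditions, which reduces the
    sigma-algebra of the open sets to the coordinates. *)
Lemma measurable_fun_rV d (T : measurableType d) n (f : T -> 'rV[R]_n) :
  (forall j, measurable_fun [set: T] (fun x => f x 0 j)) ->
  measurable_fun [set: T] f.
Proof.
move=> mf; apply: (measurability (@open 'rV[R]_n)) => //.
move=> _ [U oU <-]; rewrite setTI (open_rV_bigcup oU) preimage_bigcup.
rewrite bigcup_mkcond; apply: countable_bigcupT_measurable => [|p]; first exact: countableP.
case: ifPn => // /set_mem[r0 _].
rewrite ball_rVE// preimage_bigcap.
apply: fin_bigcap_measurable => // j _ /=.
rewrite (_ : _ @^-1` _ = (fun x => `|map_mx ratr p.1 0 j - f x 0 j|) @^-1` [set` `]-oo,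
  (ratr p.2:R)[]); last first.
  by apply/seteqP; split=> x /=; rewrite in_itv.
rewrite -[X in measurable X]setTI.
have mF : measurable_fun setT (fun x => `|(map_mx ratr p.1 : 'rV[R]_n) 0 j - f x 0 j|).
  by apply: measurableT_comp => //; exact: measurable_funB.
exact: mF.
Qed.

Lemma measurable_funD_rV d (T : measurableType d) n (f g : T -> 'rV[R]_n) :
  measurable_fun [set: T] f -> measurable_fun [set: T] g ->
  measurable_fun [set: T] (fun x => f x + g x).
Proof.
move=> mf mg; apply: measurable_fun_rV => j.
under eq_fun do rewrite mxE.
by apply: measurable_funD; exact: measurableT_comp (measurable_coord j) _.
Qed.

Lemma measurable_funZ_rV d (T : measurableType d) n (f : T -> 'rV[R]_n) (a : R) :
  measurable_fun [set: T] f -> measurable_fun [set: T] (fun x => a *: f x).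
Proof.
move=> mf; apply: measurable_fun_rV => j.
under eq_fun do rewrite mxE.
by apply: measurable_funM => //; exact: measurableT_comp (measurable_coord j) _.
Qed.

Lemma measurable_funB_rV d (T : measurableType d) n (f g : T -> 'rV[R]_n) :
  measurable_fun [set: T] f -> measurable_fun [set: T] g ->
  measurable_fun [set: T] (fun x => f x - g x).
Proof.
move=> mf mg; apply: measurable_funD_rV => //.
by under eq_fun do rewrite -scaleN1r; exact: measurable_funZ_rV.
Qed.

End borel_rV_theory.

(** * Outer measures defined by countable covers *)

Section cover_outer_measure.
Local Open Scope ereal_scope.
Context (R : realType) (T I : Type) (D : set I) (tau : I -> \bar R) (S : I -> set T).
Hypothesis tau_ge0 : forall i, D i -> 0 <= tau i.

(** Common form of two constructions: for [hausdorff_size] an index is the covering set itself, for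
    [lebesgue_rV] a pair of corners. The condition [D] restricts the indices because the volume of a
    pair of unordered corners may be negative. *)
Definition cover_size (A : set T) : \bar R :=
  ereal_inf [set \sum_(0 <= k <oo) tau (s k)
            | s in [set s : nat -> I | (forall k, D (s k)) /\ A `<=` \bigcup_k S (s k)]].

Lemma cover_size_ge0 A : 0 <= cover_size A.
Proof.
by apply: le_ereal_inf_tmp => _ [s [Ds _] <-]; apply: nneseries_ge0 => k _ _; exact: tau_ge0.
Qed.

Lemma le_cover_size : {homo cover_size : A B / A `<=` B >-> A <= B}.
Proof.
move=> A B AB; apply: ereal_inf_le_tmp => _ [s [Ds Bs] <-].
by exists s => //; split => //; exact: subset_trans Bs.
Qed.

Lemma cover_size0 i0 : D i0 -> tau i0 = 0 -> cover_size set0 = 0.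
Proof.
move=> Di0 ti0; apply/eqP; rewrite eq_le cover_size_ge0 andbT.
apply: ereal_inf_lbound; exists (fun=> i0); first by split=> // x.
by rewrite eseries0.
Qed.

Lemma cover_size_sigma_subadditive : sigma_subadditive cover_size.
Proof.
move=> A; have [[i ioo]|] := pselect (exists i, cover_size (A i) = +oo).
  rewrite (eseries_pinfty _ _ ioo) ?leey// => n _.
  by rewrite -ltNye (lt_le_trans _ (cover_size_ge0 _)).
rewrite -forallNE => Aoo.
apply/lee_addgt0Pr => e e0.
have := epsilon_trick xpredT (fun n => cover_size_ge0 (A n)) (ltW e0).
apply: le_trans.
have [G PG] : {G : nat -> nat -> I & forall n,
    [/\ forall k, D (G n k), A n `<=` \bigcup_k S (G n k) &
     \sum_(0 <= k <oo) tau (G n k) <= cover_size (A n) + (e / (2 ^ n.+1)%:R)%:E]}.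
  apply: (@choice _ _ (fun n (s : nat -> I) => [/\ forall k, D (s k), A n `<=` \bigcup_k S (s k) &
     \sum_(0 <= k <oo) tau (s k) <= cover_size (A n) + (e / (2 ^ n.+1)%:R)%:E])) => n.
  have en0 : (0 < e / (2 ^ n.+1)%:R)%R by rewrite divr_gt0// ltr0n expn_gt0.
  have fA : cover_size (A n) \is a fin_num.
    by rewrite ge0_fin_numE ?cover_size_ge0// ltey; apply/eqP; exact: Aoo.
  have [_ [s [Ds As] <-] /ltW sA] := lb_ereal_inf_adherent en0 fA.
  by exists s.
have DG n k : D (G n k) by have [] := PG n.
(* A bijection between [nat] and [nat * nat] merges the covers of all [A n] into one; [esum] takes
   care of the order of summation. *)
have /card_esym/ppcard_eqP[f] := card_nat2.
have fbij : set_bij [set: nat] [set: nat * nat] f by [].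
apply: (@le_trans _ _ (\sum_(0 <= k <oo) tau (G (f k).1 (f k).2))).
  apply: ereal_inf_lbound; exists (fun k => G (f k).1 (f k).2) => //; split.
    by move=> k; exact: DG.
  move=> t [n _ Ant]; have [_ /(_ _ Ant) [k _ St] _] := PG n.
  by exists (f^-1%FUN (n, k)) => //; rewrite invK ?inE.
rewrite nneseries_esumT; last by move=> k; exact: tau_ge0.
rewrite -(@reindex_esum _ _ _ setT setT f (fun p => tau (G p.1 p.2)))//.
rewrite (_ : [set: nat * nat] = [set: nat] `*`` (fun=> [set: nat])); last first.
  by apply/seteqP; split => -[].
rewrite -(@esum_esum _ _ _ setT (fun=> setT) (fun i j => tau (G i j))); last first.
  by move=> i j _ _; exact: tau_ge0.
rewrite -nneseries_esumT; last by move=> n; apply: esum_ge0 => k _; exact: tau_ge0.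
apply: lee_nneseries => n _; first by move=> _; apply: esum_ge0 => k _; exact: tau_ge0.
rewrite -nneseries_esumT; last by move=> k; exact: tau_ge0.
by have [] := PG n.
Qed.

End cover_outer_measure.

(** * Caratheodory measurability of Borel sets *)

Section caratheodory_borel.
Local Open Scope ereal_scope.
Context (R : realType) (n : nat) (mu : {outer_measure set 'rV[R]_n -> \bar R}).

(** The identity is viewed as a map from the Caratheodory sigma-algebra to R^n; its measurability,
    checked on coordinates, is the claim. *)
Lemma borel_caratheodory :
  (forall (j : 'I_n) (c : R), mu.-caratheodory [set x : 'rV[R]_n | x 0%R j <= c]%R) ->
  forall A : set 'rV[R]_n, measurable A -> mu.-caratheodory A.
Proof.
move=> mu_half A mA; pose f : caratheodory_type mu -> 'rV[R]_n := idfun.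
have mf : measurable_fun setT f.
  apply: measurable_fun_rV => j.
  apply: (measurability _ (RGenOInfty.measurableE R)) => //.
  move=> _ [_ [a ->] <-]; rewrite setTI.
  have -> : (fun x => f x 0%R j) @^-1` `]a, +oo[ = ~` [set x : 'rV[R]_n | x 0%R j <= a]%R.
    by apply/seteqP; split=> x /=; rewrite in_itv/= andbT ltNge => /negP.
  exact: caratheodory_measurable_setC (mu_half j a).
by have := mf measurableT A mA; rewrite setTI.
Qed.

Lemma measure_of_outer_measure (S : set 'rV[R]_n) :
  (forall A : set 'rV[R]_n, measurable A -> mu.-caratheodory A) -> measurable S ->
  exists m : {measure set 'rV[R]_n -> \bar R}, (m : set 'rV[R]_n -> \bar R) = restriction mu S.
Proof.
move=> mu_cara mS.
have m0 : restriction mu S set0 = 0 by rewrite /restriction set0I outer_measure0.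
have m_ge0 A : 0 <= restriction mu S A by exact: outer_measure_ge0.
have m_add : semi_sigma_additive (restriction mu S).
  move=> F mF tF mUF; rewrite /restriction setI_bigcupl.
  apply: (@caratheodory_measure_sigma_additive R _ mu) => //.
  - by move=> i; apply: mu_cara; exact: measurableI.
  - exact: trivIset_setIr.
  - apply: mu_cara; rewrite -setI_bigcupl; exact: measurableI.
pose mM := isMeasure.Build _ _ _ (restriction mu S) m0 m_ge0 m_add.
pose m : {measure set 'rV[R]_n -> \bar R} := HB.pack (restriction mu S) mM.
by exists m.
Qed.

(* The increments of [B k] are, up to one index, separated from [B k], so
   their measures telescope; this gives continuity from below of the outer
   measure along [B]. *)
Lemma separated_halfspace_caratheodory :
  (forall (j : 'I_n) (a b : R) X Y, (a < b)%R ->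
    X `<=` [set x : 'rV[R]_n | x 0%R j <= a]%R ->
    Y `<=` [set x : 'rV[R]_n | b <= x 0%R j]%R -> mu X + mu Y <= mu (X `|` Y)) ->
  forall (j : 'I_n) (c : R), mu.-caratheodory [set x : 'rV[R]_n | x 0%R j <= c]%R.
Proof.
move=> sep j c; apply: le_caratheodory_measurable => X.
have [->|muX] := eqVneq (mu X) +oo; first by rewrite leey.
set C := X `&` _; set D := X `&` _.
pose r (k : nat) : R := k.+1%:R^-1%R.
have r_lt k : (r k.+1 < r k)%R by rewrite /r ltf_pV2 ?posrE// ltr_nat.
pose B k := X `&` [set x : 'rV[R]_n | c + r k < x 0%R j]%R.
pose Rg k := B k.+1 `\` B k.
have BS k : B k `<=` B k.+1.
  by move=> x [Xx /= cx]; split => //=; rewrite (le_lt_trans _ cx)// lerD2l ltW.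
have CB k : mu C + mu (B k) <= mu X.
  rewrite (@le_trans _ _ (mu (C `|` B k)))//; last by apply: le_outer_measure => x [[]|[]].
  apply: (sep j c (c + r k) C (B k))%R => //; first by rewrite ltrDl invr_gt0.
    by move=> x [].
  by move=> x [_ /= /ltW].
have BR k : mu (B k) + mu (Rg k.+1) <= mu (B k.+2).
  rewrite addeC (@le_trans _ _ (mu (Rg k.+1 `|` B k)))//.
    apply: (sep j (c + r k.+1) (c + r k) (Rg k.+1) (B k))%R => //; first by rewrite ltrD2l.
      move=> x [[Xx _] /= nB]; rewrite leNgt; apply/negP => xr; apply: nB.
      by split.
    by move=> x [_ /= /ltW].
  by apply: le_outer_measure => x [[]//|/BS/BS].
(* [BR] links [B k] to [B k.+2], so even and odd indices telescope separately; adding two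
   consecutive terms treats both parities at once. *)
have sumR m : \sum_(0 <= k < m) mu (Rg k.+1) + (mu (B 0%N) + mu (B 1%N)) <= mu (B m) + mu (B m.+1).
  elim: m => [|m IH]; first by rewrite big_geq// add0e.
  rewrite big_nat_recr//= -addeA (addeC (mu (Rg m.+1))) addeA.
  apply: (le_trans (leeD2r _ IH)).
  by rewrite -addeA (addeC (mu (B m.+1))) addeA addeC leeD2l.
have fX : mu X \is a fin_num by rewrite ge0_fin_numE// ltey.
have BX k : mu (B k) <= mu X by apply: le_outer_measure => x [].
have sR : \sum_(0 <= k <oo) mu (Rg k.+1) < +oo.
  apply: (@le_lt_trans _ _ (mu X + mu X)); last by rewrite lte_add_pinfty// ltey.
  apply: lime_le; first by apply: is_cvg_nneseries => k _ _; exact: outer_measure_ge0.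
  apply: nearW => m; apply: (@le_trans _ _ (mu (B m) + mu (B m.+1))); last exact: leeD.
  by apply: le_trans (sumR m); rewrite leeDl// adde_ge0.
have DB k : mu D <= mu (B k) + \sum_(k <= i <oo) mu (Rg i).
  apply: (@le_trans _ _ (mu (B k `|` \bigcup_(i in ~` `I_k) Rg i))).
    apply: le_outer_measure => x [Xx /= /negP]; rewrite -ltNge => cx.
    have exB : exists m, x \in B m.
      have xc0 : (0 < x 0 j - c)%R by rewrite subr_gt0.
      exists (Num.truncn (x 0%R j - c)^-1); rewrite inE; split => //=.
      rewrite addrC -ltrBrDr invf_plt ?posrE//.
      by rewrite (le_lt_trans _ (truncnS_gt _))// .
    case: (ex_minnP exB) => m /set_mem Bm minm.
    have [mk|km] := leqP m k.
      by left; rewrite -(subnK mk); elim: (k - m)%N => // i; exact: BS.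
    case: m Bm minm km => [|m] Bm minm km; first by rewrite ltn0 in km.
    right; exists m; first by apply/negP; rewrite -leqNgt -ltnS.
    split=> // /mem_set /minm; by rewrite ltnn.
  apply: (le_trans (outer_measureU2 _ _ _)); rewrite leeD2l//.
  exact: outer_measure_sigma_subadditive_tail.
have tail : \sum_(k <= i <oo) mu (Rg i) @[k --> \oo] --> 0.
  apply: (@nneseries_tail_cvg _ _ xpredT) => //.
  rewrite nneseries_recl//=.
  rewrite lte_add_pinfty//; first by rewrite (le_lt_trans _ (_ : mu X < +oo)) ?ltey//;
    apply: le_outer_measure => x [[]].
  have := sR; congr (_ < _).
  by apply/esym; rewrite -(nneseries_addn 1)//; apply: eq_eseriesr => i _; rewrite addn1.
apply/lee_addgt0Pr => e e0.
have [k _ /(_ k (leqnn k)) /= ke] : \forall k \near \oo, \sum_(k <= i <oo) mu (Rg i) <= e%:E.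
  move/fine_cvgP : tail => [f0 /cvgrPdist_le/(_ e e0)].
  apply: filterS2 f0 => k fk; rewrite sub0r normrN => h.
  by rewrite -(fineK fk) lee_fin (le_trans (ler_norm _)).
apply: (@le_trans _ _ (mu C + (mu (B k) + e%:E))).
  rewrite leeD2l//; apply: (le_trans (DB k)); exact: leeD2l.
by rewrite addeA leeD2r.
Qed.

End caratheodory_borel.

(** * Scalar products on R^n *)

Section inner_product.
Context (R : realType) (n : nat) (ip : {dot 'rV[R]_n for idfun}).
Local Notation Z := 'rV[R]_n.
Local Notation nrm := (ipnorm ip).
Implicit Types x y : Z.

Lemma ip_sym x y : ip x y = ip y x.
Proof. by rewrite hermC expr0 mul1r. Qed.

Lemma ip_addl x y z : ip (x + y) z = ip x z + ip y z.
Proof. by rewrite linearDl. Qed.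

Lemma ip_scalel a x y : ip (a *: x) y = a * ip x y.
Proof. by rewrite linearZl_LR. Qed.

Lemma ip_addr x y z : ip x (y + z) = ip x y + ip x z.
Proof. by rewrite ip_sym ip_addl !(ip_sym _ x). Qed.

Lemma ip_scaler a x y : ip x (a *: y) = a * ip x y.
Proof. by rewrite ip_sym ip_scalel ip_sym. Qed.

Lemma ip_oppl x y : ip (- x) y = - ip x y.
Proof. by rewrite -scaleN1r ip_scalel mulN1r. Qed.

Lemma ip_oppr x y : ip x (- y) = - ip x y.
Proof. by rewrite ip_sym ip_oppl ip_sym. Qed.

Lemma ip0l y : ip 0 y = 0.
Proof. by rewrite -(scale0r 0) ip_scalel mul0r. Qed.

Lemma ip0r y : ip y 0 = 0.
Proof. by rewrite ip_sym ip0l. Qed.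

Lemma ipxx_gt0 x : x != 0 -> 0 < ip x x.
Proof. exact: neq0_dnorm_gt0. Qed.

Lemma ipxx_ge0 x : 0 <= ip x x.
Proof.
by have [->|x0] := eqVneq x 0; [rewrite ip0l|exact/ltW/ipxx_gt0].
Qed.

Lemma ipxx_eq0 x : ip x x = 0 -> x = 0.
Proof. by move=> xx0; apply/eqP/negPn/negP => /ipxx_gt0; rewrite xx0 ltxx. Qed.

Lemma ipnorm_ge0 x : 0 <= nrm x.
Proof. exact: sqrtr_ge0. Qed.

Lemma ipnorm_sqr x : nrm x ^+ 2 = ip x x.
Proof. by rewrite sqr_sqrtr// ipxx_ge0. Qed.

Lemma ipnorm0 : nrm 0 = 0.
Proof. by rewrite /ipnorm ip0l sqrtr0. Qed.

Lemma ipnorm_eq0 x : nrm x = 0 -> x = 0.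
Proof. by move=> x0; apply: ipxx_eq0; rewrite -ipnorm_sqr x0 expr0n. Qed.

Lemma ipnormZ a x : nrm (a *: x) = `|a| * nrm x.
Proof.
by rewrite /ipnorm ip_scalel ip_scaler mulrA -expr2 sqrtrM ?sqr_ge0// sqrtr_sqr.
Qed.

Lemma ipnormN x : nrm (- x) = nrm x.
Proof. by rewrite -scaleN1r ipnormZ normrN1 mul1r. Qed.

Lemma ipnormB x y : nrm (x - y) = nrm (y - x).
Proof. by rewrite -ipnormN opprB. Qed.

Lemma ip_CauchySchwarz x y : `|ip x y| <= nrm x * nrm y.
Proof.
have [->|y0] := eqVneq y 0; first by rewrite ip0r normr0 mulr_ge0// ipnorm_ge0.
have yy := ipxx_gt0 y0.
rewrite -ler_sqr ?nnegrE ?mulr_ge0 ?ipnorm_ge0// exprMn !ipnorm_sqr real_normK ?num_real//.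
have := ipxx_ge0 (x - (ip x y / ip y y) *: y).
rewrite ip_addl !ip_addr !ip_oppl !ip_oppr !ip_scalel !ip_scaler (ip_sym y x).
rewrite mulfVK ?gt_eqF// subrr addr0 subr_ge0 mulrAC.
by rewrite ler_pdivrMr// expr2.
Qed.

Lemma ipnormD x y : nrm (x + y) <= nrm x + nrm y.
Proof.
rewrite -ler_sqr ?nnegrE ?addr_ge0 ?ipnorm_ge0// sqrrD !ipnorm_sqr.
rewrite ip_addl !ip_addr (ip_sym y x).
have := le_trans (ler_norm _) (ip_CauchySchwarz x y); lra.
Qed.

Lemma ipnorm_sum (I : Type) (r : seq I) (F : I -> Z) :
  nrm (\sum_(i <- r) F i) <= \sum_(i <- r) nrm (F i).
Proof.
elim/big_ind2 : _ => //; first by rewrite ipnorm0.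
by move=> a b c d ab cd; apply: (le_trans (ipnormD _ _)); exact: lerD.
Qed.

Lemma ipnorm_dist x y : `|nrm x - nrm y| <= nrm (x - y).
Proof.
rewrite ler_norml; apply/andP; split.
  rewrite lerNl opprB lerBlDr ipnormB -[in leLHS](subrK x y); exact: ipnormD.
by rewrite lerBlDr -[in leLHS](subrK y x); exact: ipnormD.
Qed.

Lemma ipnormD_ortho x y : ip x y = 0 -> nrm (x + y) ^+ 2 = nrm x ^+ 2 + nrm y ^+ 2.
Proof.
by move=> xy; rewrite !ipnorm_sqr ip_addl !ip_addr (ip_sym y x) xy addr0 add0r.
Qed.

Definition gram : 'M[R]_n := \matrix_(i, j) ip (delta_mx 0 i) (delta_mx 0 j).

Lemma ip_gram x y : ip x y = (x *m gram *m y^T) 0 0.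
Proof.
have sumr (I : finType) (F : I -> Z) z : ip z (\sum_i F i) = \sum_i ip z (F i).
  by elim/big_rec2 : _ => [|i a b _ <-]; rewrite ?ip0r ?ip_addr.
rewrite mxE {1}(row_sum_delta y) sumr; apply: eq_bigr => j _.
rewrite ip_scaler mulrC !mxE; congr (_ * _).
rewrite ip_sym {1}(row_sum_delta x) sumr; apply: eq_bigr => i _.
by rewrite ip_scaler ip_sym !mxE.
Qed.

Lemma gram_frame_unit d (B : 'M[R]_(d, n)) : row_free B -> B *m gram *m B^T \in unitmx.
Proof.
move=> Bfree; rewrite -row_free_unit; apply: inj_row_free => w w0.
have : ip (w *m B) (w *m B) = 0.
  by rewrite ip_gram trmx_mul !mulmxA -(mulmxA w) -(mulmxA w) w0 mul0mx mxE.
move/ipxx_eq0 => wB0; apply: (row_free_inj Bfree).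
by rewrite wB0 mul0mx.
Qed.

Lemma gram_unit : gram \in unitmx.
Proof.
by have := @gram_frame_unit _ 1%:M; rewrite mul1mx trmx1 mulmx1; apply;
  rewrite row_free_unit unitmx1.
Qed.

(** Each coordinate is the product with a fixed vector [d j], found by inverting the Gram matrix.
    Cauchy-Schwarz then compares the norms with no compactness argument. *)
Lemma coord_ipnorm : exists2 K : R, 0 < K & forall x (j : 'I_n), `|x 0 j| <= K * nrm x.
Proof.
pose d (j : 'I_n) : Z := (invmx gram *m delta_mx j 0)^T.
have xd x j : x 0 j = ip x (d j).
  by rewrite ip_gram /d trmxK mulmxA mulmxK ?gram_unit// -colE mxE.
exists (1 + \sum_j nrm (d j)); first by rewrite ltr_wpDr// sumr_ge0// => j _; exact: ipnorm_ge0.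
move=> x j; rewrite xd; apply: (le_trans (ip_CauchySchwarz _ _)).
rewrite mulrC ler_wpM2r ?ipnorm_ge0// (bigD1 j)//= addrCA lerDl addr_ge0// sumr_ge0//.
by move=> i _; exact: ipnorm_ge0.
Qed.

Lemma ipnorm_bound : exists2 K : R, 0 < K & forall x, nrm x <= K * `|x|.
Proof.
exists (1 + \sum_(j < n) nrm (delta_mx 0 j)).
  by rewrite ltr_wpDr// sumr_ge0// => j _; exact: ipnorm_ge0.
move=> x; rewrite {1}(row_sum_delta x); apply: (le_trans (ipnorm_sum _ _)).
apply: (@le_trans _ _ (\sum_(j < n) `|x| * nrm (delta_mx 0 j))).
  apply: ler_sum => j _; rewrite ipnormZ ler_wpM2r ?ipnorm_ge0//.
  have := @le_bigmax _ R _ 0 (fun ij : 'I_1 * 'I_n => `|x ij.1 ij.2|) (0, j).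
  by rewrite [`|x|]/Num.norm/= mx_normrE.
by rewrite -mulr_sumr mulrC ler_wpM2r// lerDr.
Qed.

Lemma norm_le_ipnorm : exists2 K : R, 0 < K & forall x, `|x| <= K * nrm x.
Proof.
have [K K0 xK] := coord_ipnorm; exists K => // x.
rewrite [`|x|]/Num.norm/= mx_normrE; apply: bigmax_le => [|[i j] _].
  by rewrite mulr_ge0 ?ipnorm_ge0// ltW.
by rewrite /= (ord1 i).
Qed.

Lemma ipnorm_continuous : continuous (nrm : Z -> R).
Proof.
have [K K0 xK] := ipnorm_bound.
move=> x; apply/(@cvgrPdist_le _ _ _ (nbhs x) (nbhs_filter x)) => e e0; near=> y.
apply: (le_trans (ipnorm_dist _ _)); apply: (le_trans (xK _)).
rewrite -ler_pdivlMl//; near: y.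
apply/nbhs_ballP; exists (K^-1 * e) => /=; first by rewrite mulr_gt0// invr_gt0.
by move=> z; rewrite -ball_normE /= => /ltW.
Unshelve. all: by end_near. Qed.

Lemma measurable_ipnorm : measurable_fun [set: Z] nrm.
Proof. apply: continuous_measurable_rV; exact: ipnorm_continuous. Qed.

(** The matrix comes from the normal equations: it is the projection onto the row space of [B] in
    the metric with matrix [gram]. *)
Lemma ortho_projection d (B : 'M[R]_(d, n)) : row_free B ->
  exists P : 'M[R]_n, forall x, (exists w, x *m P = w *m B) /\
    forall w, ip (x - x *m P) (w *m B) = 0.
Proof.
move=> Bfree; exists (gram *m B^T *m invmx (B *m gram *m B^T) *m B) => x; split.
  by exists (x *m gram *m B^T *m invmx (B *m gram *m B^T)); rewrite !mulmxA.
move=> w; rewrite ip_addl ip_oppl !ip_gram trmx_mul.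
rewrite !mulmxA -(mulmxA _ B gram) -(mulmxA _ (B *m gram) B^T).
rewrite -(mulmxA _ (invmx _) (B *m gram *m B^T)) mulVmx ?gram_frame_unit//.
by rewrite mulmx1 subrr.
Qed.

Lemma vspace_frame (U : {vspace Z}) d : \dim U = d ->
  exists2 B : 'M[R]_(d, n), row_free B & [set` U] = range (fun w : 'rV[R]_d => w *m B).
Proof.
move=> <-; exists (\matrix_i (vbasis U)`_i).
  apply: inj_row_free => w; rewrite mulmx_sum_row => w0.
  have /freeP : free (vbasis U) by exact: basis_free (vbasisP U).
  move=> /(_ (fun i => w 0 i)) h; apply/rowP => i; rewrite mxE h//.
  by rewrite -[RHS]w0; apply: eq_bigr => k _; rewrite rowK.
apply/seteqP; split => x /=.
  move=> xU; exists (\row_i coord (vbasis U) i x) => //.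
  rewrite {2}(coord_vbasis xU) mulmx_sum_row; apply: eq_bigr => i _.
  by rewrite rowK mxE.
move=> [w _ <-]; rewrite mulmx_sum_row; apply: memv_suml => i _.
by rewrite rowK memvZ// vbasis_mem// mem_nth// size_tuple.
Qed.

(** Orthogonality to the rows of [B] is membership in the kernel of [gram *m B^T], which has rank n
    - d because [gram] is invertible. *)
Lemma ortho_frame d m (B : 'M[R]_(d, n)) : (d + m)%N = n -> row_free B ->
  exists2 C : 'M[R]_(m, n), row_free C &
    [set x | forall w, ip x (w *m B) = 0] = range (fun w : 'rV[R]_m => w *m C).
Proof.
move=> dmn Bfree; pose K := kermx (gram *m B^T).
have rK : \rank K = m.
  rewrite mxrank_ker -mxrank_tr trmx_mul trmxK mxrankMfree; last first.
    by rewrite row_free_unit unitmx_tr gram_unit.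
  by move: Bfree => /eqP ->; rewrite -dmn addKn.
have [C Cfree CK] : exists2 C : 'M[R]_(m, n), row_free C & (C :=: K)%MS.
  by rewrite -rK; exists (row_base K); [exact: row_base_free|exact: eq_row_base].
exists C => //; apply/seteqP; split => x /=.
  move=> xB; have : (x <= K)%MS.
    apply/sub_kermxP/rowP => j; rewrite mulmxA [RHS]mxE.
    by have := xB (delta_mx 0 j); rewrite ip_gram trmx_mul trmx_delta !mulmxA -colE mxE.
  by rewrite -CK => /submxP[w ->]; exists w.
move=> [v _ <-] w.
have : (v *m C <= K)%MS by rewrite -CK submxMl.
by move=> /sub_kermxP vC; rewrite ip_gram trmx_mul !mulmxA -(mulmxA _ gram) vC mul0mx mxE.
Qed.

End inner_product.

(** * Hausdorff measure *)

Section hausdorff_measure.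
Local Open Scope ereal_scope.
Context (R : realType) (n : nat) (ip : {dot 'rV[R]_n for idfun}) (s : nat).
Hypothesis s_gt0 : (0 < s)%N.
Local Notation Z := 'rV[R]_n.
Local Notation nrm := (ipnorm ip).
Implicit Types (A F : set Z).

Lemma unit_ball_volume_ge0 : (0 <= unit_ball_volume R s)%R.
Proof.
clear s_gt0; have [k] := ubnP s; elim: k s => // k IH [|[|m]] //= mk.
by rewrite mulr_ge0 ?IH ?divr_ge0 ?mulr_ge0 ?pi_ge0 ?ler0n// -ltnS ltnW.
Qed.

Lemma diam_ge0 A : 0 <= diam ip A.
Proof. by apply: ereal_sup_ubound; left. Qed.

Lemma dist_le_diam A x y : A x -> A y -> (nrm (x - y))%:E <= diam ip A.
Proof. by move=> Ax Ay; apply: ereal_sup_ubound; right; exists (x, y). Qed.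

Lemma diam_le A (d : R) : (0 <= d)%R ->
  (forall x y, A x -> A y -> (nrm (x - y) <= d)%R) -> diam ip A <= d%:E.
Proof.
move=> d0 Ad; apply: ge_ereal_sup => _ [->|[[x y] [/= Ax Ay] <-]]; rewrite lee_fin//.
exact: Ad.
Qed.

Lemma diam_set0 : diam ip set0 = 0.
Proof. by apply/eqP; rewrite eq_le diam_ge0 andbT; apply: diam_le. Qed.

Definition cover_weight F : \bar R :=
  (unit_ball_volume R s * (fine (diam ip F) / 2) ^+ s)%:E.

Lemma cover_weight_ge0 F : 0 <= cover_weight F.
Proof.
rewrite lee_fin mulr_ge0 ?unit_ball_volume_ge0// exprn_ge0// divr_ge0//.
by rewrite fine_ge0// diam_ge0.
Qed.

Lemma cover_weight0 : cover_weight set0 = 0.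
Proof. by rewrite /cover_weight diam_set0/= mul0r expr0n gtn_eqF// mulr0. Qed.

Lemma hausdorff_sizeE (delta : R) : hausdorff_size ip s delta =
  cover_size [set F | diam ip F <= delta%:E] cover_weight (fun F => F).
Proof. by []. Qed.

Lemma hausdorff_size_outer (delta : R) : (0 < delta)%R ->
  exists mu : {outer_measure set Z -> \bar R},
    (mu : set Z -> \bar R) = hausdorff_size ip s delta.
Proof.
move=> d0; rewrite hausdorff_sizeE; set m := cover_size _ _ _.
have w0 F : diam ip F <= delta%:E -> 0 <= cover_weight F.
  by move=> _; exact: cover_weight_ge0.
have m0 : m set0 = 0.
  by apply: (@cover_size0 _ _ _ [set F | diam ip F <= delta%:E] cover_weight (fun F =>
    F) w0 set0 _ cover_weight0); rewrite /= diam_set0 lee_fin ltW.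
pose mM := isOuterMeasure.Build R Z m m0 
  (@cover_size_ge0 _ _ _ [set F | diam ip F <= delta%:E] cover_weight (fun F => F) w0)
  (@le_cover_size _ _ _ _ _ _)
  (@cover_size_sigma_subadditive _ _ _ [set F | diam ip F <= delta%:E] cover_weight (fun F =>
    F) w0).
pose mu : {outer_measure set Z -> \bar R} := HB.pack m mM.
by exists mu.
Qed.

Lemma hausdorff_size_ge0 delta A : 0 <= hausdorff_size ip s delta A.
Proof.
rewrite hausdorff_sizeE; apply: cover_size_ge0 => F _; exact: cover_weight_ge0.
Qed.

Lemma le_hausdorff_size delta A B : A `<=` B ->
  hausdorff_size ip s delta A <= hausdorff_size ip s delta B.
Proof. by rewrite hausdorff_sizeE; exact: le_cover_size. Qed.

Lemma hausdorff_size_anti (delta delta' : R) A : (delta <= delta')%R ->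
  hausdorff_size ip s delta' A <= hausdorff_size ip s delta A.
Proof.
move=> dd; apply: ereal_inf_le_tmp => _ [F [Fd AF] <-]; exists F => //; split => // k.
by rewrite (le_trans (Fd k))// lee_fin.
Qed.

Lemma hausdorff_size_le (delta : R) A : (0 < delta)%R ->
  hausdorff_size ip s delta A <= hausdorff ip s A.
Proof. by move=> d0; apply: ereal_sup_ubound; exists delta. Qed.

Lemma hausdorff_outer : exists mu : {outer_measure set Z -> \bar R},
  (mu : set Z -> \bar R) = hausdorff ip s.
Proof.
have H_ge0 A : 0 <= hausdorff ip s A.
  by apply: le_trans (hausdorff_size_le A (@ltr01 R)); exact: hausdorff_size_ge0.
have H0 : hausdorff ip s set0 = 0.
  apply/eqP; rewrite eq_le H_ge0 andbT; apply: ge_ereal_sup => _ [d /= d0 <-].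
  by have [mu <-] := hausdorff_size_outer d0; rewrite outer_measure0.
have H_le : {homo hausdorff ip s : A B / A `<=` B >-> A <= B}.
  move=> A B AB; apply: ge_ereal_sup => _ [d /= d0 <-].
  by apply: le_trans (hausdorff_size_le B d0); exact: le_hausdorff_size.
have H_sub : sigma_subadditive (hausdorff ip s).
  move=> F; apply: ge_ereal_sup => _ [d /= d0 <-].
  apply: (@le_trans _ _ (\sum_(0 <= i <oo) hausdorff_size ip s d (F i))).
    have [mu <-] := hausdorff_size_outer d0; exact: outer_measure_sigma_subadditive.
  apply: lee_nneseries => i _; first by move=> _; exact: hausdorff_size_ge0.
  exact: hausdorff_size_le.
pose mM := isOuterMeasure.Build R Z (hausdorff ip s) H0 H_ge0 H_le H_sub.
pose mu : {outer_measure set Z -> \bar R} := HB.pack (hausdorff ip s) mM.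
by exists mu.
Qed.

Lemma hausdorff_ge0 A : 0 <= hausdorff ip s A.
Proof. by have [mu <-] := hausdorff_outer; exact: outer_measure_ge0. Qed.

Lemma le_hausdorff A B : A `<=` B -> hausdorff ip s A <= hausdorff ip s B.
Proof. by have [mu <-] := hausdorff_outer; exact: le_outer_measure. Qed.

(** A set of diameter at most [d] cannot meet both [X] and [Y], so every cover of the union splits
    into a cover of each. *)
Lemma hausdorff_size_separated (d : R) X Y : (0 < d)%R ->
  (forall x y, X x -> Y y -> (d < nrm (x - y))%R) ->
  hausdorff_size ip s d X + hausdorff_size ip s d Y <= hausdorff_size ip s d (X `|` Y).
Proof.
move=> d0 XY; apply: le_ereal_inf_tmp => _ [F [Fd XYF] <-].
(* A set that misses [W] is replaced by the empty set, whose weight is 0 because s > 0. *)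
pose G (W : set Z) k := if pselect (F k `&` W !=set0) then F k else set0.
have Gd W k : diam ip (G W k) <= d%:E.
  rewrite /G; case: (pselect (F k `&` W !=set0)) => H; first exact: Fd.
  by rewrite diam_set0 lee_fin ltW.
have GW W : W `<=` X `|` Y -> W `<=` \bigcup_k G W k.
  move=> WXY x Wx; have [k _ Fx] := XYF x (WXY _ Wx); exists k => //.
  by rewrite /G; case: (pselect (F k `&` W !=set0)) => // -[]; exists x.
have XU : X `<=` X `|` Y by move=> x; left.
have YU : Y `<=` X `|` Y by move=> x; right.
apply: (@le_trans _ _ (\sum_(0 <= k <oo) cover_weight (G X k) +
                       \sum_(0 <= k <oo) cover_weight (G Y k))).
  by apply: leeD; apply: ereal_inf_lbound; [exists (G X)|exists (G Y)] => //; split => //;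
    exact: GW.
rewrite -nneseriesD; [|by move=> k _ _; exact: cover_weight_ge0..].
apply: lee_nneseries => k _; first by move=> _; rewrite adde_ge0 ?cover_weight_ge0.
rewrite /G.
case: (pselect (F k `&` X !=set0)) => [[x [Fx Xx]]|nX];
  case: (pselect (F k `&` Y !=set0)) => [[y [Fy Yy]]|nY].
- have := XY x y Xx Yy; rewrite ltNge -lee_fin.
  by rewrite (le_trans (dist_le_diam Fx Fy) (Fd k)).
- by rewrite cover_weight0 adde0.
- by rewrite cover_weight0 add0e.
- by rewrite cover_weight0 add0e cover_weight_ge0.
Qed.

Lemma hausdorff_separated (d : R) X Y : (0 < d)%R ->
  (forall x y, X x -> Y y -> (d < nrm (x - y))%R) ->
  hausdorff ip s X + hausdorff ip s Y <= hausdorff ip s (X `|` Y).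
Proof.
move=> d0 XY; have [->|HXY] := eqVneq (hausdorff ip s (X `|` Y)) +oo.
  by rewrite leey.
have fXY W : W `<=` X `|` Y -> hausdorff ip s W \is a fin_num.
  move=> WXY; rewrite ge0_fin_numE ?hausdorff_ge0//.
  by rewrite (le_lt_trans (le_hausdorff WXY))// ltey.
have fX : hausdorff ip s X \is a fin_num by apply: fXY => x; left.
have fY : hausdorff ip s Y \is a fin_num by apply: fXY => x; right.
rewrite -leeBrDr//; apply: ge_ereal_sup => _ [d1 /= d10 <-].
rewrite leeBrDr// addeC.
have fd1 : hausdorff_size ip s d1 X \is a fin_num.
  rewrite ge0_fin_numE ?hausdorff_size_ge0// (le_lt_trans (hausdorff_size_le X d10))//.
  by rewrite -ge0_fin_numE ?hausdorff_ge0.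
rewrite -leeBrDr//; apply: ge_ereal_sup => _ [d2 /= d20 <-].
rewrite leeBrDr// addeC.
(* One mesh serves both suprema: smaller meshes give larger sizes, and a mesh not above [d] brings
   in the separated case. *)
pose e := Num.min d (Num.min d1 d2).
have e0 : (0 < e)%R by rewrite !lt_min d0 d10.
apply: (@le_trans _ _ (hausdorff_size ip s e X + hausdorff_size ip s e Y)).
  by apply: leeD; apply: hausdorff_size_anti; rewrite /e !ge_min lexx ?orbT.
apply: le_trans (hausdorff_size_le _ e0).
apply: hausdorff_size_separated => // x y Xx Yy.
by rewrite (le_lt_trans _ (XY x y Xx Yy))// /e ge_min lexx.
Qed.

(** Caratheodory's criterion for metric outer measures: sets separated in one coordinate are at
    positive distance, since coordinates are Lipschitz for the norm. *)
Lemma hausdorff_caratheodory A : measurable A ->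
  caratheodory_measurable (hausdorff ip s) A.
Proof.
have [mu muE] := hausdorff_outer; rewrite -muE; apply: borel_caratheodory.
apply: separated_halfspace_caratheodory => j a b X Y ab Xa Yb.
rewrite muE; have [K K0 xK] := coord_ipnorm ip.
(* Halving turns the lower bound (b - a) / K on distances into a strict one. *)
apply: (@hausdorff_separated ((b - a) / K / 2)%R).
  by rewrite !divr_gt0// subr_gt0.
move=> x y Xx Yy; apply: (@lt_le_trans _ _ ((b - a) / K))%R.
  by rewrite ltr_pdivrMr// ltr_pMr ?ltr1n// divr_gt0// subr_gt0.
rewrite ler_pdivrMr// mulrC; apply: le_trans (xK _ j).
rewrite -normrN (le_trans _ (ler_norm _))// !mxE opprB lerB//; first exact: Yb.
exact: Xa.
Qed.

Lemma hausdorff_on_measure (S : set Z) : measurable S ->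
  exists m : {measure set Z -> \bar R}, (m : set Z -> \bar R) = hausdorff_on ip s S.
Proof.
move=> mS; have [mu muE] := hausdorff_outer.
have [|m mE] := @measure_of_outer_measure _ _ mu S _ mS.
  by rewrite muE; exact: hausdorff_caratheodory.
by exists m; rewrite mE /hausdorff_on muE.
Qed.

(** The images of the traces on [A] of a cover of mesh [d / C] form a cover of mesh [d]. Taking
    traces matters because the Lipschitz bound is assumed on [A] only. *)
Lemma hausdorff_lipschitz (T : Z -> Z) (C : R) A : (0 < C)%R ->
  (forall x y, A x -> A y -> (nrm (T x - T y) <= C * nrm (x - y))%R) ->
  hausdorff ip s (T @` A) <= (C ^+ s)%:E * hausdorff ip s A.
Proof.
move=> C0 TC; apply: ge_ereal_sup => _ [d /= d0 <-].
have Cs0 : (0 < C ^+ s)%R by rewrite exprn_gt0.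
have dC0 : (0 < d / C)%R by rewrite divr_gt0.
apply: (@le_trans _ _ ((C ^+ s)%:E * hausdorff_size ip s (d / C) A)); last first.
  by rewrite lee_pmul2l ?lte_fin//; exact: hausdorff_size_le.
rewrite -lee_pdivrMl//; apply: le_ereal_inf_tmp => _ [F [Fd AF] <-].
rewrite lee_pdivrMl// -nneseriesZl; last by move=> k _; exact: cover_weight_ge0.
pose G k := T @` (F k `&` A).
have Fdf k : diam ip (F k) \is a fin_num.
  by rewrite ge0_fin_numE ?diam_ge0// (le_lt_trans (Fd k)) ?ltry.
have Gd k : diam ip (G k) <= (C * fine (diam ip (F k)))%:E.
  apply: diam_le; first by apply: mulr_ge0; [exact: ltW|exact/fine_ge0/diam_ge0].
  move=> _ _ [x [Fx Ax] <-] [y [Fy Ay] <-]; apply: (le_trans (TC _ _ Ax Ay)).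
  rewrite ler_wpM2l ?(ltW C0)// -lee_fin fineK//; exact: dist_le_diam.
apply: (@le_trans _ _ (\sum_(0 <= k <oo) cover_weight (G k))).
  apply: ereal_inf_lbound; exists G => //; split.
    move=> k; apply: (le_trans (Gd k)); rewrite lee_fin mulrC -ler_pdivlMr//.
    by rewrite -lee_fin fineK.
  by move=> _ [x Ax <-]; have [k _ Fx] := AF x Ax; exists k => //; exists x.
apply: lee_nneseries => k _; first by move=> _; exact: cover_weight_ge0.
rewrite lee_fin mulrCA ler_wpM2l ?unit_ball_volume_ge0// -exprMn.
have d20 F' : (0 <= fine (diam ip F') / 2)%R by rewrite divr_ge0// fine_ge0// diam_ge0.
apply: lerXn2r; [by rewrite nnegrE d20|by rewrite nnegrE mulr_ge0 ?d20 ?(ltW C0)|].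
rewrite mulrA ler_pM2r ?invr_gt0// -lee_fin fineK ?(le_trans (Gd k))//.
by rewrite ge0_fin_numE ?diam_ge0// (le_lt_trans (Gd k)) ?ltry.
Qed.

Lemma hausdorff_isometry (T : Z -> Z) A :
  (forall x y, nrm (T x - T y) = nrm (x - y)) ->
  hausdorff ip s (T @` A) <= hausdorff ip s A.
Proof.
move=> TI; have := @hausdorff_lipschitz T 1 A ltr01.
by rewrite expr1n mul1e; apply => x y _ _; rewrite TI mul1r.
Qed.

Lemma hausdorff_translate (v : Z) A : hausdorff ip s [set (v + x)%R | x in A] = hausdorff ip s A.
Proof.
apply/eqP; rewrite eq_le; apply/andP; split.
  by apply: hausdorff_isometry => x y; rewrite opprD addrACA subrr add0r.
rewrite [in leLHS](_ : A = [set (- v + y)%R | y in [set (v + x)%R | x in A]])%R; last first.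
  rewrite image_comp; apply/seteqP; split=> [x Ax|_ [x Ax <-]] /=; last by rewrite addKr.
  by exists x => //=; rewrite addKr.
by apply: hausdorff_isometry => x y; rewrite opprD addrACA subrr add0r.
Qed.

(** The dilation and its inverse are both Lipschitz, with reciprocal constants. *)
Lemma hausdorff_scale (t : R) A : (0 < t)%R ->
  hausdorff ip s [set (t *: x)%R | x in A] = (t ^+ s)%:E * hausdorff ip s A.
Proof.
move=> t0; apply/eqP; rewrite eq_le; apply/andP; split.
  by apply: hausdorff_lipschitz => // x y _ _; rewrite -scalerBr ipnormZ gtr0_norm.
rewrite -lee_pdivlMl ?exprn_gt0// -exprVn.
rewrite [in leLHS](_ : A = [set (t^-1 *: y)%R | y in [set (t *: x)%R | x in A]])%R; last first.
  rewrite image_comp; apply/seteqP; split=> [x Ax|_ [x Ax <-]] /=.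
    by exists x => //=; rewrite scalerA mulVf ?gt_eqF// scale1r.
  by rewrite scalerA mulVf ?gt_eqF// scale1r.
apply: hausdorff_lipschitz; rewrite ?invr_gt0// => x y _ _.
by rewrite -scalerBr ipnormZ gtr0_norm ?invr_gt0.
Qed.

End hausdorff_measure.

(** * Local finiteness of Hausdorff measure on planes *)

Section rV_norm.
Context (R : realType) (n : nat).
Implicit Types x : 'rV[R]_n.

Lemma coord_le_norm x (j : 'I_n) : `|x 0 j| <= `|x|.
Proof.
rewrite [`|x|]/Num.norm/= mx_normrE.
exact: (@le_bigmax _ R _ 0 (fun ij : 'I_1 * 'I_n => `|x ij.1 ij.2|) (0, j)).
Qed.

Lemma measurable_norm_ball (M : R) : measurable [set x : 'rV[R]_n | `|x| <= M].
Proof.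
apply: closed_measurable_rV; rewrite (_ : mkset _ = (fun x : 'rV[R]_n =>
  `|x|) @^-1` [set t : R | t <= M])//.
by apply: closed_comp; [move=> ? _; exact: norm_continuous|exact: closed_le].
Qed.

End rV_norm.

Section sigma_finite_rV.
Context (R : realType) (n : nat) (m : {measure set 'rV[R]_n -> \bar R}).
Hypothesis m_lty : forall k : nat, (m [set x : 'rV[R]_n | `|x| <= k%:R]%R < +oo)%E.

Let sfm : set 'rV[R]_n -> \bar R := m.

Let sfm_sigma_finite : sigma_finite setT sfm.
Proof.
exists (fun k : nat => [set x : 'rV[R]_n | `|x| <= k%:R]).
  apply/seteqP; split => // x _; exists (Num.truncn `|x|).+1 => //=.
  exact/ltW/truncnS_gt.
by move=> k; split; [exact: measurable_norm_ball|exact: m_lty].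
Qed.

HB.instance Definition _ := Measure.on sfm.
HB.instance Definition _ := Measure_isSigmaFinite.Build _ _ _ sfm sfm_sigma_finite.

(** Attaches the sigma-finite structure, which the Tonelli theorem requires, to a measure that is
    known only up to equality of set functions. *)
Lemma sigma_finite_rV : exists m' : {sigma_finite_measure set 'rV[R]_n -> \bar R},
  (m' : set 'rV[R]_n -> \bar R) = m.
Proof. by exists sfm. Qed.

End sigma_finite_rV.

Section hausdorff_finite.
Local Open Scope ereal_scope.
Context (R : realType) (n : nat) (ip : {dot 'rV[R]_n for idfun}) (s : nat).
Hypothesis s_gt0 : (0 < s)%N.
Local Notation Z := 'rV[R]_n.
Local Notation nrm := (ipnorm ip).

Lemma hausdorff_size_single (delta : R) (A : set Z) (d : R) :
  (0 <= d)%R -> (d <= delta)%R -> (forall x y, A x -> A y -> (nrm (x - y) <= d)%R) ->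
  hausdorff_size ip s delta A <= (unit_ball_volume R s * (d / 2) ^+ s)%:E.
Proof.
move=> d0 dd Ad; have dA := diam_le d0 Ad.
apply: (@le_trans _ _ (cover_weight ip s A)); last first.
  rewrite lee_fin ler_wpM2l ?unit_ball_volume_ge0//.
  have fA : (fine (diam ip A) <= d)%R.
    rewrite -lee_fin fineK// ge0_fin_numE ?diam_ge0//.
    by rewrite (le_lt_trans dA) ?ltry.
  have fA0 : (0 <= fine (diam ip A))%R by rewrite fine_ge0// diam_ge0.
  by apply: lerXn2r; rewrite ?nnegrE ?divr_ge0// ler_pM2r.
apply: ereal_inf_lbound; exists (fun k => if k is 0%N return set Z then A else set0).
  split; last by move=> x Ax; exists 0%N.
  by move=> [|k]; [rewrite (le_trans dA) ?lee_fin|rewrite diam_set0 lee_fin (le_trans d0)].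
rewrite nneseries_recl//=; last by case=> [|k] _; exact: cover_weight_ge0.
rewrite eseries0 ?adde0// => -[|k]// _ _; exact: cover_weight0.
Qed.

(** The parameter cube of side 2M is cut into m^s cubes of side 2M/m, whose images have diameter at
    most 2KM/m. The weights add up to the volume of the unit ball times (KM)^s, whatever m is, so
    the bound survives the supremum over the meshes. *)
Lemma hausdorff_frame_lty (B : 'M[R]_(s, n)) (M : R) :
  hausdorff ip s [set (w *m B)%R | w in [set w : 'rV[R]_s | `|w| <= M]%R] < +oo.
Proof.
wlog M0 : M / (0 < M)%R.
  move=> H; apply: le_lt_trans (H (Num.max M 1)%R _); last by rewrite lt_max ltr01 orbT.
  apply: le_hausdorff => // _ [w /= wM <-]; exists w => //=.
  by rewrite le_max wM.
pose K := (1 + \sum_i nrm (row i B))%R.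
have K0 : (0 < K)%R by rewrite ltr_wpDr// sumr_ge0// => i _; exact: ipnorm_ge0.
have wK (w : 'rV[R]_s) (d : R) : (0 <= d)%R ->
    (forall j, `|w 0%R j| <= d)%R -> (nrm (w *m B) <= K * d)%R.
  move=> d0 wd; rewrite mulmx_sum_row; apply: (le_trans (ipnorm_sum _ _ _)).
  apply: (@le_trans _ _ (\sum_i nrm (row i B) * d)%R).
    apply: ler_sum => i _; rewrite ipnormZ mulrC ler_wpM2l ?ipnorm_ge0//.
  by rewrite -mulr_suml ler_wpM2r// lerDr.
apply: (@le_lt_trans _ _ (unit_ball_volume R s * (K * M) ^+ s)%:E); last by rewrite ltry.
apply: ge_ereal_sup => _ [delta /= delta0 <-].
(* The number of pieces per side is taken large enough for their images to have diameter at most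
   [delta]. *)
pose m' := Num.truncn (K * (2 * M) / delta)%R; pose m := m'.+1.
have mdelta : (K * (2 * M / m%:R) <= delta)%R.
  rewrite mulrA ler_pdivrMr ?ltr0n// [leRHS]mulrC -ler_pdivrMr//.
  exact/ltW/truncnS_gt.
pose u (w : 'rV[R]_s) j : R := ((w 0%R j + M) * (m%:R / (2 * M)))%R.
pose T : finType := {ffun 'I_s -> 'I_m}.
pose piece (i : T) : set Z :=
  [set (w *m B)%R | w in [set w : 'rV[R]_s | forall j, ((i j)%:R <= u w j <= (i j)%:R + 1)%R]].
pose i0 : T := [ffun=> ord0].
pose F (k : nat) : set Z := piece (nth i0 (enum T) k).
have QF : [set (w *m B)%R | w in [set w : 'rV[R]_s | `|w| <= M]%R] `<=`
    \big[setU/set0]_(k < size (enum T)) F k.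
  move=> _ [w /= wM <-].
  have um j : (0 <= u w j <= m%:R)%R.
    have := le_trans (coord_le_norm w j) wM; rewrite ler_norml => /andP[Mw wM'].
    rewrite /u mulr_ge0/=; last 2 first.
    - by rewrite -lerBlDr sub0r.
    - by rewrite divr_ge0// mulr_ge0// ltW.
    rewrite mulrA ler_pdivrMr ?mulr_gt0// mulrC ler_pM2l ?ltr0n//.
    by rewrite mulr_natl mulr2n lerD2r.
  (* The minimum with [m'] handles the face where a coordinate of w equals M: there [u w j] is m,
     and its integer part would be out of range. *)
  pose i : T := [ffun j => inord (minn (Num.truncn (u w j)) m')].
  have iu j : ((i j)%:R <= u w j <= (i j)%:R + 1)%R.
    rewrite ffunE inordK; last by rewrite ltnS geq_minr.
    have /andP[u0 uM] := um j.
    have /andP[tu ut] := truncn_itv u0.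
    have [tm|mt] := leqP (Num.truncn (u w j)) m'.
      by rewrite tu/= -natr1 in ut *; rewrite ltW.
    rewrite -[(m'%:R + 1)%R]/(m'%:R + 1%:R)%R -natrD addn1 uM andbT.
    by rewrite (le_trans _ tu)// ler_nat ltnW.
  rewrite -bigcup_mkord; exists (index i (enum T)) => /=.
    by rewrite index_mem mem_enum.
  by rewrite /F nth_index ?mem_enum//; exists w.
have [mu muE] := hausdorff_size_outer ip s_gt0 delta0.
rewrite -muE; apply: (le_trans (le_outer_measure mu _ _ QF)).
apply: (le_trans (outer_measure_subadditive mu F _)).
have M2m : (0 <= 2 * M / m%:R)%R by rewrite divr_ge0// mulr_ge0// ltW.
apply: (@le_trans _ _ (\sum_(i < size (enum T))
    (unit_ball_volume R s * (K * (2 * M / m%:R) / 2) ^+ s)%:E)).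
  apply: lee_sum => k _; rewrite muE; apply: hausdorff_size_single => //.
    by rewrite mulr_ge0// ltW.
  move=> _ _ [w wp <-] [v vp <-]; rewrite -mulmxBl; apply: wK => // j.
  have /andP[w1 w2] := wp j; have /andP[v1 v2] := vp j.
  have : (`|u w j - u v j| <= 1)%R by rewrite ler_norml; apply/andP; split; lra.
  rewrite /u -mulrBl opprD addrACA subrr addr0 normrM (ger0_norm (_ : 0 <= m%:R / (2 * M)))%R;
    last first.
    by rewrite divr_ge0// mulr_ge0// ltW.
  by rewrite -ler_pdivlMr ?divr_gt0 ?mulr_gt0 ?ltr0n// div1r invf_div !mxE.
rewrite sumEFin lee_fin sumr_const card_ord -cardE (card_ffun 'I_s 'I_m) !card_ord -mulrnAr ler_wpM2l ?unit_ball_volume_ge0//.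
rewrite -mulr_natr natrX -exprMn.
rewrite (_ : K * (2 * M / m%:R) / 2 * m%:R = K * M)%R// .
by field; rewrite pnatr_eq0.
Qed.

(* A set with a linear parametrization by R^s, s being its Hausdorff dimension. *)
Lemma hausdorff_on_frame_lty (B : 'M[R]_(s, n)) (S : set Z) (p : Z) (M : R) :
  row_free B -> S `<=` [set (p + w *m B)%R | w in [set: 'rV[R]_s]] ->
  hausdorff_on ip s S [set x | `|x| <= M]%R < +oo.
Proof.
move=> Bfree SB.
pose C := (1 + \sum_i `|row i (pinvmx B)|)%R.
have C0 : (0 <= C)%R by rewrite addr_ge0// sumr_ge0.
have SC : S `&` [set x | `|x| <= M]%R `<=` [set (p + x)%R | x in
    [set (w *m B)%R | w in [set w : 'rV[R]_s | `|w| <= C * (M + `|p|)]%R]].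
  move=> x [Sx /= xM]; have [w _ wx] := SB _ Sx; exists (w *m B)%R => //; exists w => //=.
  have -> : w = ((x - p) *m pinvmx B)%R.
    by rewrite -wx addrC addKr -mulmxA mulmxVp// mulmx1.
  have xp : (`|x - p| <= M + `|p|)%R by rewrite (le_trans (ler_normB _ _))// lerD2r.
  rewrite mulmx_sum_row (le_trans (ler_norm_sum _ _ _))//.
  apply: (@le_trans _ _ (\sum_i `|row i (pinvmx B)| * (M + `|p|))%R).
    apply: ler_sum => i _; rewrite normrZ mulrC ler_wpM2l//.
    exact: le_trans (coord_le_norm _ _) xp.
  rewrite -mulr_suml ler_wpM2r ?lerDr// (le_trans _ xp)//.
rewrite /hausdorff_on /restriction setIC (le_lt_trans (le_hausdorff _ s_gt0 SC))//.
by rewrite hausdorff_translate// hausdorff_frame_lty.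
Qed.

End hausdorff_finite.

(** * Lebesgue measure *)

Section box_measure.
Local Open Scope ereal_scope.
Context (R : realType).

Definition rV_box n (a b : 'rV[R]_n) : set 'rV[R]_n :=
  [set x | forall j, (a 0 j < x 0 j <= b 0 j)%R].

Lemma measurable_rV_box n (a b : 'rV[R]_n) : measurable (rV_box a b).
Proof.
rewrite (_ : rV_box a b = \bigcap_(j in [set: 'I_n])
    ((fun x : 'rV[R]_n => x 0%R j) @^-1` `]a 0%R j, b 0%R j])); last first.
  apply/seteqP; split=> x xab; first by move=> j _ /=; rewrite in_itv/=; exact: xab.
  by move=> j; have := xab j Logic.I; rewrite /= in_itv.
apply: fin_bigcap_measurable => // j _.
by rewrite -[X in measurable X]setTI; exact: measurable_coord.
Qed.

Definition box_volume n (a b : 'rV[R]_n) : R := \prod_(j < n) (b 0%R j - a 0%R j).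

Lemma norm_ball_box n (k : nat) : [set x : 'rV[R]_n | `|x| <= k%:R]%R `<=`
  rV_box (const_mx (- (k%:R + 1))%R) (const_mx k%:R).
Proof.
move=> x /= xk j; have := le_trans (coord_le_norm x j) xk.
rewrite ler_norml !mxE => /andP[xk1 ->]; rewrite andbT (lt_le_trans _ xk1)//.
by rewrite ltrN2 ltrDl.
Qed.

(** An auxiliary product measure, built by induction on the dimension. Measuring covers with it
    gives a lower bound for [lebesgue_rV]. *)
Lemma ex_box_measure n : exists m : {sigma_finite_measure set 'rV[R]_n -> \bar R},
  forall a b : 'rV[R]_n, (forall j, a 0 j <= b 0 j)%R ->
    m (rV_box a b) = (box_volume a b)%:E.
Proof.
elim: n => [|n [m mE]].
  (* R^0 is a point and the empty product of side lengths is 1. *)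
  exists (\d_(0 : 'rV[R]_0)%R : {sigma_finite_measure set _ -> \bar R}) => a b _.
  rewrite -[LHS]/(\d_(0 : 'rV[R]_0)%R (rV_box a b)) diracE mem_set; last by move=> [].
  by rewrite /box_volume big_ord0.
pose f (p : R * 'rV[R]_n) : 'rV[R]_n.+1 := row_mx (const_mx p.1 : 'rV[R]_1) p.2.
have fl p (k : 'I_1) : f p 0%R (lshift n k) = p.1.
  by have := row_mxEl (const_mx p.1 : 'rV[R]_1) p.2 0%R k; rewrite [RHS]mxE.
have fr p (k : 'I_n) : f p 0%R (rshift 1 k) = p.2 0%R k.
  exact: (row_mxEr (const_mx p.1 : 'rV[R]_1) p.2 0%R k).
have l0 (k : 'I_1) : lshift n k = ord0 :> 'I_n.+1.
  by apply: val_inj; rewrite /= (ord1 k).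
have fl0 p : f p 0%R ord0 = p.1 by rewrite -(l0 ord0) fl.
have mf : measurable_fun setT (f : measurableTypeR R * 'rV[R]_n -> _).
  apply: measurable_fun_rV => j.
  case: (@splitP 1 n j) => k jk.
    have -> : j = lshift n k by exact: val_inj.
    by under eq_fun do rewrite fl; exact: measurable_fst.
  have -> : j = rshift 1 k by exact: val_inj.
  under eq_fun do rewrite fr.
  by apply: measurableT_comp (measurable_coord k) _; exact: measurable_snd.
pose pf : {measure set 'rV[R]_n.+1 -> \bar R} :=
  pushforward (@lebesgue_measure R \x m)%E f.
pose m1 := pf mf.
have m1E (a b : 'rV[R]_n.+1) : (forall j, a 0 j <= b 0 j)%R ->
    m1 (rV_box a b) = (box_volume a b)%:E.
  move=> ab; rewrite /m1 /pf /= /pushforward.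
  pose a' := rsubmx (a : 'rV[R]_(1 + n)); pose b' := rsubmx (b : 'rV[R]_(1 + n)).
  have -> : f @^-1` rV_box a b = `]a 0%R ord0, b 0%R ord0] `*` rV_box a' b'.
    apply/seteqP; split=> -[t x] /=.
      move=> h; split.
        by have := h ord0; rewrite fl0/= in_itv.
      by move=> j; have := h (rshift 1 j); rewrite fr !mxE.
    move=> [t0 xj] j; case: (@splitP 1 n j) => k jk.
      have -> : j = ord0 by rewrite -(l0 k); exact: val_inj.
      by rewrite fl0; move: t0; rewrite in_itv.
    have -> : j = rshift 1 k by exact: val_inj.
    by rewrite fr/=; have := xj k; rewrite !mxE.
  rewrite product_measure1E//; last exact: measurable_rV_box.
  rewrite mE; last by move=> j; rewrite !mxE.
  rewrite [X in X * _](_ : _ = (b 0 ord0 - a 0 ord0)%R%:E); last first.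
    have := lebesgue_measure_itv `]a 0%R ord0, b 0%R ord0]%R; rewrite /= lte_fin => ->.
    by case: ltgtP (ab ord0) => // ->; rewrite subrr.
  rewrite /box_volume big_ord_recl EFinM; congr (_ * _%:E).
  apply: eq_bigr => j _; rewrite !mxE.
  by congr (b _ _ - a _ _)%R; exact: val_inj.
have [|m2 m2E] := sigma_finite_rV (m := m1).
  move=> k; apply: (@le_lt_trans _ _ (m1 (rV_box (const_mx (- (k%:R + 1))%R) (const_mx k%:R)))).
    apply: le_measure; rewrite ?inE; [exact: measurable_norm_ball|exact: measurable_rV_box|].
    exact: norm_ball_box.
  rewrite m1E ?ltry// => j; rewrite !mxE; have := ler0n R k; lra.
by exists m2 => a b ab; rewrite m2E m1E.
Qed.

End box_measure.

Section lebesgue_rV_measure.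
Local Open Scope ereal_scope.
Context (R : realType) (n : nat).
Hypothesis n_gt0 : (0 < n)%N.
Local Notation Z := 'rV[R]_n.
Local Notation leb := (@lebesgue_rV R n).

Let D := [set ab : Z * Z | forall j, (ab.1 0 j <= ab.2 0 j)%R].
Let vol (ab : Z * Z) : \bar R := (box_volume ab.1 ab.2)%:E.
Let box (ab : Z * Z) := rV_box ab.1 ab.2.

Let vol_ge0 ab : D ab -> 0 <= vol ab.
Proof. by move=> Dab; rewrite lee_fin prodr_ge0// => j _; rewrite subr_ge0. Qed.

Lemma lebesgue_rVE : leb = cover_size D vol box.
Proof.
apply/funext => A; congr ereal_inf; apply/seteqP; split => t [].
  by move=> [a b] [/= ab Aab] <-; exists (fun k => (a k, b k)).
by move=> s [Ds As] <-; exists ((fun k => (s k).1), (fun k => (s k).2)).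
Qed.

(** Positive dimension provides a degenerate box of volume 0, with which the empty set is covered at
    no cost. *)
Lemma lebesgue_rV_outer : exists mu : {outer_measure set Z -> \bar R},
  (mu : set Z -> \bar R) = leb.
Proof.
rewrite lebesgue_rVE; set m := cover_size _ _ _.
have m0 : m set0 = 0.
  apply: (@cover_size0 _ _ _ D vol box vol_ge0 (0, 0)%R); first by move=> j /=.
  rewrite /vol /box_volume; by rewrite (bigD1 (Ordinal n_gt0))//= subrr mul0r.
pose mM := isOuterMeasure.Build R Z m m0
  (@cover_size_ge0 _ _ _ D vol box vol_ge0)
  (@le_cover_size _ _ _ _ _ _)
  (@cover_size_sigma_subadditive _ _ _ D vol box vol_ge0).
pose mu : {outer_measure set Z -> \bar R} := HB.pack m mM.
by exists mu.
Qed.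

Let setj (x : Z) j t : Z := \row_k (if k == j then t else x 0%R k).

Lemma lebesgue_rV_halfspace (j : 'I_n) (c : R) :
  caratheodory_measurable leb [set x : Z | x 0%R j <= c]%R.
Proof.
have [mu muE] := lebesgue_rV_outer; rewrite -muE.
apply: le_caratheodory_measurable => X; rewrite muE lebesgue_rVE.
apply: le_ereal_inf_tmp => _ [s [Ds Xs] <-].
(* [t k] is [c] clamped to the j-th side of the box. Both parts of the cut box are thus admissible
   even if the hyperplane misses it, one of them being degenerate, and their volumes add up. *)
pose t k : R := Num.min ((s k).2 0%R j) (Num.max ((s k).1 0%R j) c).
pose s1 k : Z * Z := ((s k).1, setj (s k).2 j (t k)).
pose s2 k : Z * Z := (setj (s k).1 j (t k), (s k).2).
have Dsj k : (((s k).1 0 j <= t k) && (t k <= (s k).2 0 j))%R.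
  by rewrite /t ge_min lexx/= le_min le_max lexx (Ds k j).
have Ds1 k : D (s1 k).
  move=> i; rewrite /s1/= /setj mxE; case: eqP => [->|_]; last exact: Ds.
  by have /andP[] := Dsj k.
have Ds2 k : D (s2 k).
  move=> i; rewrite /s2/= /setj mxE; case: eqP => [->|_]; last exact: Ds.
  by have /andP[] := Dsj k.
apply: (@le_trans _ _ (\sum_(0 <= k <oo) vol (s1 k) + \sum_(0 <= k <oo) vol (s2 k))).
  apply: leeD; apply: ereal_inf_lbound.
    exists s1 => //; split => // x [Xx /= xc]; have [k _ xk] := Xs x Xx; exists k => // i.
    rewrite /s1/= /setj mxE; case: eqP => [->|_]; last exact: xk.
    have /andP[ax xb] := xk j.
    by rewrite ax/= /t le_min xb le_max xc orbT.
  exists s2 => //; split => // x [Xx /= /negP]; rewrite -ltNge => cx.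
  have [k _ xk] := Xs x Xx; exists k => // i.
  rewrite /s2/= /setj mxE; case: eqP => [->|_]; last exact: xk.
  have /andP[ax xb] := xk j.
  by rewrite xb andbT /t gt_min gt_max ax cx orbT.
rewrite -nneseriesD; [|by move=> k _ _; exact: vol_ge0..].
apply: lee_nneseries => k _; first by move=> _; rewrite adde_ge0// vol_ge0.
rewrite lee_fin /box_volume (bigD1 j)//= [X in (_ + X)%R](bigD1 j)//= [leRHS](bigD1 j)//=.
rewrite (eq_bigr (fun i => (s k).2 0 i - (s k).1 0 i))%R; last first.
  by move=> i ij; rewrite /setj mxE (negbTE ij).
rewrite [X in (_ + _ * X)%R](eq_bigr (fun i => (s k).2 0 i - (s k).1 0 i))%R; last first.
  by move=> i ij; rewrite /setj mxE (negbTE ij).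
by rewrite /setj !mxE eqxx -mulrDl addrC subrKA.
Qed.

Lemma lebesgue_rV_box_le (a b : Z) : (forall j, a 0 j <= b 0 j)%R ->
  leb (rV_box a b) <= (box_volume a b)%:E.
Proof.
move=> ab; rewrite lebesgue_rVE; apply: ereal_inf_lbound.
exists (fun k => if k is 0%N return (Z * Z)%type then (a, b) else (0, 0)%R).
  split; last by move=> x xab; exists 0%N.
  by case=> [|k] j /=.
have v0 : vol (0, 0)%R = 0.
  rewrite /vol /box_volume; by rewrite (bigD1 (Ordinal n_gt0))//= subrr mul0r.
rewrite nneseries_recl//=; last by case=> [|k] _; apply: vol_ge0 => j /=.
by rewrite eseries0 ?adde0// => -[|k].
Qed.

(** Sigma-subadditivity of the product measure bounds the total volume of every cover of the unit
    box below by 1. *)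
Lemma lebesgue_rV_unit_box_gt0 : 0 < leb (rV_box 0 (const_mx 1))%R.
Proof.
have [m mE] := ex_box_measure R n.
apply: (@lt_le_trans _ _ 1%E) => //.
have -> : 1 = m (rV_box 0 (const_mx 1))%R.
  rewrite mE; last by move=> j; rewrite !mxE.
  by rewrite /box_volume big1// => j _; rewrite !mxE subr0.
rewrite lebesgue_rVE; apply: le_ereal_inf_tmp => _ [s [Ds Xs] <-].
apply: (@le_trans _ _ (\sum_(0 <= k <oo) m (box (s k)))).
  by apply: measure_sigma_subadditive => //; [move=> k|]; exact: measurable_rV_box.
by apply: lee_nneseries => // k _; rewrite /box mE//; exact: Ds.
Qed.

Lemma lebesgue_rV_translate_le (v : Z) (A : set Z) :
  leb [set (v + x)%R | x in A] <= leb A.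
Proof.
rewrite lebesgue_rVE; apply: le_ereal_inf_tmp => _ [s [Ds Xs] <-].
apply: ereal_inf_lbound; exists (fun k => (v + (s k).1, v + (s k).2)%R).
  split; first by move=> k j /=; rewrite !mxE lerD2l; exact: Ds.
  move=> _ [x Ax <-]; have [k _ xk] := Xs x Ax; exists k => // j.
  by rewrite /= !mxE ltrD2l lerD2l; exact: xk.
apply: eq_eseriesr => k _; congr (_%:E); apply: eq_bigr => j _ /=.
by rewrite !mxE opprD addrACA subrr add0r.
Qed.

Lemma lebesgue_rV_translate (v : Z) (A : set Z) :
  leb [set (v + x)%R | x in A] = leb A.
Proof.
apply/eqP; rewrite eq_le lebesgue_rV_translate_le/=.
rewrite [in leLHS](_ : A = [set (- v + y)%R | y in [set (v + x)%R | x in A]])%R.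
  exact: lebesgue_rV_translate_le.
rewrite image_comp; apply/seteqP; split=> [x Ax|_ [x Ax <-]] /=; last by rewrite addKr.
by exists x => //=; rewrite addKr.
Qed.

Lemma lebesgue_rV_measure : exists m : {sigma_finite_measure set Z -> \bar R},
  (m : set Z -> \bar R) = leb.
Proof.
have [mu muE] := lebesgue_rV_outer.
have [||m mE] := @measure_of_outer_measure _ _ mu setT.
- apply: borel_caratheodory; rewrite muE; exact: lebesgue_rV_halfspace.
- exact: measurableT.
have mleb : (m : set Z -> \bar R) = leb.
  by rewrite mE -muE; apply/funext => A; rewrite /restriction setIT.
have [|m' m'E] := sigma_finite_rV (m := m); last by exists m'; rewrite m'E.
move=> k; rewrite mleb.
apply: (@le_lt_trans _ _ (leb (rV_box (const_mx (- (k%:R + 1))%R) (const_mx k%:R)))).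
  by rewrite -muE; apply: le_outer_measure; exact: norm_ball_box.
rewrite (le_lt_trans (lebesgue_rV_box_le _)) ?ltry// => j; rewrite !mxE; have := ler0n R k; lra.
Qed.

End lebesgue_rV_measure.

(** * Disintegration along orthogonal subspaces *)

Section change_of_variables.
Local Open Scope ereal_scope.
Context d1 d2 (X : measurableType d1) (Y : measurableType d2) (R : realType).
Variables (mu : {measure set X -> \bar R}) (nu : {measure set Y -> \bar R}).

Lemma ge0_integral_preimage (phi : X -> Y) (c : R) : measurable_fun setT phi ->
  (0 <= c)%R -> (forall A, measurable A -> mu (phi @^-1` A) = c%:E * nu A) ->
  forall f : Y -> \bar R, measurable_fun setT f -> (forall y, 0 <= f y) ->
  \int[mu]_x f (phi x) = c%:E * \int[nu]_y f y.
Proof.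
move=> mphi c0 muphi f mf f0.
rewrite -(ge0_integral_mscale nu measurableT (NngNum c0))//.
rewrite -[LHS]/(\int[mu]_x (f \o phi) x) -[setT in LHS](preimage_setT phi).
rewrite -(ge0_integral_pushforward mphi)//.
by apply: eq_measure_integral => A mA _; exact: muphi.
Qed.

End change_of_variables.

Section weil.
Local Open Scope ereal_scope.
Context (R : realType) (n : nat) d (Y : measurableType d).
Local Notation Z := 'rV[R]_n.
Variables (mu : {sigma_finite_measure set Z -> \bar R}) (nu : {sigma_finite_measure set Y ->
  \bar R}).
Variables (s : Y -> Z) (ms : measurable_fun setT s).
Hypothesis mu_translate : forall (v : Z) (F : Z -> \bar R), measurable_fun setT F ->
  (forall x, 0 <= F x) -> \int[mu]_x F (v + x)%R = \int[mu]_x F x.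
Hypothesis nu_translate : forall (v : Z) (F : Z -> \bar R), measurable_fun setT F ->
  (forall x, 0 <= F x) -> \int[nu]_y F (v + s y)%R = \int[nu]_y F (s y).

(* Weil's proof of the uniqueness of Haar measure. *)
Lemma translation_invariant_proportional (f g : Z -> \bar R) :
  measurable_fun setT f -> measurable_fun setT g ->
  (forall x, 0 <= f x) -> (forall x, 0 <= g x) ->
  (\int[nu]_y g (s y)) * (\int[mu]_x f x) = (\int[mu]_x g x) * (\int[nu]_y f (- s y)%R).
Proof.
move=> mf mg f0 g0.
have mD (h : Z -> \bar R) (u : Z * Y -> Z) : measurable_fun setT h ->
    measurable_fun setT u -> measurable_fun setT (fun p => h (u p)).
  by move=> mh mu'; exact: measurableT_comp.
have m1 : measurable_fun setT (fst : Z * Y -> Z) by exact: measurable_fst.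
have m2 : measurable_fun setT (fun p : Z * Y => s p.2).
  by apply: measurableT_comp => //; exact: measurable_snd.
have mgs : measurable_fun setT (fun y => g (s y)) by exact: measurableT_comp.
have mopp : measurable_fun setT (fun z : Z => - z)%R.
  by under eq_fun do rewrite -scaleN1r; exact: measurable_funZ_rV.
have mN : measurable_fun setT (fun y => f (- s y)%R).
  by apply: measurableT_comp => //; exact: measurableT_comp.
(* [h2] is [h1] after shifting x by [- s y]. Integrating [h1] in y first separates the integral of g
   from f; integrating [h2] in y first separates the integral of f from g. *)
pose h1 (p : Z * Y) := f p.1 * g (p.1 + s p.2)%R.
pose h2 (p : Z * Y) := f (p.1 - s p.2)%R * g p.1.
have mh1 : measurable_fun setT h1.
  by apply: emeasurable_funM; apply: mD => //; exact: measurable_funD_rV.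
have mh2 : measurable_fun setT h2.
  by apply: emeasurable_funM; apply: mD => //; exact: measurable_funB_rV.
have h10 p : 0 <= h1 p by rewrite mule_ge0.
have h20 p : 0 <= h2 p by rewrite mule_ge0.
transitivity (\int[mu]_x \int[nu]_y h1 (x, y)).
  rewrite muleC -ge0_integralZr//; last exact: integral_ge0.
  apply: eq_integral => x _; rewrite -(nu_translate x)// /h1/= ge0_integralZl//.
  apply: measurableT_comp => //; exact: measurable_funD_rV.
rewrite (@fubini_tonelli _ _ _ _ _ mu nu h1 mh1 h10).
transitivity (\int[nu]_y \int[mu]_x h2 (x, y)).
  apply: eq_integral => y _.
  rewrite -(mu_translate (- s y)%R (F := fun x => h1 (x, y)))//; last first.
    exact: measurable_fun_pair1.
  by apply: eq_integral => x _; rewrite /h1 /h2/= addrAC addNr add0r addrC.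
rewrite -(@fubini_tonelli _ _ _ _ _ mu nu h2 mh2 h20) -ge0_integralZr//; last exact: integral_ge0.
apply: eq_integral => x _.
rewrite /h2/= ge0_integralZr//; last first.
  by apply: measurableT_comp => //; exact: measurable_funB_rV.
rewrite muleC; congr (_ * _).
rewrite -(nu_translate (- x)%R (F := fun z => f (- z)%R))//.
  by apply: eq_integral => y _; rewrite opprD opprK.
exact: measurableT_comp.
Qed.

End weil.

(** From (1 + u)^m <= exp(m u), completing the square in m u - b u^2 gives the maximum m^2 / (4
    b). *)
Lemma exp_envelope_polynomial (R : realType) (b : R) (m : nat) : 0 < b ->
  exists2 C : R, 0 < C & forall u : R, 0 <= u -> expR (- (b * u ^+ 2)) * (1 + u) ^+ m <= C.
Proof.
move=> b0; exists (expR (m%:R ^+ 2 / (4 * b))); first exact: expR_gt0.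
move=> u u0; have u1 : (1 + u) ^+ m <= expR (m%:R * u).
  rewrite expRM_natl lerXn2r ?nnegrE ?addr_ge0 ?expR_ge0//.
  exact: expR_ge1Dx.
apply: (@le_trans _ _ (expR (- (b * u ^+ 2)) * expR (m%:R * u))).
  by rewrite ler_wpM2l ?expR_ge0.
rewrite -expRD ler_expR -subr_ge0.
rewrite (_ : _ - _ = b * (u - m%:R / (2 * b)) ^+ 2); last first.
  by field; rewrite gt_eqF.
by rewrite mulr_ge0 ?sqr_ge0// ltW.
Qed.

(** * Homogeneous measures and Gaussian integrals *)

Section homogeneous_measure.
Local Open Scope ereal_scope.
Context (R : realType) (n : nat) (ip : {dot 'rV[R]_n for idfun}) (N : nat).
Local Notation Z := 'rV[R]_n.
Local Notation nrm := (ipnorm ip).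
Variable m : {measure set Z -> \bar R}.
Hypothesis m_scale : forall (t : R) (A : set Z), (0 < t)%R -> measurable A ->
  m ((fun x => t^-1 *: x)%R @^-1` A) = (t ^+ N)%:E * m A.
Hypothesis m_unit_ball : m [set x | nrm x <= 1]%R < +oo.

Lemma measurable_ipnorm_ball (r : R) : measurable [set x : Z | nrm x <= r]%R.
Proof.
rewrite (_ : mkset _ = nrm @^-1` `]-oo, r]); last first.
  by apply/seteqP; split=> x /=; rewrite in_itv.
by rewrite -[X in measurable X]setTI; exact: measurable_ipnorm.
Qed.

(* For [b > 0], bounds [gauss b x'] for every [x'] within distance 1 of [x]. *)
Definition gauss_envelope (b : R) (x : Z) : R :=
  expR (- (b * (Num.max (nrm x - 1) 0) ^+ 2))%R.

Lemma measurable_gauss_envelope b : measurable_fun setT (gauss_envelope b).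
Proof.
apply: measurableT_comp => //; apply: measurableT_comp => //.
apply: measurable_funM => //; apply: measurable_funX; apply: measurable_maxr => //.
by apply: measurable_funB => //; exact: measurable_ipnorm.
Qed.

(* The dyadic sum [q] is integrable by homogeneity, and dominates the envelope. *)
Lemma integral_gauss_envelope_lty (b : R) : (0 < b)%R ->
  \int[m]_x (gauss_envelope b x)%:E < +oo.
Proof.
move=> b0; have [C C0 Cb] := exp_envelope_polynomial N.+1 b0.
(* [B k] has 2^(k N) times the mass of the unit ball, so the exponent N + 1 leaves the convergent
   geometric series of 2^(-k). *)
pose a (k : nat) : R := ((2 ^+ k)^-1 ^+ N.+1)%R.
pose B k := [set x : Z | nrm x <= 2 ^+ k]%R.
have a0 k : (0 <= a k)%R by rewrite exprn_ge0// invr_ge0 exprn_ge0.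
have mB k : measurable (B k) by exact: measurable_ipnorm_ball.
have mBE k : m (B k) = ((2 ^+ k) ^+ N)%:E * m (B 0%N).
  rewrite -m_scale ?exprn_gt0//; congr (m _); apply/seteqP; split=> x;
    by rewrite /B/= ipnormZ expr0 ger0_norm ?invr_ge0 ?exprn_ge0// mulrC ler_pdivrMr ?exprn_gt0// mul1r.
pose q (x : Z) : \bar R := \sum_(0 <= k <oo) (a k)%:E * (\1_(B k) x)%:E.
have mq : measurable_fun setT q.
  apply: ge0_emeasurable_sum => k; first by move=> x _ _; rewrite mule_ge0 ?lee_fin.
  move=> _; apply: measurable_funeM; apply/measurable_EFinP; exact: measurable_indic.
have q0 x : 0 <= q x by apply: nneseries_ge0 => k _ _; rewrite mule_ge0 ?lee_fin.
apply: (@le_lt_trans _ _ (\int[m]_x ((C * 4 ^+ N.+1)%:E * q x))).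
  apply: ge0_le_integral => //.
  - by move=> x _; rewrite lee_fin expR_ge0.
  - by apply/measurable_EFinP; exact: measurable_gauss_envelope.
  - exact: measurable_funeM.
  move=> x _; pose u := Num.max (nrm x - 1)%R 0%R.
  have u0 : (0 <= u)%R by rewrite le_max lexx orbT.
  have xu : (nrm x <= 1 + u)%R by rewrite -lerBlDl le_max lexx.
  have exk : exists k, (1 + u <= 2 ^+ k)%R.
    exists (Num.truncn (1 + u)%R).+1; apply: (le_trans (ltW (truncnS_gt _))).
    by rewrite -natrX ler_nat ltnW// ltn_expl.
  case: (ex_minnP exk) => k uk mink.
  (* By minimality of [k] the radius 2^k is comparable to 1 + u, so the single weight [a k] already
     dominates the envelope, up to a constant. *)
  have k2 : (2 ^+ k <= 4 * (1 + u))%R.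
    case: k uk mink => [|k] uk mink; first by rewrite expr0; lra.
    have : (2 ^+ k < 1 + u)%R by rewrite ltNge; apply/negP => /mink; rewrite ltnn.
    by rewrite exprS; move=> h; lra.
  apply: (@le_trans _ _ ((C * 4 ^+ N.+1)%:E * (a k)%:E)); last first.
    rewrite lee_wpmul2l ?lee_fin ?mulr_ge0 ?exprn_ge0 ?(ltW C0)//.
    rewrite (_ : (a k)%:E = (a k)%:E * (\1_(B k) x)%:E); last first.
      by rewrite indicE mem_set ?mule1// /B/= (le_trans xu).
    rewrite /q (nneseriesD1 (n := k))//.
      by rewrite leeDl// nneseries_ge0// => i _ _; rewrite mule_ge0 ?lee_fin.
    by move=> i _; rewrite mule_ge0 ?lee_fin.
  rewrite -EFinM lee_fin /a exprVn -[leRHS]mulrA.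
  rewrite -exprVn -exprMn.
  have -> : (C * (4 * (2 ^+ k)^-1) ^+ N.+1 =
    (C * (4 * (1 + u) / 2 ^+ k) ^+ N.+1) / (1 + u) ^+ N.+1)%R.
    by rewrite -mulrA -expr_div_n; congr (_ * _ ^+ _)%R; field; rewrite !gt_eqF ?exprn_gt0//; lra.
  have u1 : (0 < (1 + u) ^+ N.+1)%R by rewrite exprn_gt0//; lra.
  rewrite ler_pdivlMr//; apply: (le_trans (Cb u u0)).
  apply: ler_peMr; first exact: ltW.
  rewrite -[leLHS](expr1n _ N.+1) lerXn2r ?nnegrE//.
    by rewrite divr_ge0 ?exprn_ge0//; lra.
  by rewrite ler_pdivlMr ?exprn_gt0// mul1r.
rewrite ge0_integralZl//; last by rewrite lee_fin mulr_ge0 ?exprn_ge0 ?(ltW C0).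
rewrite lte_mul_pinfty// ?lee_fin ?mulr_ge0 ?exprn_ge0 ?(ltW C0)//.
rewrite integral_nneseries//; last 2 first.
- by move=> k; apply: measurable_funeM; apply/measurable_EFinP; exact: measurable_indic.
- by move=> k x _; rewrite mule_ge0 ?lee_fin.
have fB0 : m (B 0%N) < +oo by rewrite /B expr0.
have -> : \sum_(0 <= k <oo) \int[m]_x ((a k)%:E * (\1_(B k) x)%:E) =
    \sum_(0 <= k <oo) (fine (m (B 0%N)) / 2 ^+ k)%:E.
  apply: eq_eseriesr => k _.
  have mi : measurable_fun setT (fun x => (\1_(B k) x)%:E : \bar R).
    by apply/measurable_EFinP; exact: measurable_indic.
  have i0 (x : Z) : setT x -> 0 <= (\1_(B k) x)%:E :> \bar R by rewrite lee_fin.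
  rewrite (ge0_integralZl_EFin _ _ i0 mi)//.
  rewrite integral_indic// setIT (mBE k) muleA -EFinM [RHS]EFinM fineK;
    last by rewrite ge0_fin_numE.
  rewrite [LHS]muleC; congr (_ * _%:E).
  by rewrite /a exprSr mulrAC exprVn mulVf ?mul1r// gt_eqF// !exprn_gt0.
have := @cvg_geometric_eseries_half R (fine (m (B 0%N)) * 2) 0.
rewrite expr0 divr1 => /cvg_lim h.
rewrite (_ : \sum_(0 <= k <oo) _ = (fine (m (B 0%N)) * 2)%:E) ?ltry//.
rewrite -h//; congr (limn _); apply/funext => k; apply: eq_bigr => i _.
by congr (_%:E); rewrite natrX addn1 exprS; field; rewrite gt_eqF// exprn_gt0.
Qed.

Lemma measurable_gauss (b : R) : measurable_fun setT (gauss ip b).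
Proof.
apply: measurableT_comp => //; apply: measurableT_comp => //.
by apply: measurable_funM => //; apply: measurable_funX; exact: measurable_ipnorm.
Qed.

Lemma gauss_gt0 (b : R) x : (0 < gauss ip b x)%R.
Proof. exact: expR_gt0. Qed.

Lemma gauss_le_envelope (b : R) x : (0 < b)%R -> (gauss ip b x <= gauss_envelope b x)%R.
Proof.
move=> b0; rewrite ler_expR lerN2 ler_pM2l// lerXn2r ?nnegrE ?ipnorm_ge0//.
  by rewrite le_max lexx orbT.
by rewrite ge_max ipnorm_ge0 andbT lerBlDr lerDl.
Qed.

Lemma integral_gauss_lty (b : R) : (0 < b)%R -> \int[m]_x (gauss ip b x)%:E < +oo.
Proof.
move=> b0; apply: le_lt_trans (integral_gauss_envelope_lty b0).
apply: ge0_le_integral => //.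
- by move=> x _; rewrite lee_fin ltW// gauss_gt0.
- by apply/measurable_EFinP; exact: measurable_gauss.
- by apply/measurable_EFinP; exact: measurable_gauss_envelope.
- by move=> x _; rewrite lee_fin gauss_le_envelope.
Qed.

Lemma integral_gauss_gt0 (b : R) : 0 < m setT -> 0 < \int[m]_x (gauss ip b x)%:E.
Proof.
move=> mT; rewrite lt0e integral_ge0 ?andbT//; last by move=> x _; rewrite lee_fin ltW// gauss_gt0.
apply/eqP => i0; have : \int[m]_x `|(gauss ip b x)%:E| = 0.
  by rewrite -[RHS]i0; apply: eq_integral => x _; rewrite gee0_abs// lee_fin ltW// gauss_gt0.
move/(ae_eq_integral_abs _ measurableT) => -[|M [mM M0 sM]].
  by apply/measurable_EFinP; exact: measurable_gauss.
have : m setT <= m M.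
  apply: le_measure; rewrite ?inE// => x _; apply: sM => /= /(_ Logic.I)[] /eqP.
  by rewrite gt_eqF// gauss_gt0.
by rewrite M0 leNgt mT.
Qed.

End homogeneous_measure.

(** * Orthogonal splitting and nearest-point projection *)

Section orthogonal_splitting.
Context (R : realType) (n : nat) (ip : {dot 'rV[R]_n for idfun}).
Local Notation Z := 'rV[R]_n.
Local Notation nrm := (ipnorm ip).
Variables (E0 V : set Z) (P : 'M[R]_n) (p : Z).
Hypothesis E0_lin : forall a u v, E0 u -> E0 v -> E0 (a *: u + v).
Hypothesis V_lin : forall a u v, V u -> V v -> V (a *: u + v).
Hypothesis E0V : forall u v, E0 u -> V v -> ip u v = 0.
Hypothesis E0P : forall x, E0 (x *m P).
Hypothesis VP : forall x, V (x - x *m P).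

(** An explicit formula for P_E from the linear projection [P] onto [E0]: unlike the closest point
    picked by [get], it is visibly measurable. *)
Definition affine_proj (x : Z) : Z := p + (x - p) *m P.
Local Notation pi := affine_proj.
Local Notation E := [set p + v | v in E0].

Lemma E0_sub u v : E0 u -> E0 v -> E0 (u - v).
Proof. by move=> Eu Ev; rewrite addrC -scaleN1r; exact: E0_lin. Qed.

Lemma V_sub u v : V u -> V v -> V (u - v).
Proof. by move=> Eu Ev; rewrite addrC -scaleN1r; exact: V_lin. Qed.

(** The difference of the two decompositions of u + v lies in both [E0] and [V], so it is orthogonal
    to itself. *)
Lemma proj_split u v : E0 u -> V v -> (u + v) *m P = u.
Proof.
move=> Eu Vv; apply/eqP; rewrite -subr_eq0; apply/eqP; apply: (ipxx_eq0 (ip := ip)).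
apply: E0V; first by apply: E0_sub.
have -> : (u + v) *m P - u = v - ((u + v) - (u + v) *m P).
  by move: (_ *m P) => w; apply/rowP => j; rewrite !mxE; ring.
exact: V_sub.
Qed.

Lemma affine_proj_mem x : E (pi x).
Proof. by exists ((x - p) *m P). Qed.

Lemma affine_proj_ortho x : V (x - pi x).
Proof. by rewrite /affine_proj opprD addrA. Qed.

Lemma affine_proj_split xi eta : E xi -> V eta -> pi (xi + eta) = xi.
Proof.
by move=> [u Eu <-] Veta; rewrite /affine_proj (_ : p + u + eta - p = u + eta) ?proj_split//;
  apply/rowP => j; rewrite !mxE; ring.
Qed.

Lemma E_sub xi xi' : E xi -> E xi' -> E0 (xi - xi').
Proof.
move=> [u Eu <-] [v Ev <-]; rewrite opprD addrACA subrr add0r; exact: E0_sub.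
Qed.

(** Differences of projections lie in [E0], differences of residuals in [V]. This one identity
    yields both 1-Lipschitz bounds and the Pythagorean formula. *)
Lemma affine_proj_dist x y :
  nrm (x - y) ^+ 2 = nrm (pi x - pi y) ^+ 2 + nrm ((x - pi x) - (y - pi y)) ^+ 2.
Proof.
rewrite -ipnormD_ortho.
  by congr (nrm _ ^+ 2); move: (pi x) (pi y) => a b; apply/rowP => j; rewrite !mxE; ring.
apply: E0V; first by apply: E_sub; exact: affine_proj_mem.
by apply: V_sub; exact: affine_proj_ortho.
Qed.

Lemma affine_proj_lip x y : nrm (pi x - pi y) <= nrm (x - y).
Proof.
rewrite -ler_sqr ?nnegrE ?ipnorm_ge0// (affine_proj_dist x y) lerDl.
by rewrite exprn_ge0// ipnorm_ge0.
Qed.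

Lemma affine_proj_ortho_lip x y : nrm ((x - pi x) - (y - pi y)) <= nrm (x - y).
Proof.
rewrite -ler_sqr ?nnegrE ?ipnorm_ge0// [leRHS](affine_proj_dist x y) lerDr.
by rewrite exprn_ge0// ipnorm_ge0.
Qed.

Lemma affine_proj_pythagoras y z : E z ->
  nrm (y - z) ^+ 2 = nrm (y - pi y) ^+ 2 + nrm (z - pi y) ^+ 2.
Proof.
move=> Ez; have piz : pi z = z.
  rewrite -[in LHS](addr0 z) affine_proj_split//.
  by rewrite -(subrr (y - pi y)); apply: V_sub; exact: affine_proj_ortho.
by rewrite affine_proj_dist piz subrr subr0 addrC ipnormB.
Qed.

(** [pi y] is a minimizer, so [get] returns some minimizer; the Pythagorean formula forces that one
    to be at distance 0 from [pi y]. *)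
Lemma closest_pointE y : closest_point ip E y = pi y.
Proof.
have : exists z, E z /\ forall w, E w -> nrm (y - z) <= nrm (y - w).
  exists (pi y); split; first exact: affine_proj_mem.
  move=> w Ew; rewrite -ler_sqr ?nnegrE ?ipnorm_ge0// (affine_proj_pythagoras y Ew) lerDl.
  by rewrite exprn_ge0// ipnorm_ge0.
move=> /getPex; rewrite -/(closest_point ip E y); set z := closest_point _ _ _.
move=> [Ez /(_ _ (affine_proj_mem y))].
rewrite -ler_sqr ?nnegrE ?ipnorm_ge0// (affine_proj_pythagoras y Ez) gerDl => z0.
apply/eqP; rewrite -subr_eq0; apply/eqP; apply: (ipnorm_eq0 (ip := ip)).
by apply/eqP; rewrite -sqrf_eq0 eq_le z0 exprn_ge0// ipnorm_ge0.
Qed.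

Lemma measurable_mulmx m k (M : 'M[R]_(m, k)) :
  measurable_fun setT (fun x : 'rV[R]_m => x *m M).
Proof.
apply: measurable_fun_rV => j; under eq_fun do rewrite mxE.
apply: measurable_sum => i; apply: measurable_funM => //; exact: measurable_coord.
Qed.

Lemma measurable_affine_proj : measurable_fun setT pi.
Proof.
apply: measurable_funD_rV => //.
by apply: (measurableT_comp (measurable_mulmx P)); exact: measurable_funB_rV.
Qed.

Lemma measurable_rV_set1 (a : Z) : measurable [set a].
Proof.
rewrite (_ : [set a] = \bigcap_(j in [set: 'I_n]) ((fun x : Z => x 0 j) @^-1` [set a 0 j])).
  apply: fin_bigcap_measurable => // j _.
  by rewrite -[X in measurable X]setTI; exact: measurable_coord.
apply/seteqP; split=> [x -> //|x xa]; apply/rowP => j; exact: (xa j).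
Qed.

Lemma measurable_affine : measurable E.
Proof.
rewrite (_ : E = (fun x => x - pi x) @^-1` [set 0]).
  rewrite -[X in measurable X]setTI.
  apply: (measurable_funB_rV (f := id)) => //; first exact: measurable_affine_proj.
  exact: measurable_rV_set1.
apply/seteqP; split=> x /=.
  move=> Ex; have V0 : V 0 by rewrite -(subrr (x - pi x)); apply: V_sub; exact: affine_proj_ortho.
  by rewrite -[X in pi X](addr0 x) affine_proj_split// subrr.
by move=> /eqP; rewrite subr_eq0 => /eqP ->; exact: affine_proj_mem.
Qed.

Lemma measurable_orthocompl : measurable V.
Proof.
rewrite (_ : V = (fun x => x *m P) @^-1` [set 0]).
  rewrite -[X in measurable X]setTI.
  by apply: measurable_mulmx => //; exact: measurable_rV_set1.
apply/seteqP; split=> x /=.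
  move=> Vx; rewrite -[X in X *m P](add0r x) proj_split//.
  by rewrite -(subrr (x *m P)); exact: E0_sub.
by move=> x0; rewrite -(subr0 x) -x0.
Qed.

End orthogonal_splitting.

Section linear_image.
Context (R : realType) (n : nat) (ip : {dot 'rV[R]_n for idfun}).

Lemma ipnorm_mulmx (M : 'M[R]_n) :
  exists2 K, 0 < K & forall x, ipnorm ip (x *m M) <= K * ipnorm ip x.
Proof.
have [K K0 xK] := coord_ipnorm ip.
exists (K * (1 + \sum_i ipnorm ip (row i M))).
  by rewrite mulr_gt0// ltr_wpDr// sumr_ge0// => i _; exact: ipnorm_ge0.
move=> x; rewrite mulmx_sum_row; apply: (le_trans (ipnorm_sum _ _ _)).
apply: (@le_trans _ _ (\sum_i (K * ipnorm ip x) * ipnorm ip (row i M))).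
  by apply: ler_sum => i _; rewrite ipnormZ ler_wpM2r ?ipnorm_ge0.
rewrite -mulr_sumr mulrAC ler_wpM2r ?ipnorm_ge0// ler_wpM2l ?(ltW K0)//.
by rewrite lerDr.
Qed.

End linear_image.

(** * Hausdorff measure on N-planes *)

Section hausdorff_on_theory.
Local Open Scope ereal_scope.
Context (R : realType) (n : nat) (ip : {dot 'rV[R]_n for idfun}) (N : nat).
Hypothesis N_gt0 : (0 < N)%N.
Local Notation Z := 'rV[R]_n.
Local Notation nrm := (ipnorm ip).

Lemma hausdorff_on_sigma_finite (S : set Z) (B : 'M[R]_(N, n)) (p : Z) :
  measurable S -> row_free B -> S `<=` [set (p + w *m B)%R | w in [set: 'rV[R]_N]] ->
  exists m : {sigma_finite_measure set Z -> \bar R},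
    (m : set Z -> \bar R) = hausdorff_on ip N S.
Proof.
move=> mS Bfree SB; have [m mE] := hausdorff_on_measure ip N_gt0 mS.
have [|m' m'E] := sigma_finite_rV (m := m); last by exists m'; rewrite m'E.
by move=> k; rewrite mE; exact: (@hausdorff_on_frame_lty _ _ ip N N_gt0 B S p k%:R Bfree SB).
Qed.

Lemma hausdorff_on_translate (S S' A : set Z) (v : Z) : (forall x, S' (v + x)%R <-> S x) ->
  hausdorff_on ip N S ((fun x => v + x)%R @^-1` A) = hausdorff_on ip N S' A.
Proof.
move=> SS'; rewrite /hausdorff_on /restriction -(hausdorff_translate ip N v).
congr (hausdorff _ _ _); apply/seteqP; split=> [_ [x [Ax Sx] <-]|x [Ax Sx]].
  by split=> //; apply/SS'.
by exists (- v + x)%R; [split; [rewrite /= addNKr|apply/SS'; rewrite addNKr]|rewrite addNKr].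
Qed.

Lemma hausdorff_on_scale (S A : set Z) (t : R) : (0 < t)%R ->
  (forall a x, S x -> S (a *: x)%R) ->
  hausdorff_on ip N S ((fun x => t^-1 *: x)%R @^-1` A) = (t ^+ N)%:E * hausdorff_on ip N S A.
Proof.
move=> t0 SZ; rewrite /hausdorff_on /restriction -(hausdorff_scale ip N _ t0).
congr (hausdorff _ _ _); apply/seteqP; split=> [x [Ax Sx]|_ [x [Ax Sx] <-]].
  exists (t^-1 *: x)%R; first by split=> //; exact: SZ.
  by rewrite scalerA divff ?gt_eqF// scale1r.
by split; [rewrite /= scalerA mulVf ?gt_eqF// scale1r|exact: SZ].
Qed.

Lemma hausdorff_on_setC (S : set Z) : hausdorff_on ip N S (~` S) = 0.
Proof.
have [mu muE] := hausdorff_outer ip N_gt0.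
by rewrite /hausdorff_on /restriction setICl -muE outer_measure0.
Qed.

Lemma hausdorff_on_unit_ball_lty (S : set Z) (B : 'M[R]_(N, n)) :
  row_free B -> S `<=` [set (w *m B)%R | w in [set: 'rV[R]_N]] ->
  hausdorff_on ip N S [set x | nrm x <= 1]%R < +oo.
Proof.
move=> Bfree SB; have [K K0 xK] := norm_le_ipnorm ip.
apply: le_lt_trans (@hausdorff_on_frame_lty _ _ ip N N_gt0 B S 0%R K Bfree _); last first.
  by move=> x /SB[w _ <-]; exists w; rewrite ?add0r.
rewrite /hausdorff_on /restriction; apply: le_hausdorff => // x [/= x1 Sx]; split => //.
by rewrite /= (le_trans (xK x))// ler_piMr// ltW.
Qed.

(** The matrix [pinvmx C *m B] maps the span of [C] onto that of [B] and is Lipschitz, so a null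
    plane cannot be mapped onto a non-null one. *)
Lemma hausdorff_on_frames_gt0 (B C : 'M[R]_(N, n)) : row_free C ->
  0 < hausdorff_on ip N [set (w *m B)%R | w in [set: 'rV[R]_N]] setT ->
  0 < hausdorff_on ip N [set (w *m C)%R | w in [set: 'rV[R]_N]] setT.
Proof.
move=> Cfree; rewrite /hausdorff_on /restriction !setTI => HB.
have [K K0 xK] := ipnorm_mulmx ip (pinvmx C *m B).
have := @hausdorff_lipschitz _ _ ip N (fun x => x *m (pinvmx C *m B))%R K
  [set (w *m C)%R | w in [set: 'rV[R]_N]] K0.
have -> : [set x *m (pinvmx C *m B) | x in [set (w *m C)%R | w in [set: 'rV[R]_N]]]
    = [set (w *m B)%R | w in [set: 'rV[R]_N]].
  have CB w : (w *m C *m (pinvmx C *m B) = w *m B)%R.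
    by rewrite mulmxA -(mulmxA w C) mulmxVp// mulmx1.
  by rewrite image_comp; apply/seteqP; split=> _ [w _ <-]; exists w => //=; rewrite CB.
move=> H; have : 0 < (K ^+ N)%:E * hausdorff ip N [set (w *m C)%R | w in [set: 'rV[R]_N]].
  apply: lt_le_trans HB _; apply: H => x y _ _; rewrite -mulmxBl; exact: xK.
by rewrite pmule_rgt0// lte_fin exprn_gt0.
Qed.

End hausdorff_on_theory.

Section homogeneous_positive.
Local Open Scope ereal_scope.
Context (R : realType) (n : nat) (ip : {dot 'rV[R]_n for idfun}) (N : nat).
Local Notation Z := 'rV[R]_n.
Local Notation nrm := (ipnorm ip).
Variable m : {measure set Z -> \bar R}.
Hypothesis m_scale : forall (t : R) (A : set Z), (0 < t)%R -> measurable A ->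
  m ((fun x => t^-1 *: x)%R @^-1` A) = (t ^+ N)%:E * m A.

(** If the unit ball were null, so would be all its dilates, which exhaust the space. *)
Lemma homogeneous_unit_ball_gt0 : 0 < m setT -> 0 < m [set x | nrm x <= 1]%R.
Proof.
move=> mT; rewrite lt0e measure_ge0 andbT; apply/eqP => m0.
suff : m setT = 0 by move=> mT0; rewrite mT0 ltxx in mT.
pose B (k : nat) := [set x : Z | nrm x <= k.+1%:R]%R.
have mB k : measurable (B k) by exact: measurable_ipnorm_ball.
have mB0 k : m (B k) = 0.
  rewrite (_ : B k = (fun x => k.+1%:R^-1 *: x)%R @^-1` [set x | nrm x <= 1]%R).
    by rewrite m_scale ?ltr0n// ?m0 ?mule0//; exact: measurable_ipnorm_ball.
  apply/seteqP; split=> x; rewrite /B/= ipnormZ ger0_norm ?invr_ge0//;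
    by rewrite mulrC ler_pdivrMr ?ltr0n// mul1r.
apply/eqP; rewrite eq_le measure_ge0 andbT.
apply: (@le_trans _ _ (\sum_(0 <= k <oo) m (B k))).
  apply: measure_sigma_subadditive => // x _; exists (Num.truncn (nrm x)) => //=.
  exact/ltW/truncnS_gt.
by rewrite eseries0.
Qed.

End homogeneous_positive.

(** * Product measures and the disintegration formula *)

Section integral_restriction.
Local Open Scope ereal_scope.
Context d (T : measurableType d) (R : realType).
Variables (m : {measure set T -> \bar R}) (S : set T).
Hypotheses (mS : measurable S) (mSC : m (~` S) = 0).

Lemma eq_integral_support (f g : T -> \bar R) :
  measurable_fun setT f -> measurable_fun setT g ->
  (forall x, 0 <= f x) -> (forall x, 0 <= g x) -> (forall x, S x -> f x = g x) ->
  \int[m]_x f x = \int[m]_x g x.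
Proof.
move=> mf mg f0 g0 fg; apply: ge0_ae_eq_integral => //.
exists (~` S); split => //; first exact: measurableC.
by move=> x /= fgx Sx; apply: fgx => _; exact: fg.
Qed.

End integral_restriction.

Section sigma_finite_product.
Local Open Scope ereal_scope.
Context d1 d2 (T1 : measurableType d1) (T2 : measurableType d2) (R : realType).
Variables (m1 : {sigma_finite_measure set T1 -> \bar R}).
Variables (m2 : {sigma_finite_measure set T2 -> \bar R}).

Let prod_meas : set (T1 * T2)%type -> \bar R := m1 \x m2.

HB.instance Definition _ := Measure.on prod_meas.

Let prod_meas_sigma_finite : sigma_finite setT prod_meas.
Proof.
have /sigma_finiteP[F [TF ndF Foo]] := sigma_finiteT m1.
have /sigma_finiteP[G [TG ndG Goo]] := sigma_finiteT m2.
exists (fun k => F k `*` G k).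
  apply/seteqP; split=> // -[x y] _.
  have [i _ Fx] : (\bigcup_i F i) x by rewrite -TF.
  have [j _ Gy] : (\bigcup_i G i) y by rewrite -TG.
  exists (maxn i j) => //; split; [move: x Fx|move: y Gy]; apply/subsetPset.
    exact/ndF/leq_maxl.
  exact/ndG/leq_maxr.
move=> k; have [mF Fk] := Foo k; have [mG Gk] := Goo k; split; first exact: measurableX.
by rewrite /prod_meas product_measure1E// lte_mul_pinfty// ge0_fin_numE.
Qed.

HB.instance Definition _ :=
  Measure_isSigmaFinite.Build _ _ _ prod_meas prod_meas_sigma_finite.

(** In the uniqueness argument for Haar measure the product is itself one factor of a Tonelli
    exchange, so it needs a sigma-finite structure of its own. *)
Lemma sigma_finite_product :
  exists m : {sigma_finite_measure set (T1 * T2)%type -> \bar R},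
    (m : set (T1 * T2)%type -> \bar R) = m1 \x m2.
Proof. by exists prod_meas. Qed.

End sigma_finite_product.

Section disintegration.
Local Open Scope ereal_scope.
Context (R : realType) (n : nat) (ip : {dot 'rV[R]_n for idfun}).
Local Notation Z := 'rV[R]_n.
Local Notation nrm := (ipnorm ip).
Variables (E0 V : set Z) (P : 'M[R]_n) (p : Z).
Hypothesis E0_lin : forall a u v, E0 u -> E0 v -> E0 (a *: u + v)%R.
Hypothesis V_lin : forall a u v, V u -> V v -> V (a *: u + v)%R.
Hypothesis E0V : forall u v, E0 u -> V v -> ip u v = 0%R.
Hypothesis E0P : forall x, E0 (x *m P)%R.
Hypothesis VP : forall x, V (x - x *m P)%R.
Local Notation pi := (affine_proj P p).
Local Notation E := [set (p + v)%R | v in E0].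
Variables (mL mE mV : {sigma_finite_measure set Z -> \bar R}).
Hypothesis mL_translate : forall (v : Z) (A : set Z), measurable A ->
  mL ((fun x => v + x)%R @^-1` A) = mL A.
Hypothesis mE_translate : forall (v : Z) (A : set Z), E0 v -> measurable A ->
  mE ((fun x => v + x)%R @^-1` A) = mE A.
Hypothesis mV_translate : forall (v : Z) (A : set Z), V v -> measurable A ->
  mV ((fun x => v + x)%R @^-1` A) = mV A.
Hypotheses (mEC : mE (~` E) = 0) (mVC : mV (~` V) = 0).
Hypothesis mE_ball : 0 < mE [set x | nrm (x - p)%R <= 1]%R < +oo.
Hypothesis mV_ball : 0 < mV [set x | nrm x <= 1]%R < +oo.
Hypothesis mL_ball : forall k : nat, mL [set x | `|x| <= k%:R]%R < +oo.
Hypothesis mL_gt0 : 0 < mL setT.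

Let translate_int (m : {sigma_finite_measure set Z -> \bar R}) (v : Z) (F : Z -> \bar R) :
  (forall A : set Z, measurable A -> m ((fun x => v + x)%R @^-1` A) = m A) ->
  measurable_fun setT F -> (forall x, 0 <= F x) ->
  \int[m]_x F (v + x)%R = \int[m]_x F x.
Proof.
move=> mv mF F0.
rewrite (@ge0_integral_preimage _ _ _ _ _ m m (fun x => v + x)%R 1)// ?mul1e//.
  exact: measurable_funD_rV.
by move=> A mA; rewrite mul1e mv.
Qed.

Lemma disintegration : exists2 kappa : R, (0 < kappa)%R &
  forall f : Z -> \bar R, measurable_fun setT f -> (forall x, 0 <= f x) ->
  \int[mL]_x f x = kappa%:E * \int[mE]_x \int[mV]_y f (x + y)%R.
Proof.
(* The sign is chosen so that [f (- s q)], as it appears in Weil's identity, is f at the sum of the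
   two components. *)
pose s (q : Z * Z) : Z := (- (q.1 + q.2))%R.
have mopp : measurable_fun setT (fun z : Z => - z)%R.
  by under eq_fun do rewrite -scaleN1r; exact: measurable_funZ_rV.
have madd : measurable_fun setT (fun q : Z * Z => q.1 + q.2)%R.
  by apply: measurable_funD_rV; [exact: measurable_fst|exact: measurable_snd].
have ms : measurable_fun setT s by exact: measurableT_comp.
have [nu nuEE] := sigma_finite_product mE mV.
have nuE (F : Z -> \bar R) : measurable_fun setT F -> (forall x, 0 <= F x) ->
    \int[nu]_q F (q.1 + q.2)%R = \int[mE]_x \int[mV]_y F (x + y)%R.
  move=> mF F0; rewrite nuEE (@fubini_tonelli1 _ _ _ _ _ mE mV (fun q => F (q.1 + q.2)%R))//.
  exact: measurableT_comp.
have mint (F : Z -> \bar R) : measurable_fun setT F -> (forall x, 0 <= F x) ->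
    measurable_fun setT (fun x : Z => \int[mV]_y F (x + y)%R).
  move=> mF F0.
  have := @measurable_fun_fubini_tonelli_F _ _ _ _ _ mV (fun q : Z * Z => F (q.1 + q.2)%R).
  apply => //.
  exact: measurableT_comp.
have nuT v (F : Z -> \bar R) : measurable_fun setT F -> (forall x, 0 <= F x) ->
    \int[nu]_q F (v + (q.1 + q.2))%R = \int[nu]_q F (q.1 + q.2)%R.
  move=> mF F0.
  have mFv w : measurable_fun setT (fun z : Z => F (w + z)%R).
    by apply: measurableT_comp => //; exact: measurable_funD_rV.
  rewrite (nuE (fun z => F (v + z)%R) (mFv v) (fun z => F0 _)) (nuE F mF F0).
  (* The translation splits into [u] in [E0], absorbed by [mE], and [v - u] in [V], absorbed by
     [mV]. *)
  pose u := (v *m P)%R.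
  have mEu (A : set Z) : measurable A -> mE ((fun x => u + x)%R @^-1` A) = mE A.
    by move=> mA; apply: mE_translate => //; exact: E0P.
  have mVu (A : set Z) : measurable A -> mV ((fun x => (v - u) + x)%R @^-1` A) = mV A.
    by move=> mA; apply: mV_translate => //; exact: VP.
  have i0 (x : Z) : 0 <= \int[mV]_y F (x + y)%R by exact: integral_ge0.
  rewrite -(translate_int mEu (mint F mF F0) i0).
  apply: eq_integral => x _.
  rewrite -(translate_int mVu (mFv (u + x)%R) (fun=> F0 _)).
  by apply: eq_integral => y _; congr F; apply/rowP => j; rewrite !mxE; ring.
have nuTs v (F : Z -> \bar R) : measurable_fun setT F -> (forall x, 0 <= F x) ->
    \int[nu]_q F (v + s q)%R = \int[nu]_q F (s q).
  move=> mF F0; have mFN : measurable_fun setT (fun z : Z => F (- z)%R).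
    exact: measurableT_comp.
  have := nuT (- v)%R (fun z => F (- z)%R) mFN (fun=> F0 _); rewrite /s => <-.
  by apply: eq_integral => q _; rewrite [in RHS]opprD opprK.
pose BV := [set x : Z | nrm x <= 1]%R.
have mBV : measurable BV by exact: measurable_ipnorm_ball.
(* Test set for Weil's identity: the z whose opposite is the sum of a point of E at distance at most
   1 from p and a vector of V of norm at most 1. The integral of its indicator along [s] is a
   product of two ball masses, finite and positive; being bounded, it also has finite [mL]
   measure. *)
pose C := ((fun z => pi (- z) - p)%R @^-1` BV) `&` ((fun z => - z - pi (- z))%R @^-1` BV).
have mpi : measurable_fun setT (fun z : Z => pi (- z)%R).
  by apply: measurableT_comp => //; exact: measurable_affine_proj.
have mC : measurable C.
  apply: measurableI; rewrite -[X in measurable X]setTI.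
    exact: measurable_funB_rV.
  exact: measurable_funB_rV.
pose g (z : Z) : \bar R := (\1_C z)%:E.
have mg : measurable_fun setT g by apply/measurable_EFinP; exact: measurable_indic.
have g0 z : 0 <= g z by rewrite lee_fin.
pose BE := [set x : Z | nrm (x - p)%R <= 1]%R.
have mBE : measurable BE.
  rewrite (_ : BE = (fun z => z - p)%R @^-1` BV)//.
  by rewrite -[X in measurable X]setTI; exact: measurable_funB_rV.
have mEs : measurable E := measurable_affine p E0_lin V_lin E0V E0P VP.
have mVs : measurable V := measurable_orthocompl E0_lin V_lin E0V E0P VP.
have mgN : measurable_fun setT (fun z : Z => g (- z)%R) by exact: measurableT_comp.
have mI (A : set Z) : measurable A -> measurable_fun setT (fun z => (\1_A z)%:E : \bar R).
  by move=> mA; apply/measurable_EFinP; exact: measurable_indic.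
have nug : \int[nu]_q g (s q) = mE BE * mV BV.
  rewrite /s (nuE (fun z => g (- z)%R))//.
  transitivity (\int[mE]_x ((\1_BE x)%:E * mV BV)).
    apply: (eq_integral_support mEs mEC).
    - exact: (mint _ mgN).
    - by apply: emeasurable_funM => //; exact: mI.
    - by move=> x; exact: integral_ge0.
    - by move=> x; rewrite mule_ge0 ?lee_fin.
    move=> x Ex; have -> : mV BV = \int[mV]_y (\1_BV y)%:E by rewrite integral_indic// setIT.
    rewrite -ge0_integralZl//; last exact: mI.
    apply: (eq_integral_support mVs mVC).
    - by apply: (measurableT_comp mgN); exact: measurable_funD_rV.
    - by apply: measurable_funeM; exact: mI.
    - by move=> y.
    - by move=> y; rewrite -EFinM lee_fin mulr_ge0.
    move=> y Vy; rewrite /g -EFinM; congr (_%:E).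
    rewrite !indicE -natrM mulnb; congr (_%:R)%R; congr (nat_of_bool _).
    have yE : (x + y - x = y)%R by rewrite addrC addKr.
    apply/idP/andP.
      rewrite inE /C/= opprK (affine_proj_split E0_lin V_lin E0V E0P VP)// yE.
      by move=> [? ?]; rewrite !inE.
    by rewrite !inE /C/= opprK (affine_proj_split E0_lin V_lin E0V E0P VP)// yE.
  by rewrite ge0_integralZr//; [rewrite integral_indic// setIT|exact: mI].
have mLg : \int[mL]_z g z < +oo.
  rewrite integral_indic// setIT.
  have [K K0 xK] := norm_le_ipnorm ip.
  apply: le_lt_trans (mL_ball (Num.truncn (K * (2 + nrm p))%R).+1).
  apply: le_measure; rewrite ?inE//; first exact: measurable_norm_ball.
  move=> z [/= z1 z2]; apply: (le_trans _ (ltW (truncnS_gt _))).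
  apply: (le_trans (xK z)); rewrite ler_wpM2l ?(ltW K0)// -ipnormN.
  rewrite (_ : - z = (- z - pi (- z)) + (pi (- z) - p) + p)%R; last first.
    by move: (pi _) => w; apply/rowP => j; rewrite !mxE; ring.
  apply: (le_trans (ipnormD _ _ _)); rewrite lerD2r; apply: (le_trans (ipnormD _ _ _)).
  by rewrite -[leRHS]/(1 + 1)%R lerD.
have /andP[BE0 BEy] := mE_ball; have /andP[BV0 BVy] := mV_ball.
pose a := fine (mE BE * mV BV); pose b := fine (\int[mL]_z g z).
have fBE : mE BE \is a fin_num by rewrite ge0_fin_numE.
have fBV : mV BV \is a fin_num by rewrite ge0_fin_numE.
have a0 : (0 < a)%R.
  by rewrite fine_gt0// mule_gt0//= ltey_eq fin_numM.
have aE : a%:E = mE BE * mV BV by rewrite fineK// fin_numM.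
have bE : b%:E = \int[mL]_z g z by rewrite fineK// ge0_fin_numE// integral_ge0.
have main (f : Z -> \bar R) : measurable_fun setT f -> (forall x, 0 <= f x) ->
  \int[mL]_x f x = (b / a)%:E * \int[mE]_x \int[mV]_y f (x + y)%R.
  move=> mf f0; have := translation_invariant_proportional ms
    (fun v F mF F0 => @translate_int mL v F (mL_translate v) mF F0) nuTs mf mg f0 g0.
  rewrite nug -aE -bE (eq_integral (fun q : Z * Z => f (q.1 + q.2)%R)); last first.
    by move=> q _; rewrite /s opprK.
  rewrite (nuE f mf f0) => h.
  by rewrite mulrC EFinM -muleA -h muleA -EFinM mulVf ?mul1e// gt_eqF.
exists (b / a)%R => //; have b0 : (0 <= b)%R by apply: fine_ge0; exact: integral_ge0.
rewrite lt_neqAle divr_ge0 ?(ltW a0)// andbT.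
(* A zero constant would give the function 1 integral zero, so [mL] would vanish. *)
apply/eqP => ba0; move: mL_gt0.
have := main (cst 1) (@measurable_cst _ _ _ _ setT 1) (fun=> lee01).
by rewrite -ba0 mul0e integral_cst// mul1e => ->; rewrite ltxx.
Qed.

End disintegration.

(** * Densities and atomic measures *)

Section ae_integral.
Local Open Scope ereal_scope.
Context d (T : measurableType d) (R : realType) (mu : {measure set T -> \bar R}).
Import HBNNSimple.

(** A simple function below f, cut off on the exceptional null set, keeps its integral and lies
    below g. Only the simple functions and the null set have to be measurable. *)
Lemma ge0_ae_eq_integral_any (f g : T -> \bar R) :
  (forall x, 0 <= f x) -> (forall x, 0 <= g x) -> {ae mu, forall x, f x = g x} ->
  \int[mu]_x f x = \int[mu]_x g x.
Proof.
suff le_fg (f' g' : T -> \bar R) : (forall x, 0 <= f' x) -> (forall x, 0 <= g' x) ->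
    {ae mu, forall x, f' x = g' x} -> \int[mu]_x f' x <= \int[mu]_x g' x.
  move=> f0 g0 fg; apply/eqP; rewrite eq_le !le_fg//.
  by apply: filterS fg => x ->.
move=> f0 g0 [M [mM M0 fgM]]; rewrite !ge0_integralTE//.
apply: ge_ereal_sup => _ [h /= hf <-].
have mMC : measurable (~` M) by exact: measurableC.
have -> : sintegral mu h = sintegral mu (proj_nnsfun h mMC).
  rewrite -!integralT_nnsfun; apply: ge0_ae_eq_integral => //.
  - by apply/measurable_EFinP.
  - by apply/measurable_EFinP.
  - by move=> x _; rewrite lee_fin.
  - by move=> x _; rewrite lee_fin.
  exists M; split => // x /= hx; apply: contrapT => xM; apply: hx => _.
  by rewrite mindicE mem_set// mulr1.
apply: ereal_sup_ubound; exists (proj_nnsfun h mMC) => // x /=; rewrite mindicE.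
have [xM|xM] := boolP (x \in ~` M); last by rewrite mulr0 g0.
rewrite mulr1; have <- : f' x = g' x.
  by apply: contrapT => fg; move: xM; rewrite inE; apply; exact: fgM.
exact: hf.
Qed.

(* Unlike [ae_eq_integral], no measurability is required. *)
Lemma ae_eq_integral_any (f g : T -> \bar R) : {ae mu, forall x, f x = g x} ->
  \int[mu]_x f x = \int[mu]_x g x.
Proof.
move=> fg; rewrite integralE [RHS]integralE; congr (_ - _);
  apply: ge0_ae_eq_integral_any => //; apply: filterS fg => x fgx.
- by rewrite !funeposE fgx.
- by rewrite !funenegE fgx.
Qed.

End ae_integral.

Section density_integral.
Local Open Scope ereal_scope.
Context d (T : measurableType d) (R : realType) (nu : {measure set T -> \bar R}).
Variable w : T -> R.
Hypotheses (mw : measurable_fun setT w) (w0 : forall x, (0 <= w x)%R).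

Let mEw : measurable_fun setT (EFin \o w).
Proof. exact/measurable_EFinP. Qed.

Let dens : set T -> \bar R := density w nu.

Let dens0 : dens set0 = 0.
Proof. by rewrite /dens /density integral_set0. Qed.

Let dens_ge0 A : 0 <= dens A.
Proof. by apply: integral_ge0 => x _; rewrite lee_fin. Qed.

Let dens_sigma_additive : semi_sigma_additive dens.
Proof.
move=> F mF tF mUF; rewrite /dens /density ge0_integral_bigcup//.
- by apply: is_cvg_nneseries => k _ _; exact: dens_ge0.
- exact: measurable_funTS.
- by move=> x _; rewrite lee_fin.
Qed.

HB.instance Definition _ :=
  isMeasure.Build _ _ _ dens dens0 dens_ge0 dens_sigma_additive.

Lemma density_measure : exists m : {measure set T -> \bar R},
  (m : set T -> \bar R) = density w nu.
Proof. by exists dens. Qed.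

Import HBNNSimple.

Lemma ge0_integral_density (F : T -> \bar R) : measurable_fun setT F ->
  (forall x, 0 <= F x) -> \int[density w nu]_x F x = \int[nu]_x ((w x)%:E * F x).
Proof.
move=> mF F0; rewrite -[density w nu]/dens; pose h := nnsfun_approx measurableT mF.
have h_cvg x : (h n x)%:E @[n --> \oo] --> F x by exact: cvg_nnsfun_approx.
have h_nd x : {homo (fun n => (h n x)%:E) : a b / (a <= b)%N >-> a <= b}.
  by move=> a b ab; rewrite lee_fin; exact/lefP/nd_nnsfun_approx.
have mh n : measurable_fun setT (EFin \o h n) by exact/measurable_EFinP.
have h0 n x : 0 <= (h n x)%:E by rewrite lee_fin.
have simple (k : {nnsfun T >-> R}) :
    \int[dens]_x (k x)%:E = \int[nu]_x ((w x)%:E * (k x)%:E).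
  have mi r : measurable (k @^-1` [set r]) by exact: measurable_funPTI.
  have mki (r : R) : measurable_fun setT (fun x => (r * \1_(k @^-1` [set r]) x)%:E).
    by apply/measurable_EFinP; apply: measurable_funM => //; exact: measurable_indic.
  have pki (r : R) x : 0 <= (r * \1_(k @^-1` [set r]) x)%:E.
    by rewrite EFinM nnfun_muleindic_ge0.
  transitivity (\int[dens]_x (\sum_(i \in range k) (i * \1_(k @^-1` [set i]) x)%:E)).
    by apply: eq_integral => x _; rewrite fimfunE -fsumEFin.
  rewrite ge0_integral_fsum//.
  under [RHS]eq_integral.
    move=> x _; rewrite (fimfunE k) -fsumEFin// ge0_mule_fsumr; last first.
      by move=> r; exact: pki.
    over.
  rewrite ge0_integral_fsum//; last 2 first.
  - by move=> r; exact: emeasurable_funM.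
  - by move=> r x _; apply: mule_ge0; rewrite ?lee_fin// -lee_fin.
  apply: eq_fsbigr => r rk.
  have r0 : (0 <= r)%R by move: rk; rewrite inE => -[x _ <-].
  under eq_integral do rewrite EFinM.
  rewrite integralZl_indic_nnsfun// integral_indic// setIT.
  under eq_integral do rewrite EFinM muleCA.
  rewrite ge0_integralZl//.
  - congr (_ * _); rewrite /dens /density [LHS]integral_mkcond; apply: eq_integral => x _.
    by rewrite epatch_indic.
  - by apply: emeasurable_funM => //; apply/measurable_EFinP; exact: measurable_indic.
  - by move=> x _; rewrite mule_ge0 ?lee_fin.
transitivity (limn (fun n => \int[dens]_x (h n x)%:E)).
  transitivity (\int[dens]_x limn (fun n => (h n x)%:E)).
    by apply: eq_integral => x _; apply/esym/cvg_lim => //; exact: h_cvg.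
  by rewrite monotone_convergence.
transitivity (limn (fun n => \int[nu]_x ((w x)%:E * (h n x)%:E))).
  by congr (limn _); apply/funext => n; exact: simple.
transitivity (\int[nu]_x limn (fun n => (w x)%:E * (h n x)%:E)).
  rewrite monotone_convergence//.
  - by move=> n; apply: emeasurable_funM => //; exact: mh.
  - by move=> n x _; rewrite mule_ge0 ?lee_fin.
  - by move=> x _ a b ab; rewrite lee_wpmul2l ?lee_fin//; exact: h_nd.
by apply: eq_integral => x _; apply/cvg_lim => //; apply: cvgeZl => //; exact: h_cvg.
Qed.

End density_integral.

Section atomic_integral.
Local Open Scope ereal_scope.
Context d (T : measurableType d) (R : realType).
Variables (c : nat -> R) (y : nat -> T) (A : nat -> set T).
Hypotheses (c0 : forall i, (0 <= c i)%R) (mA : forall i, measurable (A i)).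
Hypotheses (tA : trivIset setT A) (UA : \bigcup_i A i = setT) (yA : forall i, A i (y i)).

Let atom (i : nat) : {measure set T -> \bar R} := mscale (NngNum (c0 i)) (\d_(y i)).

Let am : set T -> \bar R := mseries atom 0.

Let amE : am = atomic (fun i => (c i)%:E) y.
Proof. by []. Qed.

HB.instance Definition _ := Measure.on am.

(** Each cell contains exactly one of the atoms, so the partition itself is an exhaustion by sets of
    finite mass. *)
Let am_sigma_finite : sigma_finite setT am.
Proof.
exists A; first by rewrite UA.
move=> i; split => //; rewrite amE /atomic.
rewrite (nneseriesD1 (n := i))//; last by move=> j _; rewrite mule_ge0 ?lee_fin.
rewrite eseries0 ?adde0.
  by rewrite diracE mem_set// mule1 ltry.
move=> j _ /andP[_ ji]; rewrite diracE memNset ?mule0// => Aij.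
move/eqP : ji; apply; apply: contrapT => ji.
have : (A j `&` A i) (y j) by split.
by move/trivIsetP : tA => /(_ j i Logic.I Logic.I) ->//; exact/eqP.
Qed.

HB.instance Definition _ := Measure_isSigmaFinite.Build _ _ _ am am_sigma_finite.

Lemma atomic_measure : exists m : {sigma_finite_measure set T -> \bar R},
  (m : set T -> \bar R) = atomic (fun i => (c i)%:E) y.
Proof. by exists am. Qed.

Lemma ge0_integral_atomic (F : T -> \bar R) : measurable_fun setT F ->
  (forall x, 0 <= F x) ->
  \int[atomic (fun i => (c i)%:E) y]_x F x = \sum_(0 <= i <oo) (c i)%:E * F (y i).
Proof.
move=> mF F0; rewrite -amE ge0_integral_measure_series//.
apply: eq_eseriesr => i _.
by rewrite ge0_integral_mscale// integral_dirac// diracT mul1e.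
Qed.

End atomic_integral.

(** * Concentration of Gaussian weights *)

Section smoothing.
Local Open Scope ereal_scope.
Context (R : realType) (n : nat) (ip : {dot 'rV[R]_n for idfun}) (N : nat).
Local Notation Z := 'rV[R]_n.
Local Notation nrm := (ipnorm ip).
Local Notation gauss := (gauss ip).

Lemma gauss_scale (b t : R) (x : Z) : (0 < t)%R ->
  gauss (b * t ^+ 2) (t^-1 *: x)%R = gauss b x.
Proof.
move=> t0; rewrite /Defs.gauss ipnormZ ger0_norm ?invr_ge0 ?(ltW t0)//.
by congr (expR (- _))%R; field; rewrite gt_eqF.
Qed.

Lemma cvg_rV_ipnorm (u : nat -> Z) (l : Z) :
  nrm (u h - l)%R @[h --> \oo] --> (0%R : R) -> u h @[h --> \oo] --> l.
Proof.
have [K K0 xK] := norm_le_ipnorm ip.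
move=> /cvgrPdist_le ul; apply/(@cvgrPdist_le _ _ _ _ (eventually_filter)) => e e0.
have eK : (0 < e / K)%R by rewrite divr_gt0.
apply: filterS (ul _ eK) => h; rewrite sub0r normrN ger0_norm ?ipnorm_ge0// => uh.
rewrite -opprB normrN (le_trans (xK _))// mulrC -ler_pdivlMr//.
Qed.

Lemma ge0_integral_scale (m : {measure set Z -> \bar R}) (t : R) (k : Z -> \bar R) :
  (forall A : set Z, measurable A -> m ((fun x => t^-1 *: x)%R @^-1` A) = (t ^+ N)%:E * m A) ->
  (0 < t)%R -> measurable_fun setT k -> (forall x, 0 <= k x) ->
  \int[m]_x k (t^-1 *: x)%R = (t ^+ N)%:E * \int[m]_x k x.
Proof.
move=> m_scale t0 mk k0.
rewrite (@ge0_integral_preimage _ _ _ _ _ m m (fun x => t^-1 *: x)%R (t ^+ N)%R)//.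
  exact: measurable_funZ_rV.
by rewrite exprn_ge0// ltW.
Qed.

Variable m0 : {sigma_finite_measure set Z -> \bar R}.
Hypothesis m0_scale : forall (t : R) (A : set Z), (0 < t)%R -> measurable A ->
  m0 ((fun x => t^-1 *: x)%R @^-1` A) = (t ^+ N)%:E * m0 A.
Hypothesis m0_ball : m0 [set x | nrm x <= 1]%R < +oo.
Hypothesis m0_gt0 : 0 < m0 setT.

(** The formula of [smoothed_value], with a measure structure in place of the bare set function. *)
Definition gauss_smoothing (b : R) (F : Z -> R) (z : Z) : R :=
  ((fine (\int[m0]_x (gauss b x)%:E))^-1 *
   fine (\int[m0]_x (F (z + x)%R * gauss b x)%:E))%R.

Let C_fin b : (0 < b)%R -> \int[m0]_x (gauss b x)%:E \is a fin_num.
Proof.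
move=> b0; rewrite ge0_fin_numE; first exact: (integral_gauss_lty m0_scale m0_ball b0).
by apply: integral_ge0 => x _; rewrite lee_fin ltW// gauss_gt0.
Qed.

Lemma gauss_mass_gt0 b : (0 < b)%R -> (0 < fine (\int[m0]_x (gauss b x)%:E))%R.
Proof.
move=> b0; rewrite fine_gt0// (integral_gauss_gt0 ip b m0_gt0)//=.
exact: (integral_gauss_lty m0_scale m0_ball b0).
Qed.

Variables (F : Z -> R) (M : R).
Hypotheses (cF : continuous F) (F0 : forall x, (0 <= F x)%R) (FM : forall x, (F x <= M)%R).

Let mF : measurable_fun setT F.
Proof. exact: continuous_measurable_rV. Qed.

Let mFz z : measurable_fun setT (fun x : Z => F (z + x)%R).
Proof. by apply: measurableT_comp => //; exact: measurable_funD_rV. Qed.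

Let mgauss b : measurable_fun setT (gauss b) := measurable_gauss ip b.

Lemma measurable_smoothing_integrand b (z : Z) :
  measurable_fun setT (fun x : Z => (F (z + x)%R * gauss b x)%:E).
Proof. by apply/measurable_EFinP; exact: measurable_funM. Qed.

Lemma smoothing_integrand_ge0 b (z x : Z) : 0 <= (F (z + x)%R * gauss b x)%:E.
Proof. by rewrite lee_fin mulr_ge0// ltW// gauss_gt0. Qed.

Lemma smoothing_integral_le b (z : Z) : (0 < b)%R ->
  \int[m0]_x (F (z + x)%R * gauss b x)%:E <= M%:E * \int[m0]_x (gauss b x)%:E.
Proof.
have mg : measurable_fun setT (fun x => (gauss b x)%:E) by exact/measurable_EFinP.
move=> b0; rewrite -ge0_integralZl//; last 2 first.
- by move=> x _; rewrite lee_fin ltW// gauss_gt0.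
- by rewrite lee_fin (le_trans (F0 0%R)).
apply: ge0_le_integral => //.
- by move=> x _; exact: smoothing_integrand_ge0.
- exact: measurable_smoothing_integrand.
- by apply: measurable_funeM; apply/measurable_EFinP.
- by move=> x _; rewrite lee_fin ler_wpM2r// ltW// gauss_gt0.
Qed.

Lemma smoothing_integral_fin b (z : Z) : (0 < b)%R ->
  \int[m0]_x (F (z + x)%R * gauss b x)%:E \is a fin_num.
Proof.
move=> b0; rewrite ge0_fin_numE; last by apply: integral_ge0 => x _; exact: smoothing_integrand_ge0.
apply: (le_lt_trans (smoothing_integral_le z b0)).
by rewrite -(fineK (C_fin b0)) -EFinM ltry.
Qed.

Lemma smoothing_integralE b (z : Z) : (0 < b)%R ->
  \int[m0]_x (F (z + x)%R * gauss b x)%:E =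
  (\int[m0]_x (gauss b x)%:E) * (gauss_smoothing b F z)%:E.
Proof.
move=> b0; have C0 := gauss_mass_gt0 b0.
rewrite -(fineK (C_fin b0)) -EFinM /gauss_smoothing mulrA divff ?gt_eqF// mul1r.
by rewrite fineK// smoothing_integral_fin.
Qed.

Lemma smoothing_ge0 b (z : Z) : (0 < b)%R -> (0 <= gauss_smoothing b F z)%R.
Proof.
move=> b0; rewrite mulr_ge0 ?invr_ge0 ?fine_ge0//; apply: integral_ge0 => x _.
  by rewrite lee_fin ltW// gauss_gt0.
exact: smoothing_integrand_ge0.
Qed.

Lemma smoothing_le b (z : Z) : (0 < b)%R -> (gauss_smoothing b F z <= M)%R.
Proof.
move=> b0; have C0 := gauss_mass_gt0 b0.
rewrite /gauss_smoothing mulrC ler_pdivrMr// -lee_fin EFinM fineK ?smoothing_integral_fin//.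
by rewrite fineK ?C_fin// smoothing_integral_le.
Qed.

Lemma measurable_smoothing b : measurable_fun setT (gauss_smoothing b F).
Proof.
apply: measurable_funM => //; apply: measurableT_comp => //.
have := @measurable_fun_fubini_tonelli_F _ _ _ _ _ m0
  (fun q : Z * Z => (F (q.1 + q.2) * gauss b q.2)%:E).
apply.
  apply/measurable_EFinP; apply: measurable_funM.
    apply: measurableT_comp => //.
    by apply: measurable_funD_rV; [exact: measurable_fst|exact: measurable_snd].
  by apply: measurableT_comp => //; exact: measurable_snd.
by move=> q; exact: smoothing_integrand_ge0.
Qed.

(** On substituting x / t for x, the powers t^N of the integral and of its normalization cancel; the
    Gaussian left over does not depend on t. *)
Lemma smoothing_rescale b t (z : Z) : (0 < b)%R -> (0 < t)%R -> gauss_smoothing (b * t ^+ 2) F z =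
  ((fine (\int[m0]_x (gauss b x)%:E))^-1 *
   fine (\int[m0]_x (F (z + t^-1 *: x)%R * gauss b x)%:E))%R.
Proof.
move=> b0 t0; have bt0 : (0 < b * t ^+ 2)%R by rewrite mulr_gt0// exprn_gt0.
have ms A : measurable A -> _ := @m0_scale t A t0.
have tN : (0 < t ^+ N)%R by rewrite exprn_gt0.
have CE : fine (\int[m0]_x (gauss b x)%:E) =
    (t ^+ N * fine (\int[m0]_x (gauss (b * t ^+ 2) x)%:E))%R.
  have := ge0_integral_scale ms t0 (k := fun x => (gauss (b * t ^+ 2) x)%:E).
  under eq_integral do rewrite gauss_scale//.
  move=> -> //; first by rewrite fineM// C_fin.
    exact/measurable_EFinP.
  by move=> x; rewrite lee_fin ltW// gauss_gt0.
have -> : \int[m0]_x (F (z + t^-1 *: x)%R * gauss b x)%:E =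
    (t ^+ N)%:E * \int[m0]_x (F (z + x)%R * gauss (b * t ^+ 2) x)%:E.
  have <- := ge0_integral_scale ms t0 (measurable_smoothing_integrand (b * t ^+ 2) z)
    (smoothing_integrand_ge0 (b * t ^+ 2) z).
  by apply: eq_integral => x _; rewrite gauss_scale.
rewrite CE fineM ?smoothing_integral_fin// invfM /gauss_smoothing.
have := gauss_mass_gt0 bt0; move: tN.
rewrite -[fine (t ^+ N)%:E]/(t ^+ N)%R; move: (t ^+ N)%R (fine _) (fine _) => a C I a0 C0.
by field; rewrite !gt_eqF.
Qed.

(** With the Gaussian fixed by rescaling, [M] times it dominates. The centre is allowed to move
    because the sample points project to points that vary with h. *)
Lemma smoothing_cvg b (t : nat -> R) (z : nat -> Z) (xi : Z) : (0 < b)%R ->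
  (forall h, 0 < t h)%R -> t h @[h --> \oo] --> +oo%R -> z h @[h --> \oo] --> xi ->
  gauss_smoothing (b * t h ^+ 2) F (z h) @[h --> \oo] --> F xi.
Proof.
move=> b0 t0 too zxi; have C0 := gauss_mass_gt0 b0.
have t_inv : (t h)^-1%R @[h --> \oo] --> (0%R : R).
  by apply/gtr0_cvgV0 => //; exact: nearW.
pose u h x := (F (z h + (t h)^-1 *: x) * gauss b x)%:E.
pose l x := (F xi * gauss b x)%:E.
have mg : measurable_fun setT (fun x => (gauss b x)%:E) by exact/measurable_EFinP.
have g0 x : 0 <= (gauss b x)%:E by rewrite lee_fin ltW// gauss_gt0.
have M0 : (0 <= M)%R := le_trans (F0 0%R) (FM _).
have mu h : measurable_fun setT (u h).
  apply/measurable_EFinP; apply: measurable_funM => //; apply: measurableT_comp => //.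
  by apply: measurable_funD_rV => //; exact: measurable_funZ_rV.
have ml : measurable_fun setT l.
  by apply/measurable_EFinP; apply: measurable_funM.
have ul x : u h x @[h --> \oo] --> l x.
  apply: cvg_EFin; first exact: nearW.
  apply: cvgM; last exact: cvg_cst.
  have zt : (z h + (t h)^-1 *: x)%R @[h --> \oo] --> xi.
    rewrite -[X in _ --> X]addr0 -(scale0r x); apply: cvgD => //.
    exact: cvgZr_tmp.
  have := cvg_comp (fun h => z h + (t h)^-1 *: x)%R F zt. by apply; exact: cF.
have u_le h x : `|u h x| <= M%:E * (gauss b x)%:E.
  rewrite gee0_abs; last by rewrite lee_fin mulr_ge0// ltW// gauss_gt0.
  by rewrite -EFinM lee_fin ler_wpM2r// ltW// gauss_gt0.
have gi : m0.-integrable setT (fun x => M%:E * (gauss b x)%:E).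
  apply: integrableZl => //; apply/integrableP; split => //.
  under eq_integral do rewrite gee0_abs//.
  exact: (integral_gauss_lty m0_scale m0_ball b0).
have [_ _ cv] := @dominated_convergence _ _ _ m0 setT measurableT u l
  (fun x => M%:E * (gauss b x)%:E) mu ml (aeW _ (fun x _ => ul x)) gi
  (aeW _ (fun x h _ => u_le h x)).
have lE : \int[m0]_x l x = (F xi * fine (\int[m0]_x (gauss b x)%:E))%:E.
  rewrite EFinM fineK ?C_fin// -ge0_integralZl//=.
  by rewrite lee_fin.
rewrite lE in cv.
have -> : (fun h => gauss_smoothing (b * t h ^+ 2) F (z h)) =
    (fun h => (fine (\int[m0]_x (gauss b x)%:E))^-1 * fine (\int[m0]_x u h x))%R.
  by apply/funext => h; rewrite smoothing_rescale.
have -> : F xi = ((fine (\int[m0]_x (gauss b x)%:E))^-1 *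
    (F xi * fine (\int[m0]_x (gauss b x)%:E)))%R by field; rewrite gt_eqF.
by apply: cvgMl_tmp; apply: fine_cvg.
Qed.

End smoothing.

Section concentration.
Local Open Scope ereal_scope.
Context (R : realType) (n : nat) (ip : {dot 'rV[R]_n for idfun}) (N : nat).
Local Notation Z := 'rV[R]_n.
Local Notation nrm := (ipnorm ip).
Local Notation gauss := (gauss ip).
Variables (E0 V : set Z) (P : 'M[R]_n) (p : Z).
Hypothesis E0_lin : forall a u v, E0 u -> E0 v -> E0 (a *: u + v)%R.
Hypothesis V_lin : forall a u v, V u -> V v -> V (a *: u + v)%R.
Hypothesis E0V : forall u v, E0 u -> V v -> ip u v = 0%R.
Hypothesis E0P : forall x, E0 (x *m P)%R.
Hypothesis VP : forall x, V (x - x *m P)%R.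
Local Notation pi := (affine_proj P p).
Local Notation E := [set (p + v)%R | v in E0].
Variables (mL mE mV : {sigma_finite_measure set Z -> \bar R}).
Hypothesis mV_scale : forall (t : R) (A : set Z), (0 < t)%R -> measurable A ->
  mV ((fun x => t^-1 *: x)%R @^-1` A) = (t ^+ N)%:E * mV A.
Hypothesis mV_ball : mV [set x | nrm x <= 1]%R < +oo.
Hypothesis mV_gt0 : 0 < mV setT.
Hypotheses (mEC : mE (~` E) = 0) (mVC : mV (~` V) = 0).
Variable kappa : R.
Hypothesis kappa_gt0 : (0 < kappa)%R.
Hypothesis mL_fibers : forall f : Z -> \bar R, measurable_fun setT f -> (forall x, 0 <= f x) ->
  \int[mL]_x f x = kappa%:E * \int[mE]_x \int[mV]_y f (x + y)%R.

Let V0 : V 0%R.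
Proof. by have := VP 0%R; rewrite mul0mx subr0. Qed.

Let V_scale a v : V v -> V (a *: v)%R.
Proof. by move=> Vv; rewrite -[X in V X]addr0; exact: V_lin. Qed.

Let measurable_fiber (f : Z -> \bar R) (t : R) : measurable_fun setT f ->
  measurable_fun setT (fun q : Z * Z => f (q.1 + t *: q.2)%R).
Proof.
move=> mf; apply: measurableT_comp => //; apply: measurable_funD_rV; first exact: measurable_fst.
by apply: measurable_funZ_rV; exact: measurable_snd.
Qed.

Lemma ge0_integral_fiber_scale (f : Z -> \bar R) (t : R) : (0 < t)%R ->
  measurable_fun setT f -> (forall x, 0 <= f x) ->
  (t ^+ N)%:E * \int[mL]_x f x =
  kappa%:E * \int[mE]_x \int[mV]_y f (x + t^-1 *: y)%R.
Proof.
move=> t0 mf f0; have tN0 : (0 <= t ^+ N)%R by rewrite exprn_ge0// ltW.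
rewrite mL_fibers// muleCA -ge0_integralZl//; last 2 first.
- have := @measurable_fun_fubini_tonelli_F _ _ _ _ _ mV (fun q : Z * Z => f (q.1 + 1 *: q.2)%R).
  have -> : (fun x : Z => \int[mV]_y f (x + y)%R) = (fun x => \int[mV]_y f (x + 1 *: y)%R).
    by apply/funext => x; apply: eq_integral => y _; rewrite scale1r.
  by apply => //; exact: measurable_fiber.
- by move=> x _; exact: integral_ge0.
congr (_ * _); apply: eq_integral => x _; rewrite -(@ge0_integral_scale _ _ N mV t (fun y =>
  f (x + y)%R))//.
- by move=> A; exact: mV_scale.
- by apply: measurableT_comp => //; exact: measurable_funD_rV.
Qed.

(** For one scale this is Tonelli for the indicator of a null set containing the exceptions. There
    are countably many scales, so one null set of fibres and, on each remaining fibre, one null set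
    of eta serve them all. *)
Lemma ae_fibers (Q : Z -> Prop) (t : nat -> R) : (forall h, 0 < t h)%R ->
  {ae mL, forall x : Z, Q x} ->
  {ae mE, forall x : Z, {ae mV, forall y : Z, forall h, Q (x + (t h)^-1 *: y)%R}}.
Proof.
move=> t0 [N0 [mN0 N00 QN0]].
pose f (x : Z) := (\1_N0 x)%:E : \bar R.
have mf : measurable_fun setT f by apply/measurable_EFinP; exact: measurable_indic.
have f0 x : 0 <= f x by rewrite lee_fin.
have mh h : measurable_fun setT (fun x : Z => \int[mV]_y f (x + (t h)^-1 *: y)%R).
  have := @measurable_fun_fubini_tonelli_F _ _ _ _ _ mV (fun q : Z * Z =>
    f (q.1 + (t h)^-1 *: q.2)%R).
  by apply => //; exact: measurable_fiber.
suff: {ae mE, forall x : Z, forall h, {ae mV, forall y : Z, ~ N0 (x + (t h)^-1 *: y)%R}}.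
  apply: filterS => x xN; apply: filterS (ae_foralln xN) => y yN h.
  by apply: contrapT => nQ; apply: (yN h); apply: QN0.
apply: ae_foralln => h.
have : \int[mE]_x `| \int[mV]_y f (x + (t h)^-1 *: y)%R | = 0.
  have /esym := ge0_integral_fiber_scale (t0 h) mf f0.
  rewrite integral_indic// setIT N00 mule0 => /eqP.
  rewrite mule_eq0 eqe gt_eqF//= => /eqP intf.
  rewrite -[RHS]intf; apply: eq_integral => x _; rewrite gee0_abs//.
  exact: integral_ge0.
move/(ae_eq_integral_abs _ measurableT (mh h)); apply: filterS => x /(_ Logic.I) /= fx0.
have mfx : measurable_fun setT (fun y : Z => f (x + (t h)^-1 *: y)%R).
  by apply: measurableT_comp => //; apply: measurable_funD_rV => //; exact: measurable_funZ_rV.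
have : \int[mV]_y `|f (x + (t h)^-1 *: y)%R| = 0.
  by rewrite -[RHS]fx0; apply: eq_integral => y _; rewrite gee0_abs.
move/(ae_eq_integral_abs _ measurableT mfx); apply: filterS => y /(_ Logic.I) /= fy0 yN.
by move: fy0; rewrite /f indicE mem_set//= => -[] /eqP; rewrite oner_eq0.
Qed.

Variables (L : Z -> R) (L' : Z -> \bar R).
Hypotheses (L_ge0 : forall x, (0 <= L x)%R) (mL' : measurable_fun setT L').
Hypothesis L'_ge0 : forall x, 0 <= L' x.
Hypothesis LL' : {ae mL, forall x : Z, L' x = (L x)%:E}.
Hypothesis L_radial : {ae mE, forall xi : Z, {ae mV, forall eta : Z,
  L (xi + s^-1 *: eta) @[s --> +oo] --> L xi}}%R.
Variable ghat : Z -> \bar R.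
Hypothesis ghat_int : mE.-integrable setT ghat.
Hypothesis L_ghat : {ae mE, forall xi : Z,
  ereal_sup [set (L (xi + eta)%R)%:E | eta in V] = ghat xi}.

Variables (t : nat -> R) (e : nat -> R) (yy : nat -> Z -> Z).
Hypotheses (t_gt0 : forall h, (0 < t h)%R) (t_oo : t h @[h --> \oo] --> +oo%R).
Hypotheses (e_le1 : forall h, (e h <= 1)%R) (e_0 : e h @[h --> \oo] --> (0%R : R)).
Hypothesis myy : forall h, measurable_fun setT (yy h).
Hypothesis yy_near : forall h x, (t h * nrm (x - yy h x) <= e h)%R.

Variables (b M : R) (F : Z -> R) (Phi : nat -> Z -> R).
Hypotheses (b_gt0 : (0 < b)%R) (mPhi : forall h, measurable_fun setT (Phi h)).
Hypotheses (Phi_ge0 : forall h z, (0 <= Phi h z)%R) (Phi_le : forall h z, (Phi h z <= M)%R).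
Hypothesis Phi_cvg : forall (z : nat -> Z) xi, z h @[h --> \oo] --> xi ->
  Phi h (z h) @[h --> \oo] --> F xi.

(** In the application [yy h x] is the sample point of the cell of x, [e h] the mesh rescaled by
    [t h], and [Phi h] the Gaussian smoothing of a test function. *)
Let w h (x : Z) : R :=
  (Phi h (pi (yy h x)) * gauss (b * t h ^+ 2) (yy h x - pi (yy h x)))%R.

Let mpi : measurable_fun setT pi := measurable_affine_proj P p.

Let mw h : measurable_fun setT (w h).
Proof.
apply: measurable_funM.
  by apply: measurableT_comp => //; apply: measurableT_comp.
apply: (measurableT_comp (measurable_gauss ip _)); apply: measurable_funB_rV => //.
by apply: measurableT_comp.
Qed.

Let w_ge0 h x : (0 <= w h x)%R.
Proof. by rewrite mulr_ge0// ltW// gauss_gt0. Qed.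

Let t_inv : (t h)^-1%R @[h --> \oo] --> (0%R : R).
Proof. by apply/gtr0_cvgV0 => //; exact: nearW. Qed.

(** The residual x - pi x is a 1-Lipschitz function of x, so its rescaled displacement is controlled
    by the rescaled mesh. *)
Let nrm_offset h x : (nrm (t h *: ((yy h x - pi (yy h x)) - (x - pi x))) <= e h)%R.
Proof.
rewrite ipnormZ ger0_norm ?(ltW (t_gt0 h))//; apply: le_trans (yy_near h x).
rewrite ler_wpM2l ?(ltW (t_gt0 h))// -ipnormN opprB.
exact: (affine_proj_ortho_lip p E0_lin V_lin E0V E0P VP).
Qed.

Let fiber_offset h xi eta : E xi -> V eta ->
  (nrm (t h *: (yy h (xi + (t h)^-1 *: eta) - pi (yy h (xi + (t h)^-1 *: eta))) - eta) <= e h)%R.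
Proof.
move=> Exi Veta; have := nrm_offset h (xi + (t h)^-1 *: eta)%R.
rewrite (affine_proj_split E0_lin V_lin E0V E0P VP Exi (V_scale _ Veta)).
have -> : (xi + (t h)^-1 *: eta - xi = (t h)^-1 *: eta)%R by rewrite addrAC subrr add0r.
by rewrite scalerBr scalerA divff ?gt_eqF// scale1r.
Qed.

(** The offset is at most [e h <= 1]; this is the unit of slack built into [gauss_envelope]. *)
Let w_le h xi eta : E xi -> V eta ->
  (w h (xi + (t h)^-1 *: eta) <= M * gauss_envelope ip b eta)%R.
Proof.
move=> Exi Veta; have off := fiber_offset h Exi Veta.
rewrite ler_pM// ?(ltW (gauss_gt0 _ _ _))//.
move: off; set x := (yy h _ - _)%R => off.
have -> : gauss (b * t h ^+ 2) x = gauss b (t h *: x).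
  by rewrite -(gauss_scale ip b _ (t_gt0 h)) scalerA mulVf ?gt_eqF// scale1r.
rewrite /Defs.gauss /gauss_envelope ler_expR lerN2 ler_pM2l//.
rewrite ler_sqr ?nnegrE ?ipnorm_ge0 ?le_max ?lexx ?orbT//.
rewrite ge_max ipnorm_ge0 andbT lerBlDr.
have {1}-> : eta = (t h *: x + - (t h *: x - eta))%R by rewrite opprB addrC subrK.
by apply: (le_trans (ipnormD _ _ _)); rewrite ipnormN lerD// (le_trans off).
Qed.

Let w_cvg xi eta : E xi -> V eta ->
  w h (xi + (t h)^-1 *: eta)%R @[h --> \oo] --> (F xi * gauss b eta)%R.
Proof.
move=> Exi Veta; apply: cvgM.
  apply: Phi_cvg; apply: (@cvg_rV_ipnorm _ _ ip).
  apply: (@squeeze_cvgr _ _ _ _ (fun=> 0%R) (fun h => (t h)^-1 * e h)%R).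
  - apply: nearW => h; rewrite ipnorm_ge0/=.
    rewrite ler_pdivlMl//; apply: le_trans (yy_near h (xi + (t h)^-1 *: eta)).
    rewrite ler_wpM2l ?(ltW (t_gt0 h))//.
    rewrite -[X in (_ - X)%R](affine_proj_split E0_lin V_lin E0V E0P VP Exi (V_scale (t h)^-1 Veta)).
    rewrite -[X in (_ <= X)%R]ipnormN opprB.
    exact: (affine_proj_lip p E0_lin V_lin E0V E0P VP).
  - exact: cvg_cst.
  - by rewrite -[X in _ --> X](mul0r 0%R); exact: cvgM.
have -> : (fun h => gauss (b * t h ^+ 2) (yy h (xi + (t h)^-1 *: eta) - pi (yy h (xi + (t h)^-1 *: eta)))) =
  (fun h => gauss b (t h *: (yy h (xi + (t h)^-1 *: eta) - pi (yy h (xi + (t h)^-1 *: eta))))).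
  apply/funext => h; rewrite -(gauss_scale ip b _ (t_gt0 h)) scalerA mulVf ?gt_eqF// scale1r//.
have cg : continuous (gauss b).
  move=> x; apply: continuous_comp; last exact: continuous_expR.
  have nx : (b * (nrm y * nrm y))%R @[y --> x] --> (b * (nrm x * nrm x))%R.
    apply: (@cvgMl_tmp _ _ _ (nbhs_filter x)); apply: (@cvgM _ _ _ (nbhs_filter x));
      exact: ipnorm_continuous.
  exact: (@cvgN _ _ _ _ (nbhs_filter x) _ _ nx).
apply: (cvg_comp _ (gauss b) _ (cg eta)).
apply: (@cvg_rV_ipnorm _ _ ip).
apply: (@squeeze_cvgr _ _ _ _ (fun=> 0%R) e) => //; last exact: cvg_cst.
by apply: nearW => h; rewrite ipnorm_ge0/=; exact: fiber_offset.
Qed.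

Let Psi h (x : Z) : \bar R := L' x * (w h x)%:E.

Let mPsi h : measurable_fun setT (Psi h).
Proof. by apply: emeasurable_funM => //; apply/measurable_EFinP; exact: mw. Qed.

Let Psi_ge0 h x : 0 <= Psi h x.
Proof. by rewrite mule_ge0// lee_fin. Qed.

Let J h (xi : Z) : \bar R := \int[mV]_eta Psi h (xi + (t h)^-1 *: eta)%R.

Let mJ h : measurable_fun setT (J h).
Proof.
have := @measurable_fun_fubini_tonelli_F _ _ _ _ _ mV (fun q : Z * Z =>
  Psi h (q.1 + (t h)^-1 *: q.2)%R).
by apply => //; exact: measurable_fiber.
Qed.

Let M_ge0 : (0 <= M)%R := le_trans (Phi_ge0 0 0%R) (Phi_le 0 0%R).

Let G : R := fine (\int[mV]_x (gauss_envelope ip b x)%:E).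

Let env_int : mV.-integrable setT (EFin \o gauss_envelope ip b).
Proof.
apply/integrableP; split; first by apply/measurable_EFinP; exact: measurable_gauss_envelope.
under eq_integral do rewrite /= ger0_norm ?expR_ge0//.
exact: (integral_gauss_envelope_lty mV_scale mV_ball b_gt0).
Qed.

Let G_E : \int[mV]_x (gauss_envelope ip b x)%:E = G%:E.
Proof. by rewrite /G fineK// integrable_fin_num. Qed.

Let gauss_fin : \int[mV]_x (gauss b x)%:E = (fine (\int[mV]_x (gauss b x)%:E))%:E.
Proof.
rewrite fineK// ge0_fin_numE; first exact: (integral_gauss_lty mV_scale mV_ball b_gt0).
by apply: integral_ge0 => x _; rewrite lee_fin ltW// gauss_gt0.
Qed.

Let F_ge0 x : (0 <= F x)%R.
Proof.
have cx : Phi h x @[h --> \oo] --> F x by apply: Phi_cvg; exact: cvg_cst.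
have <- : limn (Phi ^~ x) = F x by apply/cvg_lim.
by apply: limr_ge; [apply/cvg_ex; exists (F x)|exact: nearW].
Qed.

(** All exceptional sets are collected here, so that the bound and the limit on a fibre hold at
    every [good] point rather than almost everywhere. *)
Let good (xi : Z) := [/\ E xi, ghat xi \is a fin_num,
  ereal_sup [set (L (xi + eta)%R)%:E | eta in V] = ghat xi,
  {ae mV, forall eta : Z, L (xi + s^-1 *: eta) @[s --> +oo] --> L xi}%R &
  {ae mV, forall eta : Z, forall h, L' (xi + (t h)^-1 *: eta)%R = (L (xi + (t h)^-1 *: eta))%:E}].

Let ae_good : {ae mE, forall xi : Z, good xi}.
Proof.
have aeE : {ae mE, forall xi : Z, E xi}.
  exists (~` E); split => //; apply: measurableC.
  exact: (measurable_affine p E0_lin V_lin E0V E0P VP).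
move: (ae_fibers t_gt0 LL') => aeL.
have aef : {ae mE, forall xi : Z, ghat xi \is a fin_num}.
  by apply: filterS (integrable_ae measurableT ghat_int) => xi; exact.
apply: filterS (filterI aeE (filterI aef (filterI L_ghat (filterI L_radial aeL)))).
by move=> xi [? [? [? []]]].
Qed.

Let L_le xi eta : good xi -> V eta -> (L (xi + eta) <= fine (ghat xi))%R.
Proof.
move=> [_ gfin gE _ _] Veta; rewrite -lee_fin fineK// -gE.
by apply: ereal_sup_ubound; exists eta.
Qed.

Let ghat_ge0 xi : good xi -> (0 <= fine (ghat xi))%R.
Proof. by move=> gxi; apply: le_trans (L_le gxi V0). Qed.

Let ae_V : {ae mV, forall eta : Z, V eta}.
Proof.
exists (~` V); split => //; apply: measurableC.
exact: (measurable_orthocompl E0_lin V_lin E0V E0P VP).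
Qed.

Let mPsi_fiber h xi : measurable_fun setT (fun eta : Z => Psi h (xi + (t h)^-1 *: eta)%R).
Proof.
by apply: measurableT_comp => //; apply: measurable_funD_rV => //; exact: measurable_funZ_rV.
Qed.

Let Psi_le xi : good xi -> {ae mV, forall eta : Z, forall h,
  Psi h (xi + (t h)^-1 *: eta)%R <= (fine (ghat xi) * M * gauss_envelope ip b eta)%:E}.
Proof.
move=> gxi; have [Exi _ _ _ aL] := gxi; move: ae_V aL; apply: filterS2 => eta Veta LE h.
rewrite /Psi LE -EFinM lee_fin -mulrA; apply: ler_pM => //.
  by apply: L_le => //; exact: V_scale.
exact: w_le.
Qed.

Let J_le h xi : good xi -> `|J h xi| <= ghat xi * (M * G)%:E.
Proof.
move=> gxi; have [_ gfin _ _ _] := gxi; have gg := ghat_ge0 gxi.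
rewrite gee0_abs; last exact: integral_ge0.
apply: (@le_trans _ _ (\int[mV]_eta (fine (ghat xi) * M * gauss_envelope ip b eta)%:E)).
  apply: ae_ge0_le_integral => //.
  - by move=> eta _; rewrite lee_fin mulr_ge0 ?expR_ge0// mulr_ge0.
  - apply/measurable_EFinP; apply: measurable_funM => //; exact: measurable_gauss_envelope.
  - by apply: filterS (Psi_le gxi) => eta le _; exact: le.
have -> : \int[mV]_eta (fine (ghat xi) * M * gauss_envelope ip b eta)%:E =
    (fine (ghat xi) * M)%:E * \int[mV]_eta (gauss_envelope ip b eta)%:E.
  rewrite -ge0_integralZl//.
  - by apply/measurable_EFinP; exact: measurable_gauss_envelope.
  - by move=> eta _; rewrite lee_fin expR_ge0.
  - by rewrite lee_fin mulr_ge0.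
by rewrite G_E -EFinM -mulrA EFinM fineK.
Qed.

Let J_cvg xi : good xi ->
  J h xi @[h --> \oo] --> (F xi * L xi * fine (\int[mV]_x (gauss b x)%:E))%:E.
Proof.
move=> gxi; have [Exi gfin gE aR aL] := gxi; have gg := ghat_ge0 gxi.
pose l (eta : Z) := (L xi * (F xi * gauss b eta))%:E.
have ml : measurable_fun setT l.
  by apply/measurable_EFinP; do 2 apply: measurable_funM => //; exact: measurable_gauss.
have Psi_l : {ae mV, forall eta : Z, setT eta ->
    Psi h (xi + (t h)^-1 *: eta)%R @[h --> \oo] --> l eta}.
  move: ae_V aR aL; apply: filterS3 => eta Veta Leta L'eta _.
  have -> : (fun h => Psi h (xi + (t h)^-1 *: eta)%R) =
      (fun h => (L (xi + (t h)^-1 *: eta) * w h (xi + (t h)^-1 *: eta))%:E).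
    by apply/funext => h; rewrite /Psi L'eta EFinM.
  apply: cvg_EFin; first exact: nearW.
  apply: cvgM; last exact: w_cvg.
  exact: (cvg_comp t (fun s => L (xi + s^-1 *: eta)%R) t_oo Leta).
have gi : mV.-integrable setT (EFin \o (fun eta => fine (ghat xi) * M * gauss_envelope ip b eta)%R).
  exact: (integrableZl measurableT (fine (ghat xi) * M)%R env_int).
have bound : {ae mV, forall eta h, setT eta -> `|Psi h (xi + (t h)^-1 *: eta)%R| <=
    (EFin \o (fun eta => fine (ghat xi) * M * gauss_envelope ip b eta)%R) eta}.
  by apply: filterS (Psi_le gxi) => eta le h _; rewrite gee0_abs//; exact: le.
have [_ _ cv] := @dominated_convergence _ _ _ mV setT measurableT _ l _
  (fun h => mPsi_fiber h xi) ml Psi_l gi bound.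
suff -> : (F xi * L xi * fine (\int[mV]_x (gauss b x)%:E))%:E = \int[mV]_x l x by [].
rewrite EFinM -gauss_fin -ge0_integralZl//.
- by apply: eq_integral => eta _; rewrite -EFinM /l mulrA [(L xi * _)%R]mulrC.
- by apply/measurable_EFinP; exact: measurable_gauss.
- by move=> eta _; rewrite lee_fin ltW// gauss_gt0.
- by rewrite lee_fin mulr_ge0.
Qed.

Lemma cvg_concentrated_integral :
  L1 mE setT (fun xi => (F xi * L xi)%:E) /\
  (t h ^+ N)%:E * \int[mL]_x (L' x *
     (Phi h (pi (yy h x)) * gauss (b * t h ^+ 2) (yy h x - pi (yy h x)))%:E) @[h --> \oo] -->
  kappa%:E * ((\int[mE]_xi (F xi * L xi)%:E) * \int[mV]_x (gauss b x)%:E).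
Proof.
pose g := fine (\int[mV]_x (gauss b x)%:E).
have g_gt0 : (0 < g)%R.
  by rewrite fine_gt0// (integral_gauss_gt0 ip b mV_gt0) gauss_fin ltry.
(* [F * L] need not be Borel, but the limit superior is. *)
pose l xi := limn_esup (J ^~ xi).
have ml : measurable_fun setT l by apply: measurable_fun_limn_esup.
have lE xi : good xi -> l xi = (F xi * L xi * g)%:E.
  by move=> gxi; rewrite /l; have [_ ->] := cvg_limn_einf_sup (J_cvg gxi).
have Jl : {ae mE, forall xi : Z, setT xi -> J h xi @[h --> \oo] --> l xi}.
  by apply: filterS ae_good => xi gxi _; rewrite lE//; exact: J_cvg.
have gi : mE.-integrable setT (fun xi => ghat xi * (M * G)%:E).
  exact: integrableZr.
have bound : {ae mE, forall (xi : Z) h, setT xi -> `|J h xi| <= ghat xi * (M * G)%:E}.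
  by apply: filterS ae_good => xi gxi h _; exact: J_le.
have [il _ cv] := @dominated_convergence _ _ _ mE setT measurableT J l _ mJ ml Jl gi bound.
have il' : mE.-integrable setT (fun xi => l xi * (g^-1)%:E) by exact: integrableZr.
have FL : {ae mE, forall xi : Z, (F xi * L xi)%:E = l xi * (g^-1)%:E}.
  by apply: filterS ae_good => xi gxi; rewrite lE// -EFinM mulfK ?gt_eqF.
split; first by exists (fun xi => l xi * (g^-1)%:E) => //; apply: filterS FL.
have -> : (fun h => (t h ^+ N)%:E * \int[mL]_x Psi h x) =
    (fun h => kappa%:E * \int[mE]_xi J h xi).
  by apply/funext => h; rewrite ge0_integral_fiber_scale.
apply: cvgeZl => //.
suff -> : (\int[mE]_xi (F xi * L xi)%:E) * \int[mV]_x (gauss b x)%:E = \int[mE]_x l x by [].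
rewrite (ae_eq_integral_any FL) gauss_fin -/g integralZr//.
by rewrite -muleA -EFinM mulVf ?gt_eqF// mule1.
Qed.

End concentration.

(** * Discretization *)

Section lebesgue_rV_locally_finite.
Local Open Scope ereal_scope.
Context (R : realType) (n : nat).
Hypothesis n_gt0 : (0 < n)%N.

Lemma lebesgue_rV_ball_lty (mL : {measure set 'rV[R]_n -> \bar R}) (k : nat) :
  (mL : set 'rV[R]_n -> \bar R) = @lebesgue_rV R n -> mL [set x | `|x| <= k%:R]%R < +oo.
Proof.
move=> mLE; apply: (@le_lt_trans _ _ (mL (rV_box (const_mx (- (k%:R + 1))%R) (const_mx k%:R)))).
  apply: le_measure; rewrite ?inE; last exact: norm_ball_box.
    exact: measurable_norm_ball.
  exact: measurable_rV_box.
rewrite mLE; apply: (le_lt_trans (lebesgue_rV_box_le n_gt0 _)); last exact: ltry.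
by move=> j; rewrite !mxE (@le_trans _ _ 0%R)// oppr_le0 addr_ge0.
Qed.

(** Local integrability yields a Borel representative on each ball only. Extended by zero, these are
    glued by a limit superior: at almost every x they are eventually equal to [L x]. The absolute
    value makes the result nonnegative at every point. *)
Lemma L1loc_representative (mL : {measure set 'rV[R]_n -> \bar R}) (L : 'rV[R]_n -> R) :
  (mL : set 'rV[R]_n -> \bar R) = @lebesgue_rV R n ->
  (forall x, 0 <= L x)%R -> L1loc L ->
  exists L' : 'rV[R]_n -> \bar R, [/\ measurable_fun setT L', forall x, 0 <= L' x,
    {ae mL, forall x, L' x = (L x)%:E} &
    forall k : nat, \int[mL]_(x in [set x | `|x| <= k%:R]%R) L' x < +oo].
Proof.
move=> mLE L0 Lloc.
pose K (k : nat) := [set x : 'rV[R]_n | `|x| <= k%:R]%R.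
have mK k : measurable (K k) by exact: measurable_norm_ball.
have cK k : compact (K k).
  apply: bounded_closed_compact.
    exists k%:R; split; first by rewrite realn.
    by move=> M kM x /= xk; rewrite (le_trans xk)// ltW.
  rewrite (_ : K k = (fun x : 'rV[R]_n => `|x|)%R @^-1` [set s : R | s <= k%:R]%R)//.
  by apply: closed_comp; [move=> ? _; exact: norm_continuous|exact: closed_le].
have gE k : {g : 'rV[R]_n -> \bar R | mL.-integrable (K k) g &
    {ae mL, forall x, K k x -> (L x)%:E = g x}}.
  by apply: cid2; rewrite mLE; exact: Lloc (cK k).
pose g k := sval (gE k).
have ig k : mL.-integrable (K k) (g k) by rewrite /g; case: (gE k).
have Lg : {ae mL, forall x, forall k, K k x -> (L x)%:E = g k x}.
  by apply: ae_foralln => k; rewrite /g; case: (gE k).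
pose L' x := `|limn_esup (fun k => ((g k) \_ (K k)) x)|.
have LL' : {ae mL, forall x, L' x = (L x)%:E}.
  apply: filterS Lg => x Lgx; rewrite /L'.
  suff -> : limn_esup (fun k => ((g k) \_ (K k)) x) = (L x)%:E by rewrite gee0_abs// lee_fin.
  have cv : (fun k => ((g k) \_ (K k)) x) @ \oo --> (L x)%:E.
    apply: cvg_near_cst; exists (Num.truncn `|x|).+1 => // k /= xk.
    have Kx : K k x.
      by rewrite /K/= ltW// (lt_le_trans (truncnS_gt _))// ler_nat.
    by rewrite patchE mem_set// -Lgx.
  by have [_ ->] := cvg_limn_einf_sup cv.
exists L'; split => //.
- apply: measurableT_comp => //; apply: measurable_fun_limn_esup => k.
  by have /integrableP[mg _] := ig k; apply: (measurable_restrictT _ _).1.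
- by move=> x; exact: abse_ge0.
- move=> k; have /integrableP[_] := ig k.
  suff -> : \int[mL]_(x in K k) L' x = \int[mL]_(x in K k) `|g k x| by [].
  rewrite integral_mkcond [RHS]integral_mkcond; apply: ae_eq_integral_any.
  apply: filterS2 LL' Lg => x L'x gx; rewrite !patchE; case: ifPn => // /set_mem Kx.
  by rewrite L'x -gx// gee0_abs// lee_fin.
Qed.

End lebesgue_rV_locally_finite.

Section cells.
Local Open Scope ereal_scope.
Context (R : realType) (n : nat) (ip : {dot 'rV[R]_n for idfun}).
Local Notation Z := 'rV[R]_n.
Local Notation nrm := (ipnorm ip).
Variables (A : nat -> set Z) (y : nat -> Z).
Hypotheses (A_partition : bounded_borel_partition ip A).

(** The map sending x to the sample point of its cell; composing with it turns sums over cells into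
    integrals over Z. *)
Definition cell_point (x : Z) : Z := y (xget 0%N [set i | A i x]).

Let mA i : measurable (A i). Proof. by case: A_partition. Qed.

Lemma cell_pointE i x : A i x -> cell_point x = y i.
Proof.
have [_ _ tA _] := A_partition => Aix; congr y.
have Ax : A (xget 0%N [set i | A i x]) x by exact: (@xgetPex _ 0%N [set i | A i x] (ex_intro _ i Aix)).
by apply: (tA _ _ Logic.I Logic.I); exists x.
Qed.

Lemma measurable_cell_point : measurable_fun setT cell_point.
Proof.
have [_ _ _ UA] := A_partition.
move=> _ B mB; rewrite setTI.
rewrite (_ : _ @^-1` _ = \bigcup_(i in [set i | B (y i)]) A i); last first.
  apply/seteqP; split => x /=; last by move=> [i By Ai]; rewrite (cell_pointE Ai).
  have [i _ Ai] : (\bigcup_i A i) x by rewrite UA.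
  by rewrite (cell_pointE Ai) => By; exists i.
by apply: bigcup_measurable.
Qed.

Lemma ge0_integral_cells (m : {measure set Z -> \bar R}) (L : Z -> \bar R) (k : Z -> R)
    (c : nat -> R) :
  measurable_fun setT L -> (forall x, 0 <= L x) -> measurable_fun setT k ->
  (forall x, 0 <= k x)%R -> (forall i, \int[m]_(x in A i) L x = (c i)%:E) ->
  \int[m]_x (L x * (k (cell_point x))%:E) = \sum_(0 <= i <oo) (c i * k (y i))%:E.
Proof.
move=> mL L0 mk k0 cE; have [_ _ tA UA] := A_partition.
rewrite -UA ge0_integral_bigcup//=.
- apply: eq_eseriesr => i _; rewrite mulrC EFinM -cE -ge0_integralZl//.
  + by apply: eq_integral => x /set_mem Ax; rewrite (cell_pointE Ax) muleC.
  + exact: measurable_funTS.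
  + by rewrite lee_fin.
- rewrite UA; apply: emeasurable_funM => //; apply/measurable_EFinP.
  by apply: measurableT_comp => //; exact: measurable_cell_point.
- by move=> x _; rewrite mule_ge0// lee_fin.
Qed.

Lemma ipnorm_le_diam (B : set Z) x x' : B x -> B x' -> (nrm (x - x'))%:E <= diam ip B.
Proof. by move=> Bx Bx'; apply: ereal_sup_ubound; right; exists (x, x'). Qed.

Lemma ipnorm_cell_point x : (forall i, A i (y i)) ->
  (nrm (x - cell_point x))%:E <= ereal_sup (range (cell_diam ip A)).
Proof.
move=> Ay; have [_ _ _ UA] := A_partition.
have [i _ Ai] : (\bigcup_i A i) x by rewrite UA.
apply: (@le_trans _ _ (cell_diam ip A x)); last by apply: ereal_sup_ubound; exists x.
by apply: ipnorm_le_diam; exists i => //; rewrite (cell_pointE Ai).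
Qed.

Lemma cell_integral_lty (m : {measure set Z -> \bar R}) (L : Z -> \bar R) i :
  measurable_fun setT L -> (forall x, 0 <= L x) ->
  (forall k : nat, \int[m]_(x in [set x | `|x| <= k%:R]%R) L x < +oo) ->
  \int[m]_(x in A i) L x < +oo.
Proof.
move=> mL L0 Lk; have [_ bA _ _] := A_partition.
have [M AM] := bA i; have [K K0 xK] := norm_le_ipnorm ip.
have := Lk (Num.truncn (K * M)%R).+1; apply: le_lt_trans.
apply: ge0_subset_integral => //; first exact: measurable_norm_ball.
- exact: measurable_funTS.
- move=> x Ax /=; rewrite (le_trans (xK x))// ltW// (le_lt_trans _ (truncnS_gt _))//.
  by rewrite ler_wpM2l ?(ltW K0)//; exact: AM.
Qed.

End cells.

Lemma Cc_bounded (R : realType) n (f : 'rV[R]_n -> R) : Cc f ->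
  exists2 M, 0 < M & forall x, `|f x| <= M.
Proof.
move=> [cf cK].
have /compact_bounded[M [_ fM]] : compact (f @` closure [set x | f x != 0]).
  apply: continuous_compact => //; exact: continuous_subspaceT.
exists (`|M| + 1) => [|x]; first by rewrite ltr_pwDr.
have [fx0|fx0] := eqVneq (f x) 0; first by rewrite fx0 normr0 addr_ge0.
apply: (fM (`|M| + 1)); first by rewrite (le_lt_trans (ler_norm M))// ltrDl.
by exists x => //; exact: subset_closure.
Qed.

(** Passes from the extended-real sums of the computations to the real [series] of the theorem. *)
Lemma cvg_series_nneseries (R : realType) (u : nat -> R) : (forall i, 0 <= u i) ->
  (\sum_(0 <= i <oo) (u i)%:E < +oo)%E ->
  series u @ \oo --> fine (\sum_(0 <= i <oo) (u i)%:E)%E.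
Proof.
move=> u0 uoo; have s0 : (0 <= \sum_(0 <= i <oo) (u i)%:E)%E.
  by apply: nneseries_ge0 => i _ _; rewrite lee_fin.
have : (fun k => \sum_(0 <= i < k) (u i)%:E)%E @ \oo --> (\sum_(0 <= i <oo) (u i)%:E)%E.
  by apply: is_cvg_nneseries => i _ _; rewrite lee_fin.
rewrite -[X in _ --> X]fineK ?ge0_fin_numE// => /fine_cvg; apply: cvg_trans.
by apply: near_eq_cvg; apply: nearW => k; rewrite /= /series/= sumEFin.
Qed.

(** * Thermalized expectations *)

Section thermal_expectation.
Local Open Scope ereal_scope.
Context (R : realType) (n : nat) (ip : {dot 'rV[R]_n for idfun}) (N : nat).
Local Notation Z := 'rV[R]_n.
Local Notation nrm := (ipnorm ip).
Local Notation gauss := (gauss ip).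
Variables (E0 V : set Z) (P : 'M[R]_n) (p : Z).
Hypothesis E0_lin : forall a u v, E0 u -> E0 v -> E0 (a *: u + v)%R.
Hypothesis V_lin : forall a u v, V u -> V v -> V (a *: u + v)%R.
Hypothesis E0V : forall u v, E0 u -> V v -> ip u v = 0%R.
Hypothesis E0P : forall x, E0 (x *m P)%R.
Hypothesis VP : forall x, V (x - x *m P)%R.
Local Notation pi := (affine_proj P p).
Local Notation E := [set (p + v)%R | v in E0].
Variables (mE m0 : {sigma_finite_measure set Z -> \bar R}).
Hypothesis m0_scale : forall (t : R) (A : set Z), (0 < t)%R -> measurable A ->
  m0 ((fun x => t^-1 *: x)%R @^-1` A) = (t ^+ N)%:E * m0 A.
Hypothesis m0_ball : m0 [set x | nrm x <= 1]%R < +oo.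
Hypothesis m0_gt0 : 0 < m0 setT.
Hypothesis mEC : mE (~` E) = 0.
Hypothesis mE_m0 : forall (q : Z) (A : set Z), E q -> measurable A ->
  m0 ((fun x => q + x)%R @^-1` A) = mE A.
Variables (c : nat -> R) (y : nat -> Z) (A : nat -> set Z).
Hypotheses (c_ge0 : forall i, (0 <= c i)%R) (A_partition : bounded_borel_partition ip A).
Hypothesis yA : forall i, A i (y i).
Variables (b B : R).
Hypotheses (b_gt0 : (0 < b)%R) (B_gt0 : (0 < B)%R).

Local Notation smooth := (gauss_smoothing ip m0 b).
Let g i : R := gauss b (y i - pi (y i)).
Let w (q : Z * Z) : R := (B^-1 * gauss b (q.1 - q.2))%R.
Let nu : set (Z * Z) -> \bar R := density w (atomic (fun i => (c i)%:E) y \x mE).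
Let C : R := fine (\int[m0]_x (gauss b x)%:E).

Let g_ge0 i : (0 <= g i)%R. Proof. by rewrite ltW// gauss_gt0. Qed.

Let mw : measurable_fun setT w.
Proof.
apply: measurable_funM => //; apply: (measurableT_comp (measurable_gauss ip b)).
by apply: measurable_funB_rV; [exact: measurable_fst|exact: measurable_snd].
Qed.

Let w_ge0 q : (0 <= w q)%R.
Proof. by rewrite mulr_ge0 ?invr_ge0 ?(ltW B_gt0)// ltW// gauss_gt0. Qed.

Let gauss_pythagoras i (z : Z) : E z -> gauss b (y i - z) = (g i * gauss b (z - pi (y i)))%R.
Proof.
move=> Ez; rewrite /g /Defs.gauss -expRD -opprD -mulrDr.
by rewrite (affine_proj_pythagoras E0_lin V_lin E0V E0P VP (y i) Ez).
Qed.

Lemma thermal_integral (phi : Z -> R) (M : R) : continuous phi ->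
  (forall x, 0 <= phi x)%R -> (forall x, phi x <= M)%R ->
  \int[nu]_q (phi q.2)%:E =
  (B^-1 * C)%:E * \sum_(0 <= i <oo) (c i * (smooth phi (pi (y i)) * g i))%:E.
Proof.
move=> cphi phi0 phiM; have [mA _ tA UA] := A_partition.
have mphi : measurable_fun setT phi by exact: continuous_measurable_rV.
have [am amE] := atomic_measure c_ge0 mA tA UA yA.
have [pm pmE] := sigma_finite_product am mE.
have mphi2 : measurable_fun setT (fun q : Z * Z => (phi q.2)%:E).
  by apply/measurable_EFinP; apply: measurableT_comp => //; exact: measurable_snd.
rewrite /nu -amE -pmE ge0_integral_density//; last by move=> q; rewrite lee_fin.
have mwphi : measurable_fun setT (fun q : Z * Z => (w q)%:E * (phi q.2)%:E).
  by apply: emeasurable_funM => //; exact/measurable_EFinP.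
have wphi0 q : 0 <= (w q)%:E * (phi q.2)%:E by rewrite mule_ge0// lee_fin.
rewrite pmE (@fubini_tonelli1 _ _ _ _ _ am mE _ mwphi wphi0) amE.
rewrite (ge0_integral_atomic y c_ge0); last 2 first.
- by have := @measurable_fun_fubini_tonelli_F _ _ _ _ _ mE _; apply.
- by move=> x; exact: integral_ge0.
rewrite -nneseriesZl; last first.
  by move=> i _; rewrite lee_fin mulr_ge0// mulr_ge0// smoothing_ge0.
apply: eq_eseriesr => i _; rewrite /fubini_F/=.
set q := pi (y i); have Eq : E q by exact: affine_proj_mem.
have mg z : measurable_fun setT (fun x : Z => gauss b (z - x)).
  by apply: (measurableT_comp (measurable_gauss ip b)); exact: measurable_funB_rV.
have mg' z : measurable_fun setT (fun x : Z => gauss b (x - z)).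
  by apply: (measurableT_comp (measurable_gauss ip b)); exact: measurable_funB_rV.
pose k (z : Z) := (B^-1 * (g i * (phi z * gauss b (z - q))))%:E.
have mk : measurable_fun setT k.
  by apply/measurable_EFinP; do 3 apply: measurable_funM => //.
have k0 z : 0 <= k z.
  by rewrite lee_fin !mulr_ge0 ?invr_ge0 ?(ltW B_gt0) ?(ltW (gauss_gt0 _ _ _)).
(* The Pythagorean factorization is valid only for z in E, which carries all of [mE]. *)
rewrite (_ : \int[mE]_z _ = \int[mE]_z k z); last first.
  apply: (@eq_integral_support _ _ _ mE E) => //.
  - exact: (measurable_affine p E0_lin V_lin E0V E0P VP).
  - apply: emeasurable_funM; apply/measurable_EFinP => //.
    by apply: measurable_funM; [exact: measurable_cst|exact: mg].
  - by move=> z Ez; rewrite /k /w/= gauss_pythagoras// -EFinM; congr (_%:E); ring.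
have mEq D : measurable D -> m0 ((fun x => q + x)%R @^-1` D) = 1%:E * mE D.
  by move=> mD; rewrite mul1e mE_m0.
have mq : measurable_fun setT (fun x : Z => q + x)%R by exact: measurable_funD_rV.
have := ge0_integral_preimage mq ler01 mEq mk k0.
rewrite mul1e => <-.
rewrite (_ : \int[m0]_x k (q + x)%R =
  \int[m0]_x ((B^-1 * g i)%:E * (phi (q + x)%R * gauss b x)%:E)); last first.
  by apply: eq_integral => x _; rewrite /k (_ : q + x - q =
    x)%R -?EFinM ?mulrA// addrAC subrr add0r.
rewrite ge0_integralZl//; last 3 first.
- exact: measurable_smoothing_integrand.
- by move=> x _; exact: smoothing_integrand_ge0.
- by rewrite lee_fin mulr_ge0 ?invr_ge0 ?(ltW B_gt0).
rewrite (smoothing_integralE m0_scale m0_ball m0_gt0 cphi phi0 phiM q b_gt0).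
rewrite -(fineK (_ : \int[m0]_x (gauss b x)%:E \is a fin_num)); last first.
  rewrite ge0_fin_numE; first exact: (integral_gauss_lty m0_scale m0_ball b_gt0).
  by apply: integral_ge0 => x _; rewrite lee_fin ltW// gauss_gt0.
by rewrite -!EFinM -/C; congr (_%:E); ring.
Qed.

Let C_gt0 : (0 < C)%R := gauss_mass_gt0 m0_scale m0_ball m0_gt0 b_gt0.

Let C_E : \int[m0]_x (gauss b x)%:E = C%:E.
Proof.
rewrite fineK// ge0_fin_numE; first exact: (integral_gauss_lty m0_scale m0_ball b_gt0).
by apply: integral_ge0 => x _; rewrite lee_fin ltW// gauss_gt0.
Qed.

Lemma smoothing_cst1 z : smooth (fun=> 1%R) z = 1%R.
Proof.
rewrite /gauss_smoothing; under [X in (_ * fine X)%R]eq_integral do rewrite mul1r.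
by rewrite -/C mulVf// gt_eqF.
Qed.

Let nu_measure : exists m : {measure set (Z * Z) -> \bar R}, (m : set (Z * Z) -> \bar R) = nu.
Proof.
have [mA _ tA UA] := A_partition.
have [am amE] := atomic_measure c_ge0 mA tA UA yA.
have [pm pmE] := sigma_finite_product am mE.
have [m mE'] := density_measure pm mw w_ge0; exists m.
by rewrite mE' /nu -amE -pmE.
Qed.

Variables (f : Z -> R) (M : R).
Hypotheses (cf : continuous f) (fM : forall x, (`|f x| <= M)%R).
Hypothesis mass : 0 < \sum_(0 <= i <oo) (c i * g i)%:E < +oo.

Let F x := (f x + M)%R.
Let s1 : R := fine (\sum_(0 <= i <oo) (c i * g i)%:E).

Let cF : continuous F.
Proof. by move=> x; apply: (@cvgD _ _ _ _ (nbhs_filter x)); [exact: cf|exact: cvg_cst]. Qed.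

Let F_ge0 x : (0 <= F x)%R.
Proof. by rewrite -lerBlDr sub0r; have := fM x; rewrite ler_norml => /andP[]. Qed.

Let F_le x : (F x <= M + M)%R.
Proof. by rewrite lerD2r; have := fM x; rewrite ler_norml => /andP[]. Qed.

Let M_ge0 : (0 <= M)%R := le_trans (normr_ge0 _) (fM 0%R).

Let mf : measurable_fun setT f := continuous_measurable_rV cf.
Let mF : measurable_fun setT F := continuous_measurable_rV cF.

Let smoothF z : smooth f z = (smooth F z - M)%R.
Proof.
have mg : measurable_fun setT (EFin \o gauss b) by apply/measurable_EFinP; exact: measurable_gauss.
have ig : m0.-integrable setT (EFin \o gauss b).
  apply/integrableP; split => //.
  under eq_integral do rewrite /= ger0_norm ?(ltW (gauss_gt0 _ _ _))//.
  by rewrite C_E ltry.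
have iF : m0.-integrable setT (EFin \o (fun x => F (z + x) * gauss b x)%R).
  apply/integrableP; split; first exact: measurable_smoothing_integrand.
  under eq_integral do rewrite /= ger0_norm ?mulr_ge0 ?(ltW (gauss_gt0 _ _ _))//.
  rewrite -ge0_fin_numE ?integral_ge0//.
    exact: (smoothing_integral_fin m0_scale m0_ball cF F_ge0 F_le).
  by move=> x _; exact: smoothing_integrand_ge0.
have iM := integrableZl measurableT M ig.
rewrite /gauss_smoothing.
have -> : \int[m0]_x (f (z + x)%R * gauss b x)%:E =
    \int[m0]_x ((F (z + x)%R * gauss b x)%:E - M%:E * (gauss b x)%:E).
  by apply: eq_integral => x _; rewrite -EFinM -EFinB -mulrBl /F addrK.
rewrite integralB// integralZl// C_E fineB ?integrable_fin_num//.
rewrite -/C mulrBr; congr (_ - _)%R.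
by rewrite /= mulrCA mulVf ?mulr1// gt_eqF.
Qed.

Let uF i : R := (c i * (smooth F (pi (y i)) * g i))%R.

Let uF_ge0 i : (0 <= uF i)%R.
Proof. by rewrite mulr_ge0// mulr_ge0// smoothing_ge0. Qed.

Let SF_lty : \sum_(0 <= i <oo) (uF i)%:E < +oo.
Proof.
have /andP[mass0 mass_lty] := mass.
apply: (@le_lt_trans _ _ (\sum_(0 <= i <oo) (M + M)%:E * (c i * g i)%:E)).
  apply: lee_nneseries => i _; first by move=> _; rewrite lee_fin.
  rewrite -EFinM lee_fin /uF mulrCA ler_wpM2r// ?mulr_ge0//.
  exact: (smoothing_le m0_scale m0_ball m0_gt0 cF F_ge0 F_le).
rewrite nneseriesZl; last by move=> i _; rewrite lee_fin mulr_ge0.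
by rewrite -(fineK (_ : \sum_(0 <= i <oo) (c i * g i)%:E \is a fin_num))
  ?ge0_fin_numE ?(ltW mass0)// -EFinM ltry.
Qed.

Let SF_fin : \sum_(0 <= i <oo) (uF i)%:E \is a fin_num.
Proof. by rewrite ge0_fin_numE// nneseries_ge0// => i _ _; rewrite lee_fin. Qed.

(** [thermal_integral] is applied to the constant 1, which gives the mass, and to [F = f + M];
    subtracting [M] times the mass then recovers the signed f. Finiteness of the mass makes this
    subtraction legitimate. *)
Lemma thermal_expectation :
  [/\ 0 < nu setT < +oo,
    series (fun i => c i * smooth f (pi (y i)) * gauss b (y i - pi (y i)))%R @ \oo -->
      (fine (\sum_(0 <= i <oo) (uF i)%:E) - M * s1)%R,
    series (fun i => c i * gauss b (y i - pi (y i)))%R @ \oo --> s1 &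
    expectation_z nu f = ((fine (\sum_(0 <= i <oo) (uF i)%:E) - M * s1) / s1)%R].
Proof.
have /andP[mass0 mass_lty] := mass.
have s1E : \sum_(0 <= i <oo) (c i * g i)%:E = s1%:E by rewrite fineK// ge0_fin_numE// ltW.
have s1_gt0 : (0 < s1)%R by rewrite -lte_fin -s1E.
have BC : (0 < B^-1 * C)%R by rewrite mulr_gt0// invr_gt0.
have [m mnu] := nu_measure.
have nu_mass : nu setT = (B^-1 * C * s1)%:E.
  have := @thermal_integral (fun=> 1%R) 1%R.
  under [\sum_(0 <= i <oo) _]eq_eseriesr do rewrite smoothing_cst1 mul1r.
  rewrite s1E -EFinM => <- //; last exact: cst_continuous.
  by rewrite -mnu integral_cst// mul1e.
have intF : \int[m]_q (F q.2)%:E = (B^-1 * C * fine (\sum_(0 <= i <oo) (uF i)%:E))%:E.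
  by rewrite mnu (thermal_integral cF F_ge0 F_le) [in RHS]EFinM fineK.
have cden : series (fun i => c i * gauss b (y i - pi (y i)))%R @ \oo --> s1.
  by apply: (@cvg_series_nneseries _ (fun i => c i * g i)%R) => // i; exact: mulr_ge0.
split => //.
- by rewrite nu_mass lte_fin mulr_gt0//= ltry.
- have cF' := cvg_series_nneseries uF_ge0 SF_lty.
  have -> : series (fun i => c i * smooth f (pi (y i)) * gauss b (y i - pi (y i)))%R =
      (fun k => series uF k - M * series (fun i => c i * gauss b (y i - pi (y i))) k)%R.
    apply/funext => k; rewrite /series/= mulr_sumr -sumrB; apply: eq_bigr => i _.
    by rewrite smoothF /uF /g; ring.
  by apply: cvgB => //; exact: cvgMl_tmp.
rewrite /expectation_z /total_mass nu_mass -mnu.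
have iF : m.-integrable setT (EFin \o (fun q : Z * Z => F q.2)).
  apply/integrableP; split.
    by apply/measurable_EFinP; apply: measurableT_comp => //; exact: measurable_snd.
  under eq_integral do rewrite /= ger0_norm//.
  by rewrite intF ltry.
have iM : m.-integrable setT (EFin \o (fun q : Z * Z => M)).
  apply/integrableP; split; first by apply/measurable_EFinP; exact: measurable_cst.
  under eq_integral do rewrite /= ger0_norm//.
  by rewrite integral_cst// mnu nu_mass -EFinM ltry.
have -> : \int[m]_q (f q.2)%:E = \int[m]_q ((F q.2)%:E - M%:E).
  by apply: eq_integral => q _; rewrite -EFinB /F addrK.
rewrite integralB// intF integral_cst// mnu nu_mass -EFinM -EFinB /=.
have := gt_eqF s1_gt0; have := gt_eqF C_gt0; have := gt_eqF B_gt0.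
move: (fine _) s1 C => a s C' /negbT B0 /negbT C0 /negbT s0.
by field; rewrite s0 C0 B0.
Qed.

End thermal_expectation.

(** * Gaussian mass of Z and the planes of the theorem *)

Section gauss_mass.
Local Open Scope ereal_scope.
Context (R : realType) (n : nat) (ip : {dot 'rV[R]_n for idfun}) (N : nat).
Local Notation Z := 'rV[R]_n.
Local Notation nrm := (ipnorm ip).
Variables (E0 V : set Z) (mL m0 mV : {sigma_finite_measure set Z -> \bar R}) (kappa : R).
Hypothesis E0V : forall u v, E0 u -> V v -> ip u v = 0%R.
Hypotheses (mE0 : measurable E0) (mV_ : measurable V).
Hypotheses (m0C : m0 (~` E0) = 0) (mVC : mV (~` V) = 0) (kappa_gt0 : (0 < kappa)%R).
Hypothesis m0_gauss : forall b, (0 < b)%R -> 0 < \int[m0]_x (gauss ip b x)%:E < +oo.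
Hypothesis mV_gauss : forall b, (0 < b)%R -> 0 < \int[mV]_x (gauss ip b x)%:E < +oo.
Hypothesis mL_fibers : forall f : Z -> \bar R, measurable_fun setT f -> (forall x, 0 <= f x) ->
  \int[mL]_x f x = kappa%:E * \int[m0]_x \int[mV]_y f (x + y)%R.

(** Guarantees that the normalization B_beta is a positive real: [fine] sends an infinite integral
    to 0, and the inverse of 0 is 0. On orthogonal components the Gaussian factorizes. *)
Lemma gauss_integral_fibers (b : R) : (0 < b)%R -> 0 < \int[mL]_x (gauss ip b x)%:E < +oo.
Proof.
move=> b0; pose g (x : Z) := (gauss ip b x)%:E.
have mg : measurable_fun setT g by apply/measurable_EFinP; exact: measurable_gauss.
have g0 x : 0 <= g x by rewrite lee_fin ltW// gauss_gt0.
have /andP[V0 Voo] := mV_gauss b0; have /andP[E00 E0oo] := m0_gauss b0.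
have mgxy : measurable_fun setT (fun q : Z * Z => g (q.1 + q.2)%R).
  apply: measurableT_comp => //.
  by apply: measurable_funD_rV; [exact: measurable_fst|exact: measurable_snd].
have fib x : E0 x -> \int[mV]_y g (x + y)%R = g x * \int[mV]_y g y.
  move=> E0x; rewrite -ge0_integralZl//.
  apply: (@eq_integral_support _ _ _ mV V) => //.
  - by apply: measurableT_comp => //; exact: measurable_funD_rV.
  - exact: measurable_funeM.
  - by move=> y; rewrite mule_ge0.
  move=> y Vy; rewrite /g -EFinM; congr (_%:E).
  by rewrite /Defs.gauss -expRD -opprD -mulrDr ipnormD_ortho// E0V.
have mI := @measurable_fun_fubini_tonelli_F _ _ _ _ _ mV _ mgxy (fun q => g0 _).
have intI (I : Z -> \bar R) : measurable_fun setT I -> (forall x, 0 <= I x) ->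
    (forall x, E0 x -> I x = g x * \int[mV]_y g y) ->
    \int[m0]_x I x = \int[m0]_x g x * \int[mV]_y g y.
  move=> mI' I0 IE; rewrite muleC -ge0_integralZl//; last exact: integral_ge0.
  apply: (@eq_integral_support _ _ _ m0 E0) => //.
  - exact: measurable_funeM.
  - by move=> x; rewrite mule_ge0// integral_ge0.
  - by move=> x E0x; rewrite IE// muleC.
have I0 (x : Z) : 0 <= \int[mV]_y g (x + y)%R by exact: integral_ge0.
have -> : \int[mL]_x g x = kappa%:E * (\int[m0]_x g x * \int[mV]_y g y).
  by rewrite mL_fibers// -(intI _ mI I0 fib).
rewrite !mule_gt0//= -(fineK (_ : \int[m0]_x g x \is a fin_num)) ?ge0_fin_numE ?(ltW E00)//.
by rewrite -(fineK (_ : \int[mV]_x g x \is a fin_num)) ?ge0_fin_numE ?(ltW V0)// -!EFinM ltry.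
Qed.

End gauss_mass.

Section lagrangian.
Local Open Scope ereal_scope.
Context (R : realType) (N : nat).
Hypothesis N_gt0 : (0 < N)%N.
Local Notation Z := 'rV[R]_(2 * N).
Context (ip : {dot Z for idfun}) (E0 : {vspace Z}) (p : Z).
Hypothesis dimE0 : (\dim E0)%VS = N.
Local Notation nrm := (ipnorm ip).
Local Notation E := [set (p + v)%R | v in [set` E0]].
Local Notation V := (orthocompl ip E0).

Lemma vspace_lin a u v : [set` E0] u -> [set` E0] v -> [set` E0] (a *: u + v)%R.
Proof. by move=> /= ? ?; rewrite memvD// memvZ. Qed.

Lemma orthocompl_lin a u v : V u -> V v -> V (a *: u + v)%R.
Proof.
by move=> Vu Vv x E0x; rewrite ip_addl ip_scalel Vu// Vv// mulr0 addr0.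
Qed.

Lemma ip_orthocompl u v : [set` E0] u -> V v -> ip u v = 0%R.
Proof. by move=> E0u Vv; rewrite ip_sym Vv. Qed.

Hypothesis mass_E : 0 < hausdorff_on ip N E setT.

(** Gathers the data of the sections above, with frames and bases eliminated. Positivity of mass
    passes from E to [E0] by translation and from there to V. *)
Lemma lagrangian_setting : exists (P : 'M[R]_(2 * N))
    (mL mE mV m0 : {sigma_finite_measure set Z -> \bar R}) (kappa : R),
  [/\ (mL : set Z -> \bar R) = @lebesgue_rV R (2 * N),
    (mE : set Z -> \bar R) = hausdorff_on ip N E,
    (mV : set Z -> \bar R) = hausdorff_on ip N V &
    (m0 : set Z -> \bar R) = hausdorff_on ip N [set` E0]] /\
  [/\ forall x, [set` E0] (x *m P)%R & forall x, V (x - x *m P)%R] /\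
  [/\ forall (t : R) (A : set Z), (0 < t)%R -> measurable A ->
      m0 ((fun x => t^-1 *: x)%R @^-1` A) = (t ^+ N)%:E * m0 A,
    m0 [set x | nrm x <= 1]%R < +oo, 0 < m0 setT, mE (~` E) = 0 &
    forall (q : Z) (A : set Z), E q -> measurable A -> m0 ((fun x => q + x)%R @^-1` A) = mE A] /\
  [/\ forall (t : R) (A : set Z), (0 < t)%R -> measurable A ->
      mV ((fun x => t^-1 *: x)%R @^-1` A) = (t ^+ N)%:E * mV A,
    mV [set x | nrm x <= 1]%R < +oo, 0 < mV setT & mV (~` V) = 0] /\
  [/\ (0 < kappa)%R, (forall f : Z -> \bar R, measurable_fun setT f -> (forall x, 0 <= f x) ->
      \int[mL]_x f x = kappa%:E * \int[mE]_x \int[mV]_y f (x + y)%R) &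
    forall b, (0 < b)%R -> 0 < \int[mL]_x (gauss ip b x)%:E < +oo].
Proof.
have n_gt0 : (0 < 2 * N)%N by rewrite muln_gt0.
have [B Bfree E0B] := vspace_frame dimE0.
have [P PB] := ortho_projection ip Bfree.
have NN : (N + N)%N = (2 * N)%N by rewrite mul2n addnn.
have [C Cfree VC] := ortho_frame ip NN Bfree.
have VE : V = [set (w *m C)%R | w in [set: 'rV[R]_N]].
  rewrite -VC; apply/seteqP; split => x /= Vx.
    by move=> w; apply: Vx; suff : [set` E0] (w *m B)%R by []; rewrite E0B; exists w.
  move=> v E0v; have : [set` E0] v by [].
  by rewrite E0B => -[w _ <-].
have E0P x : [set` E0] (x *m P)%R.
  by have [[w xw] _] := PB x; rewrite E0B; exists w.
have VP x : V (x - x *m P)%R.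
  have [_ ow] := PB x => v E0v; have : [set` E0] v by [].
  by rewrite E0B => -[w _ <-].
have lin := vspace_lin; have linV := orthocompl_lin; have E0V := ip_orthocompl.
have mEm := measurable_affine p lin linV E0V E0P VP.
have E00 : [set (0 + v)%R | v in [set` E0]] = [set` E0].
  apply/seteqP; split => x /=; first by move=> [v ? <-]; rewrite add0r.
  by exists x => //; rewrite add0r.
have mE0m : measurable [set` E0].
  by have := measurable_affine 0%R lin linV E0V E0P VP; rewrite E00.
have mVm := measurable_orthocompl lin linV E0V E0P VP.
have [mL mLE] := lebesgue_rV_measure R n_gt0.
have [mE mEE] : exists m : {sigma_finite_measure set Z -> \bar R},
    (m : set Z -> \bar R) = hausdorff_on ip N E.
  apply: (hausdorff_on_sigma_finite ip N_gt0 mEm Bfree (p := p)).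
  by move=> x [v /= E0v <-]; have : [set` E0] v by []; rewrite E0B => -[w _ <-]; exists w.
have [m0 m0E] : exists m : {sigma_finite_measure set Z -> \bar R},
    (m : set Z -> \bar R) = hausdorff_on ip N [set` E0].
  apply: (hausdorff_on_sigma_finite ip N_gt0 mE0m Bfree (p := 0%R)).
  by move=> x E0x; have : [set` E0] x by []; rewrite E0B => -[w _ <-]; exists w => //;
    rewrite add0r.
have [mV mVE] : exists m : {sigma_finite_measure set Z -> \bar R},
    (m : set Z -> \bar R) = hausdorff_on ip N V.
  apply: (hausdorff_on_sigma_finite ip N_gt0 mVm Cfree (p := 0%R)).
  by move=> x; rewrite VE => -[w _ <-]; exists w => //; rewrite add0r.
have m0_scale (t : R) (A : set Z) : (0 < t)%R -> measurable A ->
    m0 ((fun x => t^-1 *: x)%R @^-1` A) = (t ^+ N)%:E * m0 A.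
  by move=> t0 mA; rewrite m0E hausdorff_on_scale// => a x /= ?; rewrite memvZ.
have V_scale a x : V x -> V (a *: x)%R.
  by move=> Vx v E0v; rewrite ip_scalel Vx// mulr0.
have mV_scale (t : R) (A : set Z) : (0 < t)%R -> measurable A ->
    mV ((fun x => t^-1 *: x)%R @^-1` A) = (t ^+ N)%:E * mV A.
  by move=> t0 mA; rewrite mVE hausdorff_on_scale.
have m0_ball : m0 [set x | nrm x <= 1]%R < +oo.
  by rewrite m0E; apply: (hausdorff_on_unit_ball_lty ip N_gt0 Bfree); rewrite E0B.
have mV_ball : mV [set x | nrm x <= 1]%R < +oo.
  by rewrite mVE; apply: (hausdorff_on_unit_ball_lty ip N_gt0 Cfree); rewrite VE.
have mE_m0 (q : Z) (A : set Z) : E q -> measurable A -> m0 ((fun x => q + x)%R @^-1` A) = mE A.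
  move=> [u E0u <-] mA; rewrite m0E mEE; apply: hausdorff_on_translate => x; split.
    move=> [v E0v]; rewrite -addrA => /addrI vE.
    by rewrite /= -(addKr u x) -vE memvD// memvN.
  by move=> E0x; exists (u + x)%R; rewrite ?addrA//= memvD.
have m0_gt0 : 0 < m0 setT.
  have Ep : E p by exists 0%R; rewrite ?addr0//= mem0v.
  by have := mE_m0 p setT Ep measurableT; rewrite preimage_setT => ->; rewrite mEE.
have mV_gt0 : 0 < mV setT.
  rewrite mVE VE. apply: (hausdorff_on_frames_gt0 (B := B) Cfree).
  by rewrite -E0B -m0E.
have mEC : mE (~` E) = 0 by rewrite mEE hausdorff_on_setC.
have m0C : m0 (~` [set` E0]) = 0 by rewrite m0E hausdorff_on_setC.
have mVC : mV (~` V) = 0 by rewrite mVE hausdorff_on_setC.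
have m0_ball_gt0 := homogeneous_unit_ball_gt0 ip m0_scale m0_gt0.
have mV_ball_gt0 := homogeneous_unit_ball_gt0 ip mV_scale mV_gt0.
have mL_translate (v : Z) (A : set Z) : measurable A -> mL ((fun x => v + x)%R @^-1` A) = mL A.
  move=> mA; rewrite mLE -(lebesgue_rV_translate v); congr lebesgue_rV.
  apply/seteqP; split => x /=; first by move=> [z Az <-].
  by move=> Ax; exists (- v + x)%R; rewrite ?addrA ?subrr ?addNr ?add0r//.
have mL_gt0 : 0 < mL setT.
  rewrite (@lt_le_trans _ _ (mL (rV_box (0 : Z)%R (const_mx 1%R))))//.
    by rewrite mLE lebesgue_rV_unit_box_gt0.
  by apply: le_measure; rewrite ?inE//; exact: measurable_rV_box.
have mE_translate (v : Z) (A : set Z) : [set` E0] v -> measurable A ->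
    mE ((fun x => v + x)%R @^-1` A) = mE A.
  move=> E0v mA; rewrite mEE; apply: hausdorff_on_translate => x; split => -[u E0u].
    by move=> uE; exists (u - v)%R; [rewrite /= memvB|rewrite addrA uE addrC addKr].
  by move=> <-; exists (v + u)%R; [rewrite /= memvD|rewrite addrCA].
have m0_translate (v : Z) (A : set Z) : [set` E0] v -> measurable A ->
    m0 ((fun x => v + x)%R @^-1` A) = m0 A.
  move=> E0v mA; rewrite m0E; apply: hausdorff_on_translate => x; split => E0x.
    by have : [set` E0] (- v + (v + x))%R; [rewrite /= memvD// memvN|rewrite addKr].
  by rewrite /= memvD.
have mV_translate (v : Z) (A : set Z) : V v -> measurable A ->
    mV ((fun x => v + x)%R @^-1` A) = mV A.
  move=> Vv mA; rewrite mVE; apply: hausdorff_on_translate => x; split => Vx.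
    have := linV (-1)%R _ _ Vv Vx; rewrite scaleN1r addKr//.
  by have := linV 1%R _ _ Vv Vx; rewrite scale1r.
have mE_ball : 0 < mE [set x | nrm (x - p) <= 1]%R < +oo.
  rewrite -(mE_m0 p); last 2 first.
  - by exists 0%R; rewrite ?addr0//= mem0v.
  - rewrite (_ : mkset _ = (fun x => x - p)%R @^-1` [set x | nrm x <= 1]%R)//.
    rewrite -[X in measurable X]setTI.
    by apply: measurable_funB_rV => //; exact: measurable_ipnorm_ball.
  rewrite (_ : _ @^-1` _ = [set x | nrm x <= 1]%R) ?m0_ball_gt0//.
  by apply/seteqP; split => x /=; rewrite addrAC subrr add0r.
have mV_ball2 : 0 < mV [set x | nrm x <= 1]%R < +oo by rewrite mV_ball_gt0.
have m0_ball2 : 0 < m0 [set x | nrm (x - 0) <= 1]%R < +oo.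
  rewrite (_ : [set x | nrm (x - 0) <= 1]%R = [set x | nrm x <= 1]%R) ?m0_ball_gt0//.
  by apply/seteqP; split => x /=; rewrite subr0.
have mL_ball k := lebesgue_rV_ball_lty n_gt0 k mLE.
have m0C' : m0 (~` [set (0 + v)%R | v in [set` E0]]) = 0 by rewrite E00.
have [kappa kappa0 mL_fibers] := disintegration lin linV E0V E0P VP mL_translate
  mE_translate mV_translate mEC mVC mE_ball mV_ball2 mL_ball mL_gt0.
(* A second disintegration, along [E0] itself, serves the Gaussian centred at the origin; along E
   the centre would not lie on the plane in general. *)
have [kappa' kappa'0 mL_fibers'] := disintegration lin linV E0V E0P VP mL_translate
  m0_translate mV_translate m0C' mVC m0_ball2 mV_ball2 mL_ball mL_gt0.
exists P, mL, mE, mV, m0, kappa; do 4 ![split=> //].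
have m0_gauss b : (0 < b)%R -> 0 < \int[m0]_x (gauss ip b x)%:E < +oo.
  by move=> b0; rewrite (integral_gauss_gt0 ip b m0_gt0) (integral_gauss_lty m0_scale m0_ball b0).
have mV_gauss b : (0 < b)%R -> 0 < \int[mV]_x (gauss ip b x)%:E < +oo.
  by move=> b0; rewrite (integral_gauss_gt0 ip b mV_gt0) (integral_gauss_lty mV_scale mV_ball b0).
split => //.
exact: (gauss_integral_fibers E0V mE0m mVm m0C mVC kappa'0 m0_gauss mV_gauss mL_fibers').
Qed.

End lagrangian.

(** * Assembly and limit of the quotient *)

Lemma cvg_sqrt_pinfty (R : realType) (u : nat -> R) :
  u h @[h --> \oo] --> +oo -> Num.sqrt (u h) @[h --> \oo] --> +oo.
Proof.
move=> /cvgryPge uoo; apply/cvgryPge => M; apply: filterS (uoo (M ^+ 2)) => h Mh.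
by rewrite (le_trans (ler_norm M))// -sqrtr_sqr ler_wsqrtr.
Qed.

(* No lower bound for the Hausdorff measure of an N-plane is proved here: its
   positivity on E comes from hypothesis (d), and is then carried over to the
   other N-planes by linear isomorphisms. *)
Lemma hausdorff_on_mass_gt0 (R : realType) (n : nat) (ip : {dot 'rV[R]_n for idfun}) (N : nat)
    (N_gt0 : (0 < N)%N) (S : set 'rV[R]_n) (k : 'rV[R]_n -> \bar R) :
  (0 < \int[hausdorff_on ip N S]_x k x)%E -> (0 < hausdorff_on ip N S setT)%E.
Proof.
move=> int0; rewrite lt0e hausdorff_ge0// andbT; apply/eqP => H0; move: int0.
rewrite (_ : hausdorff_on ip N S = mzero) ?integral_measure_zero ?ltxx//.
apply/funext => A; apply/eqP; rewrite /mzero eq_le hausdorff_ge0// andbT -H0.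
by apply: le_hausdorff => // x [].
Qed.

Unset Implicit Arguments.

Theorem mainTheorem6 (R : realType) (N : nat) (N_ge1 : (1 <= N)%N)
  (ip : {dot 'rV[R]_(2 * N) for idfun})
  (E0 : {vspace 'rV[R]_(2 * N)}) (dimE0 : (\dim E0)%VS = N)
  (E : set 'rV[R]_(2 * N)) (E0E : is_translate E0 E)
  (L_D : 'rV[R]_(2 * N) -> R)
  (L_D_ge0 : forall x, 0 <= L_D x) (L_D_loc : L1loc L_D)
  (hyp_a : {ae hausdorff_on ip N E, forall xi,
     {ae hausdorff_on ip N (orthocompl ip E0), forall eta,
        L_D (xi + lambda^-1 *: eta) @[lambda --> +oo] --> L_D xi}})
  (g0 : 'rV[R]_(2 * N) * 'rV[R]_(2 * N) * 'rV[R]_(2 * N) -> R)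
  (lambda0 beta0 : R) (lambda0_gt0 : 0 < lambda0) (beta0_gt0 : 0 < beta0)
  (g0_L1 : L1 ((hausdorff_on ip N E \x hausdorff_on ip N (orthocompl ip E0))
                 \x hausdorff_on ip N [set` E0])%E setT (EFin \o g0))
  (hyp_b : {ae ((hausdorff_on ip N E \x hausdorff_on ip N (orthocompl ip E0))
                  \x hausdorff_on ip N [set` E0])%E, forall p,
     forall lambda, lambda0 <= lambda ->
       expR (- (beta0 * (ipnorm ip p.1.2 ^+ 2 + ipnorm ip p.2 ^+ 2)))
         * L_D (p.1.1 + lambda^-1 *: p.1.2) <= g0 p})
  (hyp_c : L1 (hausdorff_on ip N E) setT (fun xi =>
     ereal_sup [set (L_D (xi + eta))%:E | eta in orthocompl ip E0]))
  (hyp_d : (0 < \int[hausdorff_on ip N E]_xi (L_D xi)%:E < +oo)%E)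
  (A : nat -> nat -> set 'rV[R]_(2 * N))
  (A_partition : forall h, bounded_borel_partition ip (A h))
  (y : nat -> nat -> 'rV[R]_(2 * N)) (yA : forall h i, A h i (y h i))
  (beta : nat -> R) (beta_gt0 : forall h, 0 < beta h)
  (beta_oo : beta h @[h --> \oo] --> +oo)
  (fine_mesh : ((Num.sqrt (beta h / beta0))%:E *
                  ereal_sup (range (cell_diam ip (A h))))%E
                 @[h --> \oo] --> 0%E)
  (f : 'rV[R]_(2 * N) -> R) (f_Cc : Cc f) :
  let c := fun h i => fine (data_measure L_D (A h i)) in
  let z := fun h i => closest_point ip E (y h i) in
  let fhi := fun h i => smoothed_value ip N [set` E0] (beta h) f (z h i) in
  let mu := fun h =>
    thermalized ip (beta h) (discretized ip N E L_D (A h) (y h)) in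
  let num := fun h i => c h i * fhi h i * gauss ip (beta h) (y h i - z h i) in
  let den := fun h i => c h i * gauss ip (beta h) (y h i - z h i) in
  (\forall h \near \oo,
     [/\ (0 < total_mass (mu h) < +oo)%E,
         cvgn (series (num h)), cvgn (series (den h)) &
         expectation_z (mu h) f =
           limn (series (num h)) / limn (series (den h))]) /\
  (expectation_z (mu h) f @[h --> \oo] --> limit_expectation ip N E L_D f).

Proof.
have N_gt0 : (0 < N)%N by [].
move: E0E => [p EE]; subst E; set E := [set p + v | v in [set` E0]] in hyp_a g0_L1 hyp_b hyp_c hyp_d *.
have /andP[int0 intoo] := hyp_d.
have mass_E := hausdorff_on_mass_gt0 N_gt0 int0.
have [P [mL [mE [mV [m0 [kappa [[mLE mEE mVE m0E] [[E0P VP] [[m0_scale m0_ball m0_gt0 mEC mE_m0]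
  [[mV_scale mV_ball mV_gt0 mVC] [kappa_gt0 mL_fibers mL_gauss]]]]]]]]]]] :=
  lagrangian_setting N_gt0 dimE0 mass_E.
have lin := @vspace_lin R N E0; have linV := @orthocompl_lin R N ip E0.
have E0V := @ip_orthocompl R N ip E0.
rewrite -/E in mEE mEC mE_m0.
have n_gt0 : (0 < 2 * N)%N by rewrite muln_gt0.
have [L' [mL' L'0 LL' L'K]] := L1loc_representative mLE L_D_ge0 L_D_loc.
have [ghat ghat_int Lghat] : exists2 ghat : 'rV[R]_(2 * N) -> \bar R, mE.-integrable setT ghat &
    {ae mE, forall xi, ereal_sup [set (L_D (xi + eta))%:E | eta in orthocompl ip E0] = ghat xi}.
  move: hyp_c; rewrite -mEE => -[ghat ig Lg]; exists ghat => //.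
  by apply: filterS Lg => xi; exact.
have L_radial : {ae mE, forall xi, {ae mV, forall eta,
    L_D (xi + s^-1 *: eta) @[s --> +oo] --> L_D xi}} by rewrite mEE mVE.
pose pi := affine_proj P p.
have closestE x : closest_point ip E x = pi x by exact: (closest_pointE p lin linV E0V E0P VP).
pose t h := Num.sqrt (beta h / beta0).
have t_gt0 h : 0 < t h by rewrite sqrtr_gt0 divr_gt0.
(* Dilating by [t h] turns the Gaussian of parameter [beta h] into the fixed one of parameter
   [beta0]. *)
have betaE h : beta h = beta0 * t h ^+ 2.
  by rewrite sqr_sqrtr ?divr_ge0 ?(ltW (beta_gt0 h)) ?(ltW beta0_gt0)// mulrC divfK ?gt_eqF.
have t_oo : t h @[h --> \oo] --> +oo.
  apply: cvg_sqrt_pinfty; apply/cvgryPge => M.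
  move/cvgryPge : beta_oo => /(_ (M * beta0)); apply: filterS => h.
  by rewrite ler_pdivlMr.
move=> c z fhi mu num den.
pose D h := ereal_sup (range (cell_diam ip (A h))).
(* For small h the supremum of the diameters may be infinite, and [fine] then returns 0; convergence
   in the extended reals makes it finite eventually. *)
pose e h := fine ((t h)%:E * D h)%E.
have [mesh_fin e_0] : (\forall h \near \oo, ((t h)%:E * D h)%E \is a fin_num) /\
    (fine \o (fun h => (t h)%:E * D h)%E) h @[h --> \oo] --> (0 : R) by exact/fine_cvgP.
(* Sequences are shifted by [h0], after which [t h * diam <= 1] always holds. *)
have [h0 _ mesh0] : \forall h \near \oo, ((t h)%:E * D h)%E \is a fin_num /\ e h < 1.
  by apply: filterI => //; exact: (cvgr_lt _ e_0 _ ltr01).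
have mesh h : ((t (h + h0)%N)%:E * D (h + h0)%N)%E \is a fin_num /\ e (h + h0)%N < 1.
  by apply: mesh0 => /=; rewrite leq_addl.
pose yy h := cell_point (A h) (y h).
have yy_near h x : t (h + h0)%N * ipnorm ip (x - yy (h + h0)%N x) <= e (h + h0)%N.
  have [mfin _] := mesh h; rewrite -lee_fin fineK// EFinM lee_wpmul2l ?lee_fin ?(ltW (t_gt0 _))//.
  exact: ipnorm_cell_point.
(* The cell masses of the statement integrate [L_D] itself, which need not be Borel; the a.e.
   exchange with [L'] is made inside these integrals. *)
have dataE h i : data_measure L_D (A h i) = (\int[mL]_(x in A h i) L' x)%E.
  rewrite /data_measure /density -mLE integral_mkcond [RHS]integral_mkcond.
  apply: ae_eq_integral_any; apply: filterS LL' => x L'x.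
  by rewrite !patchE L'x.
have cE h i : (\int[mL]_(x in A h i) L' x)%E = (c h i)%:E.
  rewrite /c dataE fineK// ge0_fin_numE; last exact: integral_ge0.
  exact: (cell_integral_lty (A_partition h)).
have c_ge0 h i : 0 <= c h i by rewrite -lee_fin -cE integral_ge0.
(* For F = 1 this is the sum of the denominator; for F = f + M it is the sum of the numerator plus
   [M] times that of the denominator. *)
pose S (F : 'rV[R]_(2 * N) -> R) h := (\sum_(0 <= i <oo) (c h i * (gauss_smoothing ip m0 (beta h) F (pi (y h i)) *
  gauss ip (beta h) (y h i - pi (y h i))))%:E)%E.
have mpi : measurable_fun setT pi by exact: measurable_affine_proj.
have S_int (F : 'rV[R]_(2 * N) -> R) h : continuous F -> (forall x, 0 <= F x) ->
    (\int[mL]_x (L' x * (gauss_smoothing ip m0 (beta h) F (pi (yy h x)) *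
       gauss ip (beta h) (yy h x - pi (yy h x)))%:E))%E = S F h.
  move=> cF F0; rewrite (@ge0_integral_cells _ _ ip _ (y h) (A_partition h) mL L'
    (fun z => gauss_smoothing ip m0 (beta h) F (pi z) * gauss ip (beta h) (z - pi z)) (c h))//.
    apply: measurable_funM.
      by apply: measurableT_comp => //; exact: measurable_smoothing.
    by apply: (measurableT_comp (measurable_gauss ip _)); exact: measurable_funB_rV.
  by move=> x; rewrite mulr_ge0 ?(ltW (gauss_gt0 _ _ _))// smoothing_ge0.
have e_0' : e (h + h0)%N @[h --> \oo] --> (0 : R) by rewrite (cvg_shiftn h0).
have t_oo' : t (h + h0)%N @[h --> \oo] --> +oo by rewrite (cvg_shiftn h0).
have e_le1 h : e (h + h0)%N <= 1 by apply: ltW; exact: (mesh h).2.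
have myy h : measurable_fun setT (yy (h + h0)%N) by exact: measurable_cell_point.
pose G := fine (\int[mV]_x (gauss ip beta0 x)%:E)%E.
have GE : (\int[mV]_x (gauss ip beta0 x)%:E)%E = G%:E.
  rewrite fineK// ge0_fin_numE; first exact: (integral_gauss_lty mV_scale mV_ball beta0_gt0).
  by apply: integral_ge0 => x _; rewrite lee_fin ltW// gauss_gt0.
have G_gt0 : 0 < G by rewrite -lte_fin -GE integral_gauss_gt0.
have conv (F : 'rV[R]_(2 * N) -> R) M' : continuous F -> (forall x, 0 <= F x) -> (forall x,
  F x <= M') ->
    L1 mE setT (fun xi => (F xi * L_D xi)%:E) /\
    ((t h ^+ N)%:E * S F h)%E @[h --> \oo] -->
      (kappa%:E * ((\int[mE]_xi (F xi * L_D xi)%:E) * G%:E))%E.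
  move=> cF F0 FM.
  pose Phi h := gauss_smoothing ip m0 (beta (h + h0)%N) F.
  have mPhi h : measurable_fun setT (Phi h) by exact: measurable_smoothing.
  have Phi_ge0 h z' : 0 <= Phi h z' by exact: smoothing_ge0.
  have Phi_le h z' : Phi h z' <= M' by exact: (smoothing_le m0_scale m0_ball m0_gt0 cF F0 FM).
  have Phi_cvg (z' : nat -> 'rV[R]_(2 * N)) xi : z' h @[h --> \oo] --> xi ->
      Phi h (z' h) @[h --> \oo] --> F xi.
    move=> z'xi; rewrite (_ : (fun h => _) = (fun h =>
      gauss_smoothing ip m0 (beta0 * t (h + h0)%N ^+ 2) F (z' h))).
      by apply: (smoothing_cvg m0_scale m0_ball m0_gt0 cF F0 FM).
    by apply/funext => h; rewrite /Phi betaE.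
  have [intF cvF] := @cvg_concentrated_integral _ _ _ _ _ _ _ _ lin linV E0V E0P VP _ _ _
    mV_scale mV_ball mV_gt0 mEC mVC _ kappa_gt0 mL_fibers _ _ L_D_ge0 mL' L'0 LL' L_radial
    _ ghat_int Lghat _ _ _ (fun h => t_gt0 (h + h0)%N) t_oo' e_le1 e_0' myy yy_near
    _ _ _ _ beta0_gt0 mPhi Phi_ge0 Phi_le Phi_cvg.
  split => //; rewrite -(cvg_shiftn h0) -GE; apply: cvg_trans cvF.
  apply: near_eq_cvg; apply: nearW => h /=.
  rewrite -(S_int F (h + h0)%N cF F0).
  by rewrite /Phi /pi !betaE.
have [M M_gt0 fM] := Cc_bounded f_Cc; have [cf _] := f_Cc.
(* The expectation of [f] is recovered from the nonnegative functions [f + M] and [1]. *)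
pose F x := f x + M.
have cF : continuous F by move=> x; apply: (@cvgD _ _ _ _ (nbhs_filter x));
  [exact: cf|exact: cvg_cst].
have F0 x : 0 <= F x by rewrite -lerBlDr sub0r; have := fM x; rewrite ler_norml => /andP[].
have FM x : F x <= M + M by rewrite lerD2r; have := fM x; rewrite ler_norml => /andP[].
have [intF cvSF] := conv _ _ cF F0 FM.
have c1 : continuous ((fun=> 1) : 'rV[R]_(2 * N) -> R) by exact: cst_continuous.
have [int1 cvS1] := conv _ _ c1 (fun=> ler01) (fun=> lexx 1).
have L_int : (\int[mE]_xi (1 * L_D xi)%:E = \int[mE]_xi (L_D xi)%:E)%E.
  by apply: eq_integral => x _; rewrite mul1r.
have fin_L1 k : L1 mE setT k -> (\int[mE]_xi k xi \is a fin_num)%E.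
  move=> [k' ik' kk']; rewrite (@ae_eq_integral_any _ _ _ mE k k').
    exact: integrable_fin_num.
  by apply: filterS kk' => x; exact.
pose lF := fine (\int[mE]_xi (F xi * L_D xi)%:E)%E.
pose l1 := fine (\int[mE]_xi (L_D xi)%:E)%E.
have lFE : (\int[mE]_xi (F xi * L_D xi)%:E)%E = lF%:E by rewrite fineK// fin_L1.
have l1E : (\int[mE]_xi (L_D xi)%:E)%E = l1%:E by rewrite fineK// -L_int fin_L1.
have l1_gt0 : 0 < l1 by rewrite -lte_fin -l1E mEE.
rewrite L_int l1E -!EFinM in cvS1; rewrite lFE -!EFinM in cvSF.
pose s1 h := fine (\sum_(0 <= i <oo) (den h i)%:E)%E.
have S1E h : S (fun=> 1%R) h = (\sum_(0 <= i <oo) (den h i)%:E)%E.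
  apply: eq_eseriesr => i _; have E1 := smoothing_cst1 m0_scale m0_ball m0_gt0 (beta_gt0 h) (pi (y h i)).
  by rewrite E1 mul1r /den /z closestE.
have [S1_fin cvs1] : (\forall h \near \oo, ((t h ^+ N)%:E * S (fun=> 1%R) h)%E \is a fin_num) /\
    (fine \o (fun h => (t h ^+ N)%:E * S (fun=> 1%R) h)%E) h @[h --> \oo] --> kappa * (l1 * G).
  exact/fine_cvgP.
have [SF_fin cvsF] : (\forall h \near \oo, ((t h ^+ N)%:E * S F h)%E \is a fin_num) /\
    (fine \o (fun h => (t h ^+ N)%:E * S F h)%E) h @[h --> \oo] --> kappa * (lF * G).
  exact/fine_cvgP.
have K1_gt0 : 0 < kappa * (l1 * G) by rewrite !mulr_gt0.
have S_ge0 (k : 'rV[R]_(2 * N) -> R) h : (forall x, 0 <= k x) -> (0 <= S k h)%E.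
  move=> k0; apply: nneseries_ge0 => i _ _.
  by rewrite lee_fin mulr_ge0// mulr_ge0 ?(ltW (gauss_gt0 _ _ _))// smoothing_ge0.
have tN_gt0 h : 0 < t h ^+ N by rewrite exprn_gt0.
have scale_fin h (x : \bar R) : (0 <= x)%E -> ((t h ^+ N)%:E * x \is a fin_num)%E ->
  x \is a fin_num.
  by case: x => [r||]// _; rewrite gt0_muley ?lte_fin.
(* The rescaled denominators tend to kappa times the integral of L_D times a Gaussian mass, which is
   positive by hypothesis (d). From some h on the quotient is therefore meaningful. *)
have large : \forall h \near \oo, [/\ S (fun=> 1%R) h \is a fin_num,
  S F h \is a fin_num & 0 < s1 h].
  have cv0 := @cvgr_gt _ _ _ (eventually_filter) _ _ cvs1 _ K1_gt0.
  apply: (filterS _ (filterI S1_fin (filterI SF_fin cv0))) => h [S1f [SFf S1_gt0]].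
  have S1_finh := scale_fin h _ (S_ge0 _ h (fun=> ler01)) S1f.
  have SF_finh := scale_fin h _ (S_ge0 _ h F0) SFf.
  split; [exact: S1_finh|exact: SF_finh|].
  rewrite /s1 -S1E -(pmulr_rgt0 _ (tN_gt0 h)).
  have tN_fin : (t h ^+ N)%:E \is a fin_num by [].
  by move: S1_gt0; rewrite /comp (fineM tN_fin S1_finh).
have B_gt0 h : 0 < gauss_mass_Z ip (beta h).
  by rewrite /gauss_mass_Z -mLE fine_gt0// mL_gauss.
have muE h : mu h = density (fun q : 'rV[R]_(2 * N) * 'rV[R]_(2 * N) =>
    (gauss_mass_Z ip (beta h))^-1 * gauss ip (beta h) (q.1 - q.2))
    (atomic (fun i => (c h i)%:E) (y h) \x mE)%E.
  have dataE' : (fun i => data_measure L_D (A h i)) = (fun i => (c h i)%:E).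
    by apply/funext => i; rewrite dataE cE.
  by rewrite /mu /thermalized /discretized dataE' -mEE.
have key h : [/\ S (fun=> 1%R) h \is a fin_num, S F h \is a fin_num & 0 < s1 h] ->
    [/\ (0 < total_mass (mu h) < +oo)%E,
      series (num h) @ \oo --> fine (S F h) - M * s1 h, series (den h) @ \oo --> s1 h &
      expectation_z (mu h) f = (fine (S F h) - M * s1 h) / s1 h].
  move=> [S1f SFf s1_gt0].
  have sumE : (\sum_(0 <= i <oo) (c h i * gauss ip (beta h) (y h i - pi (y h i)))%:E =
      S (fun=> 1%R) h)%E.
    by rewrite S1E; apply: eq_eseriesr => i _; rewrite /den /z closestE.
  have denE : (fun i => c h i * gauss ip (beta h) (y h i - pi (y h i))) = den h.
    by apply/funext => i; rewrite /den /z closestE.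
  have numE : (fun i => c h i * gauss_smoothing ip m0 (beta h) f (pi (y h i)) *
      gauss ip (beta h) (y h i - pi (y h i))) = num h.
    apply/funext => i; rewrite /num /fhi /z closestE /smoothed_value /gauss_mass_on -m0E.
    by [].
  have s1E : s1 h = fine (S (fun=> 1%R) h) by rewrite /s1 S1E.
  have massh : (0 < \sum_(0 <= i <oo) (c h i * gauss ip (beta h) (y h i - pi (y h i)))%:E < +oo)%E.
    by rewrite sumE -(fineK S1f) -s1E lte_fin s1_gt0 ltry.
  have := thermal_expectation lin linV E0V E0P VP m0_scale m0_ball m0_gt0 mEC mE_m0
    (c_ge0 h) (A_partition h) (yA h) (beta_gt0 h) (B_gt0 h) cf fM massh.
  rewrite -/pi sumE denE numE -s1E -muE.
  by [].
split.
  apply: filterS large => h /key[mass_h cnum cden ->]; split => //.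
  - exact: cvgP cnum.
  - exact: cvgP cden.
  - by rewrite (cvg_lim (@Rhausdorff R) cnum) (cvg_lim (@Rhausdorff R) cden).
(* Linearity is applied to the integrable representatives [gF] and [g1], since the product of f and
   [L_D] need not be Borel. *)
have fL : (\int[mE]_xi (f xi * L_D xi)%:E)%E = (lF - M * l1)%:E.
  have [gF iF eF] := intF; have [g1 i1 e1] := int1.
  have eF' : {ae mE, forall xi, (F xi * L_D xi)%:E = gF xi} by apply: filterS eF => xi; exact.
  have e1' : {ae mE, forall xi, (1 * L_D xi)%:E = g1 xi} by apply: filterS e1 => xi; exact.
  have efL : {ae mE, forall xi, (f xi * L_D xi)%:E = (gF xi - M%:E * g1 xi)%E}.
    apply: filterS2 eF' e1' => xi <- <-; rewrite -EFinM -EFinB; congr (_%:E).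
    by rewrite /F; ring.
  rewrite (ae_eq_integral_any efL) integralB//; last exact: integrableZl.
  rewrite integralZl// -(ae_eq_integral_any eF') -(ae_eq_integral_any e1') lFE L_int l1E.
  by rewrite -EFinM -EFinB.
have -> : limit_expectation ip N E L_D f =
    (kappa * (lF * G) - M * (kappa * (l1 * G))) / (kappa * (l1 * G)).
  rewrite /limit_expectation -mEE fL l1E /=; field.
  by rewrite !gt_eqF.
have : ((fine \o (fun h => (t h ^+ N)%:E * S F h)%E) h - M * (fine \o (fun h =>
  (t h ^+ N)%:E * S (fun=> 1%R) h)%E) h)
    / (fine \o (fun h => (t h ^+ N)%:E * S (fun=> 1%R) h)%E) h @[h --> \oo] -->
    (kappa * (lF * G) - M * (kappa * (l1 * G))) / (kappa * (l1 * G)).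
  apply: cvgM; last by apply: cvgV => //; rewrite gt_eqF.
  by apply: cvgB => //; exact: cvgMl_tmp.
(* For large h the factor [t h ^+ N] is common to numerator and denominator and cancels. *)
apply: cvg_trans; apply: near_eq_cvg; apply: filterS large => h lh.
have [_ _ _ ->] := key h lh; have [S1f SFf s1_gt0] := lh.
have s1E : s1 h = fine (S (fun=> 1%R) h) by rewrite /s1 S1E.
have tN_fin : (t h ^+ N)%:E \is a fin_num by [].
rewrite /comp (fineM tN_fin SFf) (fineM tN_fin S1f) -s1E /=; field.
by rewrite !gt_eqF.
Qed.
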